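(* Let $H$ be a separable real Hilbert space, $x\in H$, and let $A\in\mathcal S_2(H)_{\rm sk}$ have positive skew singular values $a_1\ge a_2\ge\cdots$. Let $\mathscr E(x,A)=\exp_\wedge(x+2\alpha_A)=\sum_{k\ge0}\Xi_k(x,A)$ by homogeneous degree and define $\mathscr D_A(z):=\prod_{j\ge1}(1+za_j^2)$, $z\in\mathbb C$. Then $$\mathscr D_A(z)=\sum_{N\ge0}\frac{z^N}{4^N}\|\Xi_{2N}(x,A)\|^2,\qquad\det(\operatorname{Id}+zA^*A)=\mathscr D_A(z)^2.$$ In particular, the even energy sequence $(\|\Xi_{2N}\|^2)_N$ determines the complete multiset of nonzero positive skew singular values. For $z>0$, $$\sum_{N\ge0}\frac{z^N}{4^N}\|\Xi_{2N+1}(x,A)\|^2=\mathscr D_A(z)\bigl\langle(\operatorname{Id}+zA^*A)^{-1}x,x\bigr\rangle.$$ In particular, $$\|\mathscr E(x,A)\|_{\mathscr F^\wedge}^2=\mathscr D_A(4)\bigl(1+\langle(\operatorname{Id}+4A^*A)^{-1}x,x\rangle\bigr)$$ (so the bound $\|\mathscr E(x,A)\|^2_{\mathscr F^\wedge}\le(1+\|x\|^2)\exp(4\|\alpha_A\|^2)$ follows from $\mathscr D_A(4)\le\exp(4\|\alpha_A\|^2)$ and $(\operatorname{Id}+4A^*A)^{-1}\preceq\operatorname{Id}$). Consequently, after the even sequence has determined $\mathscr D_A$, the odd sequence $(\|\Xi_{2N+1}\|^2)_N$ determines the cyclic spectral measure $\nu_{x,A}(B):=\langle E_{A^*A}(B)x,x\rangle$,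 $B\subset[0,\infty)$ Borel, through, for $z>0$, $$\frac{\sum_{N\ge0}4^{-N}z^N\|\Xi_{2N+1}(x,A)\|^2}{\mathscr D_A(z)}=\int_{[0,\infty)}\frac{1}{1+z\lambda}\,d\nu_{x,A}(\lambda).$$ Thus the scalar even--odd exterior response recovers the singular spectrum of $A$ and the energy of $x$ in every $A^*A$-spectral subspace; directions inside a degenerate spectral subspace remain unresolved by these scalar spectral data.
   Context: $\mathcal S_2(H)_{\rm sk}$: skew-adjoint Hilbert--Schmidt operators. The positive skew singular values $a_j$ are those of the real skew spectral decomposition: $A$ acts as $a_j$ times a rotation generator on mutually orthogonal two-planes $E_j$ and vanishes on the orthogonal complement (each nonzero singular value of $A$ thus appears twice). $E_{A^*A}$ is the spectral measure of $A^*A$; $\det$ is the Fredholm determinant. $\mathscr F^\wedge(H)=\bigoplus_{k\ge0}^{\ell^2}\bigwedge^kH$ is the Hilbert exterior Fock space, normalized so that increasing wedges of an orthonormal basis are orthonormal; $\exp_\wedge$ is the exponential for exterior multiplication; $\alpha_A=\sum_{i<j}\langle Ae_j,e_i\rangle e_i\wedge e_j$ for an orthonormal basis $(e_j)$, so $\|\alpha_A\|^2=\frac12\|A\|_{\mathcal S_2}^2$. *)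

(* Defs.v *)
From HB Require Import structures.
From mathcomp Require Import all_boot all_order all_algebra finmap sesquilinear.
From mathcomp Require Import all_classical all_reals all_analysis.
From mathcomp Require Import complex.
From mathcomp.analysis.showcase Require Import summability.

Set Implicit Arguments.
Unset Strict Implicit.
Unset Printing Implicit Defensive.

Import Order.TTheory GRing.Theory Num.Theory numFieldNormedType.Exports.

Local Open Scope classical_set_scope.
Local Open Scope ring_scope.
Local Open Scope complex_scope.

Section HilbertSpace.
Context {R : realType} {H : completeNormedModType R}.
Implicit Types (ip : {dot H for idfun}) (A T : H -> H).

(* The norm of H is induced by the inner product; H is complete by its type. *)
Definition hilbert_inner ip := forall u : H, ip u u = `|u| ^+ 2.

Definition separable := exists D : set H, countable D /\ dense D.

(* A maximal orthonormal family; the index type may be finite or infinite. *)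
Definition orthonormal_basis ip (J : choiceType) (e : J -> H) :=
  (forall i j, ip (e i) (e j) = (i == j)%:R) /\
  (forall y, (forall i, ip y (e i) = 0) -> y = 0).

Definition hilbert_schmidt ip (A : {linear H -> H}) :=
  continuous A /\
  exists (J : choiceType) (e : J -> H), orthonormal_basis ip e /\
    (\esum_(j in [set: J]) (`|A (e j)| ^+ 2)%:E < +oo)%E.

Definition skew_adjoint ip A := forall u v, ip (A u) v = - ip u (A v).

(* By nondegeneracy of [ip] there is at most one such [w], and there is one
   whenever [A] is linear and continuous (Riesz); 0 is only a default value. *)
Definition adjoint ip A : H -> H :=
  fun v => xget 0 [set w | forall u, ip (A u) v = ip u w].

(* [a] lists the positive skew singular values with multiplicity, in
   nonincreasing order, and is padded with zeros if there are finitely many.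
   Only the indices [j] with [a j > 0] carry a plane [span (u j, v j)]. *)
Definition skew_singular_values ip A (a : nat -> R) :=
  [/\ forall j, 0 <= a j,
      forall i j, (i <= j)%N -> a j <= a i &
      exists u v : nat -> H,
      [/\ forall i j, 0 < a i -> 0 < a j ->
            [/\ ip (u i) (u j) = (i == j)%:R, ip (v i) (v j) = (i == j)%:R &
                ip (u i) (v j) = 0],
          forall j, 0 < a j ->
            A (u j) = a j *: v j /\ A (v j) = - (a j *: u j) &
          forall y, (forall j, 0 < a j -> ip y (u j) = 0 /\ ip y (v j) = 0) ->
            A y = 0]].

(* [(Id + z T)^-1], meaningful when [Id + z T] is bijective. *)
Definition resolvent T (z : R) : H -> H :=
  'pinv_(fun=> 0) setT (fun y => y + z *: T y).

End HilbertSpace.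

Section SpectralMeasure.
Context {R : realType} {H : completeNormedModType R}.
Variable ip : {dot H for idfun}.

(* Projection-valued measures on the Borel sets of the real line. *)
Record pvm := Pvm {
  pvm_proj :> set R -> {linear H -> H};
  pvm_sym : forall B, measurable B ->
    forall u v, ip (pvm_proj B u) v = ip u (pvm_proj B v);
  pvm_setI : forall B C, measurable B -> measurable C ->
    forall u, pvm_proj (B `&` C) u = pvm_proj B (pvm_proj C u);
  pvm_set0 : forall u, pvm_proj set0 u = 0;
  pvm_setT : forall u, pvm_proj setT u = u;
  pvm_sigma : forall F : nat -> set R,
    (forall n, measurable (F n)) -> trivIset setT F ->
    forall u v, (fun n => \sum_(0 <= i < n) ip (pvm_proj (F i) u) v) @ \oo -->
                ip (pvm_proj (\bigcup_n F n) u) v }.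

Variables (E : pvm) (x : H).

(* The value on non-measurable sets is irrelevant. *)
Definition cyclic_measure (B : set R) : \bar R :=
  if `[< measurable B >] then (ip (E B x) x)%:E else 0%E.

Let cyclic_measure0 : cyclic_measure set0 = 0%E.
Proof.
by rewrite /cyclic_measure; case: asboolP => // _; rewrite pvm_set0 linear0l.
Qed.

Let cyclic_measure_ge0 B : (0 <= cyclic_measure B)%E.
Proof.
rewrite /cyclic_measure; case: asboolP => // mB; rewrite lee_fin.
rewrite -[X in E X]setIid pvm_setI// pvm_sym//.
have [->|/neq0_dnorm_gt0/ltW//] := eqVneq (E B x) 0.
by rewrite linear0l.
Qed.

Let cyclic_measure_sigma : semi_sigma_additive cyclic_measure.
Proof.
move=> F mF tF mUF; rewrite /cyclic_measure; case: asboolP => // _.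
under eq_fun => n do (under eq_bigr => i _ do rewrite asboolT//; rewrite sumEFin).
by apply: cvg_EFin; [exact: nearW | exact: pvm_sigma].
Qed.

HB.instance Definition _ := isMeasure.Build _ _ _ cyclic_measure
  cyclic_measure0 cyclic_measure_ge0 cyclic_measure_sigma.

End SpectralMeasure.

(* [T] is the integral of [l] against [E], in the weak sense; for a symmetric
   [T] the diagonal entries suffice, by polarization. *)
Definition spectral_measure_of {R : realType} {H : completeNormedModType R}
    (ip : {dot H for idfun}) (T : H -> H) (E : pvm ip) :=
  forall u, (cyclic_measure E u).-integrable setT EFin /\
    \int[cyclic_measure E u]_l l = ip (T u) u.

(* The exterior Fock space of a Hilbert space with an orthonormal basis [e]
   indexed by a totally ordered [J], in coordinates: [w S] is the coefficient
   of [w] on the increasing wedge [e_S = e_i1 /\ ... /\ e_ik],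
   [S = {i1 < ... < ik}], and these wedges are orthonormal. *)
Section ExteriorFock.
Context {R : realType} {d : Order.disp_t} {J : orderType d}.
Implicit Types (S T U : {fset J}) (v w : {fset J} -> R).

Definition increasing S : seq J := sort <=%O S.

Definition fock_norm2 w : \bar R := (\esum_(S in [set: {fset J}]) (w S ^+ 2)%:E)%E.
Definition in_fock w := (fock_norm2 w < +oo)%E.
Definition fock_norm w : R := Num.sqrt (fine (fock_norm2 w)).

Definition homogeneous (k : nat) w : {fset J} -> R :=
  fun S => if #|` S| == k then w S else 0.

(* [e_T /\ e_U = (-1) ^ inversions T U * e_(T u U)] for disjoint [T] and [U]. *)
Definition inversions T U : nat :=
  (\sum_(t <- T) count (fun u => (u < t)%O) U)%N.

Definition wedge v w : {fset J} -> R := fun S =>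
  \sum_(T <- fpowerset S) (-1) ^+ inversions T (S `\` T)%fset *
    (v T * w (S `\` T)%fset).

Definition wedge_pow (n : nat) w : {fset J} -> R :=
  iter n (wedge w) (fun S => (S == fset0)%:R).

Definition exp_wedge w : {fset J} -> R :=
  fun S => limn (series (fun n => wedge_pow n w S / n`!%:R)).

End ExteriorFock.

Section Response.
Context {R : realType} {H : completeNormedModType R}.
Variable ip : {dot H for idfun}.
Context {d : Order.disp_t} {J : orderType d}.
Variable e : J -> H.

Definition fock_vec (x : H) : {fset J} -> R := fun S =>
  if increasing S is [:: i] then ip x (e i) else 0.

Definition fock_alpha (A : H -> H) : {fset J} -> R := fun S =>
  if increasing S is [:: i; j] then ip (A (e j)) (e i) else 0.

Definition response (x : H) (A : H -> H) : {fset J} -> R :=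
  exp_wedge (fun S => fock_vec x S + 2 * fock_alpha A S).

Definition Xi (k : nat) (x : H) (A : H -> H) : {fset J} -> R :=
  homogeneous k (response x A).

Definition energy (x : H) (A : H -> H) (k : nat) : R :=
  fock_norm (Xi k x A) ^+ 2.

(* The diagonal entry of the [k]-th exterior power of [T], [k = #|S|], at the
   increasing wedge [e_S]. *)
Definition principal_minor (T : H -> H) (S : {fset J}) : R :=
  let s := in_tuple (increasing S) in
  \det (\matrix_(i < size s, j < size s)
          ip (T (e (tnth s j))) (e (tnth s i))).

(* [delta = det (Id + z T)], the sum over [k] of [z ^ k tr (/\^k T)]; for
   non-real [z] this is the determinant on the complexification of [H]. *)
Definition is_fredholm_det (T : H -> H) (z delta : R[i]^o) :=
  exists t : nat -> R,
    (forall k, partial_sum (homogeneous k (principal_minor T)) @ totally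
       --> t k) /\
    (series (fun k => z ^+ k * (t k)%:C) : nat -> R[i]^o) @ \oo --> delta.

End Response.

Section ComplexSeries.
Context {R : realType}.

Definition skew_det_partial (a : nat -> R) (z : R[i]^o) : nat -> R[i]^o :=
  fun n => \prod_(j < n) (1 + z * (a j ^+ 2)%:C).

Definition skew_det (a : nat -> R) (z : R[i]^o) : R[i]^o :=
  limn (skew_det_partial a z).

Definition energy_series (b : nat -> R) (z : R[i]^o) : nat -> R[i]^o :=
  series (fun N => z ^+ N / 4 ^+ N * (b N)%:C).

End ComplexSeries.

(* Main.v *)
From HB Require Import structures.
From mathcomp Require Import all_boot all_order all_algebra finmap sesquilinear.
From mathcomp Require Import all_classical all_reals all_analysis.
From mathcomp Require Import measurable_realfun complex.
From mathcomp.analysis.showcase Require Import summability.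
From mathcomp Require Import ring lra zify.
Require Import Defs.

Set Implicit Arguments.
Unset Strict Implicit.
Unset Printing Implicit Defensive.

Import Order.TTheory GRing.Theory Num.Theory numFieldNormedType.Exports.

Local Open Scope classical_set_scope.
Local Open Scope ring_scope.
Local Open Scope complex_scope.

(** Let [u_k, v_k] be an orthonormal basis of the [k]-th plane of [A] and
    [c_k = a_k^2]. Then [2 alpha_A] is the sum of the two-forms
    [2 a_k (v_k /\ u_k)], which commute and square to zero, and wedging with [x]
    commutes with them and squares to zero too. Hence
    [exp (x + 2 alpha_A) = (1 + x) /\ prod_k (1 + 2 a_k (v_k /\ u_k))]: the part
    [Xi_2m] is the sum over the [m]-element sets of planes of the wedge products
    of these planes, and [Xi_(2m+1) = x /\ Xi_2m] (lemma [exp_wedgeE]).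

    The Fock norm is the limit of its parts on finite sets of coordinates. There
    exterior multiplication and contraction satisfy the canonical
    anticommutation relation, so that [|y /\ w|^2 = |y|^2 |w|^2 - |y _| w|^2]
    (lemma [nrm_vcre]). Contraction with a vector orthogonal to the planes in [w]
    gives zero in the limit; therefore norms multiply, different sets of planes
    give orthogonal terms, and only the component of [x] off the planes in [w]
    counts in [x /\ w]. Thus [|Xi_2m|^2 = 4^m e_m (c)] with the elementary
    symmetric function [e_m], and [|Xi_(2m+1)|^2] is [4^m] times the
    sum over [m]-element sets [U] of
    [prod_(k in U) c_k * (|x|^2 - sum_(k in U) |P_k x|^2)], with [P_k] the
    projection onto the [k]-th plane. The latter is the convolution of the [e_i]
    with the signed moments [(-1)^j <(A^* A)^j x, x>] (lemmas [energy_even] and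
    [energy_odd]). Since [e_m (c) <= (sum c)^m / m!], the generating series may be
    summed termwise (lemma [tannery]), which gives [D_A (z)] and
    [D_A (z) (|x|^2 - sum_k z c_k / (1 + z c_k) |P_k x|^2)], the form of the
    resolvent.

    For the Fredholm determinant, a principal minor of [A^* A] is a Gram
    determinant of rows of the matrix of [A] between the basis [e] and the frame
    [u_0, v_0, u_1, v_1, ...]. Exchanging the two bases in the sum of squares of
    minors, as in the Cauchy-Binet formula, turns the sum over the index sets of
    [e] into the elementary symmetric function of the eigenvalues, each [c_k]
    counted twice (lemma [fredholm_det]).

    The even energies give the coefficients of [prod_k (1 + z c_k)], whose zero of
    least modulus is [- 1 / c_0]; dividing by this factor and repeating recovers
    the sequence (lemma [einf_inj]). The odd energies then give all moments
    [<(A^* A)^j x, x>], and a discrete measure on the decreasing sequence [c] with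
    summable signed weights and vanishing moments is zero, because high moments
    are dominated by the largest value (lemma [discrete_unique]).

    A projection-valued measure with integral [A^* A] is diagonal along the
    frame. Indeed, if [T u = c u], then the part [y] of [u] on one side of [c]
    satisfies [<T y, y> = c |y|^2] as well, so the integral of [l - c] against its
    cyclic measure vanishes although the integrand has a sign; so [y = 0]
    (lemma [eigen_range]). Hence the cyclic measure is a sum of point masses at
    the [c_k] and at zero, from which the spectral formula can be read off
    (lemmas [pvm_explicit] and [spectral_formula]). *)

(** * Exterior multiplication and contraction in coordinates *)

Section FiniteFock.
Context {R : realType} {d : Order.disp_t} {J : orderType d}.
Implicit Types (i j : J) (F S T : {fset J}) (f v w : {fset J} -> R) (y : J -> R).

(** [e_i /\ e_S = sgf i S * e_(i |` S)] for [i] outside [S]. *)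
Definition sgf i S : R := (-1) ^+ count (fun t => (t < i)%O) S.

(** Exterior multiplication by [e_i]. *)
Definition cre i f : {fset J} -> R :=
  fun S => if i \in S then sgf i S * f (S `\ i)%fset else 0.

(** Contraction with [e_i], the adjoint of [cre i]. *)
Definition ann i f : {fset J} -> R :=
  fun S => if i \in S then 0 else sgf i S * f (i |` S)%fset.

Definition vcre y f : {fset J} -> R := fun S => \sum_(i <- S) y i * cre i f S.

(** Contraction with [y], cut off to the coordinates in [F]; over infinitely many
    coordinates the full sum would be a series. *)
Definition vann F y f : {fset J} -> R := fun S => \sum_(i <- F) y i * ann i f S.

(** The Fock inner product of the parts of [v] and [w] that live on the
    coordinates in [F]. On such a finite part the exterior algebra is finite
    dimensional, and everything about it is algebra. *)
Definition bil F v w : R := \sum_(S <- fpowerset F) v S * w S.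

Definition dotf F (y z : J -> R) : R := \sum_(i <- F) y i * z i.

Lemma sgf_sqr i S : sgf i S * sgf i S = 1.
Proof. by rewrite /sgf -expr2 sqrr_sign. Qed.

Lemma sgfU1 i j S : i \notin S -> sgf j (i |` S)%fset = sgf j S * (-1) ^+ (i < j)%O.
Proof.
move=> iS; rewrite /sgf -exprD; congr (_ ^+ _).
rewrite -!sum1_count big_mkcond /= big_fsetU1 //= -big_mkcond /= addnC.
by case: (i < j)%O.
Qed.

Lemma sgfD1 i j S : i \in S -> sgf j (S `\ i)%fset = sgf j S * (-1) ^+ (i < j)%O.
Proof.
move=> iS; rewrite -{2}(fsetD1K iS) sgfU1 ?fsetD11 //.
by rewrite -mulrA -expr2 sqrr_sign mulr1.
Qed.

Lemma sign_lt_neq i j : i != j -> (-1) ^+ (i < j)%O = - (-1) ^+ (j < i)%O :> R.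
Proof. by case: ltgtP => //= _ _; rewrite ?expr0 ?expr1 ?opprK. Qed.

Lemma cre_cre i j f S : cre i (cre j f) S = - cre j (cre i f) S.
Proof.
rewrite /cre !in_fsetD1; have [->|ij] := eqVneq i j.
  by case: ifP; rewrite /= ?mulr0 oppr0.
rewrite /=; case: ifP => iS; case: ifP => jS; rewrite ?mulr0 ?oppr0 //.
rewrite !sgfD1 // (sign_lt_neq ij).
have -> : ((S `\ j) `\ i = (S `\ i) `\ j)%fset by rewrite !fsetDDl fsetUC.
ring.
Qed.

Lemma ann_cre i j f S : i != j -> ann i (cre j f) S = - cre j (ann i f) S.
Proof.
move=> ij; rewrite /ann /cre !inE (eq_sym j) (negbTE ij) /=.
case: ifP => iS; case: ifP => jS; rewrite ?mulr0 ?oppr0 //.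
rewrite sgfU1 ?iS // sgfD1 // (sign_lt_neq ij).
have -> : ((i |` S) `\ j = i |` (S `\ j))%fset.
  by apply/fsetP => k; rewrite !inE; case: (eqVneq k i) => // ->; rewrite ij.
ring.
Qed.

Lemma ann_creE i f S : ann i (cre i f) S + cre i (ann i f) S = f S.
Proof.
rewrite /ann /cre !inE eqxx /=; case: ifP => iS.
  by rewrite add0r sgfD1 // ltxx expr0 mulr1 mulrA sgf_sqr mul1r fsetD1K.
by rewrite addr0 sgfU1 ?iS // ltxx expr0 mulr1 mulrA sgf_sqr mul1r fsetU1K ?iS.
Qed.

Lemma vcreE F y f S : (S `<=` F)%fset -> vcre y f S = \sum_(i <- F) y i * cre i f S.
Proof.
move=> SF; rewrite /vcre; apply: big_fset_incl => // i iF iS.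
by rewrite /cre (negbTE iS) mulr0.
Qed.

Lemma cre_lin i (I : Type) (r : seq I) (c : I -> R) (g : I -> {fset J} -> R) S :
  cre i (fun S => \sum_(k <- r) c k * g k S) S = \sum_(k <- r) c k * cre i (g k) S.
Proof.
rewrite /cre; case: ifP => _; last by rewrite big1 // => k _; rewrite mulr0.
by rewrite mulr_sumr; apply: eq_bigr => k _; rewrite mulrCA.
Qed.

Lemma ann_lin i (I : Type) (r : seq I) (c : I -> R) (g : I -> {fset J} -> R) S :
  ann i (fun S => \sum_(k <- r) c k * g k S) S = \sum_(k <- r) c k * ann i (g k) S.
Proof.
rewrite /ann; case: ifP => _; first by rewrite big1 // => k _; rewrite mulr0.
by rewrite mulr_sumr; apply: eq_bigr => k _; rewrite mulrCA.
Qed.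

Definition axpy v (c : R) w : {fset J} -> R := fun S => v S + c * w S.

Definition agree F v w := forall S, (S `<=` F)%fset -> v S = w S.

Lemma cre_axpy i v c w S : cre i (axpy v c w) S = cre i v S + c * cre i w S.
Proof. by rewrite /cre /axpy; case: ifP => _; [ring | rewrite mulr0 addr0]. Qed.

Lemma ann_axpy i v c w S : ann i (axpy v c w) S = ann i v S + c * ann i w S.
Proof. by rewrite /ann /axpy; case: ifP => _; [rewrite mulr0 addr0 | ring]. Qed.

Lemma vcre_axpy y v c w : vcre y (axpy v c w) = axpy (vcre y v) c (vcre y w).
Proof.
apply/funext => S; rewrite /vcre {2}/axpy mulr_sumr -big_split /=.
by apply: eq_bigr => i _; rewrite cre_axpy; ring.
Qed.

Lemma vann_axpy F y v c w : vann F y (axpy v c w) = axpy (vann F y v) c (vann F y w).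
Proof.
apply/funext => S; rewrite /vann {2}/axpy mulr_sumr -big_split /=.
by apply: eq_bigr => i _; rewrite ann_axpy; ring.
Qed.

Lemma vcre_local F y v w : agree F v w -> agree F (vcre y v) (vcre y w).
Proof.
move=> vw S SF; apply: eq_bigr => i _; congr (_ * _); rewrite /cre.
by case: ifP => // _; rewrite vw // (fsubset_trans _ SF) // fsubD1set.
Qed.

Lemma eq_bil F v v' w w' : agree F v v' -> agree F w w' -> bil F v w = bil F v' w'.
Proof.
move=> vv' ww'; apply: eq_big_seq => S; rewrite fpowersetE => SF.
by rewrite vv' // ww'.
Qed.

Lemma bilC F v w : bil F v w = bil F w v.
Proof. by apply: eq_bigr => S _; rewrite mulrC. Qed.

Lemma bil_axpyl F v c w u : bil F (axpy v c w) u = bil F v u + c * bil F w u.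
Proof.
by rewrite /bil mulr_sumr -big_split; apply: eq_bigr => S _; rewrite /axpy /=; ring.
Qed.

Lemma bil_axpyr F v c w u : bil F u (axpy v c w) = bil F u v + c * bil F u w.
Proof. by rewrite bilC bil_axpyl bilC (bilC _ w). Qed.

(** [S |-> i |` S] is a bijection from the subsets of [F] without [i] onto those
    with [i]. *)
Lemma cre_adjoint F i v w : i \in F -> bil F (cre i v) w = bil F v (ann i w).
Proof.
move=> iF; rewrite /bil.
rewrite (bigID (fun U : {fset J} => i \in U)) /= [X in _ + X]big1 ?addr0; last first.
  by move=> S /negbTE iS; rewrite /cre iS mul0r.
rewrite [RHS](bigID (fun U : {fset J} => i \notin U)) /= [X in _ = _ + X]big1 ?addr0; last first.
  by move=> S; rewrite negbK => iS; rewrite /ann iS mulr0.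
rewrite -big_filter -[RHS]big_filter.
have pi : perm_eq [seq U : {fset J} <- fpowerset F | i \in U]
    [seq (i |` U)%fset | U : {fset J} <- [seq U : {fset J} <- fpowerset F | i \notin U]].
  apply: uniq_perm.
  - by rewrite filter_uniq // fset_uniq.
  - rewrite map_inj_in_uniq ?filter_uniq ?fset_uniq // => S T.
    rewrite !mem_filter => /andP[iS _] /andP[iT _] /(congr1 (fun U => U `\ i)%fset).
    by rewrite !fsetU1K.
  - move=> S; rewrite mem_filter; apply/andP/mapP => [[iS SF]|[T]].
      exists (S `\ i)%fset; last by rewrite fsetD1K.
      rewrite mem_filter fsetD11 /= fpowersetE; rewrite fpowersetE in SF.
      by rewrite (fsubset_trans _ SF) // fsubD1set.
    rewrite mem_filter !fpowersetE => /andP[_ TF] ->; rewrite fset1U1; split=> //.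
    by rewrite fsubUset fsub1set iF.
rewrite (perm_big _ pi) big_map big_seq [RHS]big_seq; apply: eq_bigr => S.
rewrite mem_filter => /andP[iS _]; rewrite /cre /ann fset1U1 (negbTE iS).
by rewrite fsetU1K // sgfU1 // ltxx expr0; ring.
Qed.

Lemma vcre_adjoint F y v w : bil F (vcre y v) w = bil F v (vann F y w).
Proof.
transitivity (\sum_(i <- F) y i * bil F (cre i v) w).
  rewrite /bil; under [RHS]eq_bigr do rewrite mulr_sumr.
  rewrite exchange_big /=; apply: eq_big_seq => S; rewrite fpowersetE => SF.
  by rewrite (vcreE _ _ SF) mulr_suml; apply: eq_bigr => i _; rewrite mulrA.
rewrite (eq_big_seq (fun i => y i * bil F v (ann i w))); last first.
  by move=> i iF; rewrite cre_adjoint.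
rewrite /bil; under eq_bigr do rewrite mulr_sumr.
rewrite exchange_big /=; apply: eq_bigr => S _.
by rewrite /vann mulr_sumr; apply: eq_bigr => i _; rewrite mulrCA.
Qed.

Lemma vcreC y z f S : vcre y (vcre z f) S = - vcre z (vcre y f) S.
Proof.
have E x x' : vcre x (vcre x' f) S =
    \sum_(i <- S) \sum_(j <- S) x i * (x' j * cre i (cre j f) S).
  apply: eq_bigr => i _; rewrite -mulr_sumr; congr (_ * _).
  rewrite -cre_lin /cre; case: ifP => // _; congr (_ * _).
  by rewrite (vcreE _ _ (fsubD1set _ _)).
rewrite !E exchange_big -sumrN; apply: eq_bigr => j _; rewrite -sumrN.
by apply: eq_bigr => i _; rewrite cre_cre; ring.
Qed.

Lemma vcre_sqr0 y f S : vcre y (vcre y f) S = 0.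
Proof. by have := vcreC y y f S; lra. Qed.

(** The canonical anticommutation relation between contraction with [y] and
    multiplication by [z]. It holds on the subsets of [F] with the inner product
    over [F], which is why the truncation is harmless. *)
Lemma vann_vcre F y z f S : (S `<=` F)%fset ->
  vann F y (vcre z f) S = dotf F y z * f S - vcre z (vann F y f) S.
Proof.
move=> SF; apply/eqP; rewrite eq_sym subr_eq eq_sym; apply/eqP.
have -> : vann F y (vcre z f) S =
    \sum_(i <- F) \sum_(j <- F) y i * (z j * ann i (cre j f) S).
  apply: eq_big_seq => i iF; rewrite -mulr_sumr; congr (_ * _).
  rewrite -ann_lin /ann; case: ifP => // _; congr (_ * _); apply: vcreE.
  by rewrite fsubUset fsub1set iF.
rewrite (vcreE _ _ SF) /vann.
under [X in _ + X]eq_bigr do rewrite cre_lin mulr_sumr.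
rewrite [X in _ + X]exchange_big -big_split /dotf mulr_suml /=.
apply: eq_big_seq => i iF; rewrite -big_split /=.
rewrite (big_fsetD1 i) //= big1_seq ?addr0; last first.
  move=> j /andP[_]; rewrite !inE => /andP[ji _].
  by rewrite ann_cre 1?eq_sym //; ring.
by rewrite -[in RHS](ann_creE i f S); ring.
Qed.

Definition nrm F w : R := bil F w w.

Lemma nrm_ge0 F w : 0 <= nrm F w.
Proof. by apply: sumr_ge0 => S _; rewrite -expr2 sqr_ge0. Qed.

(** Lagrange's identity writes the defect as a sum of squares. *)
Lemma bil_CS F v w : bil F v w ^+ 2 <= nrm F v * nrm F w.
Proof.
rewrite -subr_ge0 -(pmulrn_lge0 _ (isT : (0 < 2)%N)).
suff -> : (nrm F v * nrm F w - bil F v w ^+ 2) *+ 2 =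
    \sum_(S <- fpowerset F) \sum_(T <- fpowerset F) (v S * w T - v T * w S) ^+ 2.
  by apply: sumr_ge0 => S _; apply: sumr_ge0 => T _; rewrite sqr_ge0.
rewrite expr2 mulr2n {2}[nrm F v * _]mulrC /nrm /bil !big_distrl /=.
rewrite -!sumrB -big_split /=; apply: eq_bigr => S _.
rewrite !big_distrr -!sumrB -big_split /=; apply: eq_bigr => T _; ring.
Qed.

Lemma nrm_axpy F v c w : nrm F (axpy v c w) = nrm F v + 2 * c * bil F v w + c ^+ 2 * nrm F w.
Proof. by rewrite /nrm !(bil_axpyl, bil_axpyr) (bilC _ w v); ring. Qed.

(** The anticommutation relation inside the inner product: a wedge product has
    the product norm up to the norm of the contraction. All norm computations
    below rest on this identity. *)
Lemma nrm_vcre F y w :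
  nrm F (vcre y w) = dotf F y y * nrm F w - nrm F (vann F y w).
Proof.
have : bil F w (axpy (vann F y (vcre y w)) 1 (vcre y (vann F y w))) =
    dotf F y y * nrm F w.
  rewrite /nrm /bil mulr_sumr; apply: eq_big_seq => S; rewrite fpowersetE => SF.
  by rewrite /axpy vann_vcre //; ring.
rewrite bil_axpyr mul1r [X in _ + X]bilC vcre_adjoint -/(nrm F (vann F y w)) => <-.
by rewrite /nrm vcre_adjoint; ring.
Qed.

End FiniteFock.

(** * Wedging with forms of degree one and two *)

Section WedgeOperators.
Context {R : realType} {d : Order.disp_t} {J : orderType d}.
Implicit Types (i j : J) (F S T : {fset J}) (f v w : {fset J} -> R) (y : J -> R).

Lemma mem_increasing S i : (i \in increasing S) = (i \in S).
Proof. by rewrite mem_sort. Qed.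

Lemma increasing_sorted S : sorted <%O (increasing S).
Proof.
rewrite lt_sorted_uniq_le sort_uniq fset_uniq /=.
by apply: sort_sorted; exact: le_total.
Qed.

Lemma increasing_eq S (s : seq J) : sorted <%O s ->
  (increasing S == s) = (S == [fset k | k in s]%fset).
Proof.
move=> ss; apply/eqP/eqP => [<-|->].
  by apply/fsetP => k; rewrite !inE /= mem_increasing.
apply: lt_sorted_eq => // [|k]; first exact: increasing_sorted.
by rewrite mem_increasing !inE.
Qed.

Lemma size_increasing S : size (increasing S) = #|` S|.
Proof. by rewrite size_sort. Qed.

Lemma big_delta (K : choiceType) (F : {fset K}) (x : K) (g : K -> R) : x \in F ->
  \sum_(t <- F) (t == x)%:R * g t = g x.
Proof.
move=> xF; rewrite (big_fsetD1 x) //= eqxx mul1r big1_seq ?addr0 // => t.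
by rewrite !inE => /andP[_ /andP[/negbTE-> _]]; rewrite mul0r.
Qed.

Definition form1 y S : R := if increasing S is [:: i] then y i else 0.

Definition form2 (b : J -> J -> R) S : R :=
  if increasing S is [:: i; j] then b i j else 0.

(** The sign of [e_T /\ e_S] is obtained by moving the factors of [e_T] one at a
    time past those of [e_S]. *)
Lemma sign_inversions T S : (-1) ^+ inversions T S = \prod_(t <- T) sgf t S :> R.
Proof.
rewrite /inversions; elim: (T : seq J) => [|t s IH]; first by rewrite !big_nil.
by rewrite !big_cons exprD IH.
Qed.

(** Only singletons [T] contribute to the wedge product with a one-form. *)
Lemma wedge_form1 y f : wedge (form1 y) f = vcre y f.
Proof.
apply/funext => S; rewrite /wedge /vcre.
transitivity (\sum_(T <- fpowerset S) \sum_(i <- S) (T == [fset i]%fset)%:R *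
    (y i * (sgf i S * f (S `\ i)%fset))).
  apply: eq_big_seq => T; rewrite fpowersetE => TS; rewrite /form1.
  case iT: (increasing T) => [|a [|b l]].
  - rewrite mul0r mulr0 big1_seq // => i _.
    case: eqP => [Ti|_]; last by rewrite mul0r.
    by move: (mem_increasing T i); rewrite iT Ti !inE eqxx.
  - have TE : T = [fset a]%fset.
      by apply/fsetP => k; rewrite -mem_increasing iT !inE /= ?orbF.
    rewrite TE sign_inversions big_seq_fset1.
    rewrite (eq_bigr (fun i => (i == a)%:R * (y i * (sgf i S * f (S `\ i)%fset)))).
      rewrite big_delta; last by rewrite -fsub1set -TE.
      have aS : a \in S by rewrite -fsub1set -TE.
      by rewrite sgfD1 // ltxx /= expr0; ring.
    move=> i _; congr ((nat_of_bool _)%:R * _); apply/eqP/eqP => [/fsetP/(_ a)|->//].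
    by rewrite !inE eqxx => /esym/eqP.
  - rewrite mul0r mulr0 big1_seq // => i _.
    case: eqP => [Ti|_]; last by rewrite mul0r.
    by move: (size_increasing T); rewrite iT Ti cardfs1.
rewrite exchange_big /=; apply: eq_big_seq => i iS.
rewrite big_delta ?fpowersetE ?fsub1set //.
by rewrite /cre iS.
Qed.

Lemma increasing2 i j : (i < j)%O -> increasing [fset i; j]%fset = [:: i; j].
Proof.
move=> ij; apply/eqP; rewrite increasing_eq /= ?ij //; apply/eqP/fsetP => k.
by rewrite !inE /= orbF.
Qed.

(** Only pairs [T] contribute to the wedge product with a two-form. *)
Lemma wedge_form2 b f S : wedge (form2 b) f S =
  \sum_(i <- S) \sum_(j <- S | (i < j)%O) b i j * cre i (cre j f) S.
Proof.
rewrite /wedge.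
transitivity (\sum_(T <- fpowerset S) \sum_(i <- S) \sum_(j <- S | (i < j)%O)
    (T == [fset i; j]%fset)%:R * (b i j * cre i (cre j f) S)).
  apply: eq_big_seq => T; rewrite fpowersetE => TS; rewrite /form2.
  have [[i [j [iS jS ij iT]]]|nT] := pselect (exists i j,
      [/\ i \in S, j \in S, (i < j)%O & increasing T = [:: i; j]]).
    rewrite iT (eq_bigr (fun i' => (i' == i)%:R *
        \sum_(j' <- S | (i < j')%O) (j' == j)%:R * (b i j' * cre i (cre j' f) S))).
      rewrite big_delta // big_mkcond /=.
      rewrite (eq_bigr (fun j' => (j' == j)%:R *
          (if (i < j')%O then b i j' * cre i (cre j' f) S else 0))); last first.
        by move=> j' _; case: ifP => // _; rewrite mulr0.
      rewrite big_delta // ij.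
      have -> : T = [fset i; j]%fset.
        by apply/fsetP => k; rewrite -mem_increasing iT !inE /= ?orbF.
      have ji : i != j by rewrite (lt_eqF ij).
      rewrite sign_inversions big_fsetU1 ?inE //= big_seq_fset1.
      have jS' : j \in (S `\ i)%fset by rewrite !inE eq_sym ji.
      rewrite /cre iS jS' -fsetDDl !sgfD1 // !ltxx ij (ltNge j) (ltW ij) /=.
      by rewrite expr0 expr1; ring.
    move=> i' _; rewrite mulr_sumr.
    have [->|ii'] := eqVneq i' i.
      apply: eq_bigr => j' ij'; rewrite mul1r; congr ((nat_of_bool _)%:R * _).
      apply/eqP/eqP => [TE|->].
        by move: iT; rewrite TE increasing2 // => -[].
      by apply/fsetP => k; rewrite -mem_increasing iT !inE ?orbF.
    rewrite !big1 // => j' ij'; first by rewrite mul0r.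
    case: eqP => [TE|_]; last by rewrite mul0r.
    by move: iT ii'; rewrite TE increasing2 // => -[->]; rewrite eqxx.
  rewrite [RHS]big1_seq.
    case iT: (increasing T) => [|i [|j [|k l]]]; rewrite ?mul0r ?mulr0 //.
    case: nT; exists i, j; split=> //.
    - by apply: (fsubsetP TS); rewrite -mem_increasing iT !inE eqxx.
    - by apply: (fsubsetP TS); rewrite -mem_increasing iT !inE eqxx /= ?orbT.
    - by have := increasing_sorted T; rewrite iT /= andbT.
  move=> i /andP[_ iS]; apply: big1_seq => j /andP[ij jS].
  case: eqP => [TE|_]; last by rewrite mul0r.
  by case: nT; exists i, j; split=> //; rewrite TE increasing2.
rewrite exchange_big /=; apply: eq_big_seq => i iS.
rewrite exchange_big /= big_seq_cond [RHS]big_seq_cond; apply: eq_bigr => j /andP[jS ij].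
by rewrite big_delta // fpowersetE fsubUset !fsub1set iS.
Qed.

(** [form2 (fun i j => p i * q j - p j * q i)] is [p /\ q]; the terms with [j < i]
    are folded onto those with [i < j] by the anticommutation of [cre]. *)
Lemma wedge_form2_decomposable (p q : J -> R) f :
  wedge (form2 (fun i j => p i * q j - p j * q i)) f = vcre p (vcre q f).
Proof.
apply/funext => S; rewrite wedge_form2.
have -> : vcre p (vcre q f) S =
    \sum_(i <- S) \sum_(j <- S) p i * q j * cre i (cre j f) S.
  apply: eq_bigr => i _; under [RHS]eq_bigr do rewrite -mulrA.
  rewrite -mulr_sumr -cre_lin; congr (_ * _).
  rewrite /cre; case: ifP => // _; congr (_ * _).
  by rewrite (vcreE _ _ (fsubD1set _ _)).
have -> : \sum_(i <- S) \sum_(j <- S) p i * q j * cre i (cre j f) S =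
    \sum_(i <- S) \sum_(j <- S | (i < j)%O) p i * q j * cre i (cre j f) S +
    \sum_(i <- S) \sum_(j <- S | (j < i)%O) p i * q j * cre i (cre j f) S.
  rewrite -big_split /=; apply: eq_bigr => i _.
  rewrite (bigID (fun j => (i < j)%O)) /=; congr (_ + _).
  rewrite big_mkcond [RHS]big_mkcond; apply: eq_bigr => j _ /=.
  case: ltgtP => //= ->; have := cre_cre j j f S; set c := cre _ _ _ => E.
  have -> : c = 0 by lra.
  by rewrite mulr0.
rewrite [X in _ = _ + X](exchange_big_dep xpredT) //= -big_split /=.
apply: eq_bigr => i _; rewrite -big_split /=; apply: eq_bigr => j _.
by rewrite (cre_cre j i); ring.
Qed.

Lemma wedgeDl v w f S :
  wedge (fun T => v T + w T) f S = wedge v f S + wedge w f S.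
Proof. by rewrite /wedge -big_split; apply: eq_bigr => T _ /=; ring. Qed.

Lemma wedgeZl c v f S : wedge (fun T => c * v T) f S = c * wedge v f S.
Proof. by rewrite /wedge mulr_sumr; apply: eq_bigr => T _ /=; ring. Qed.

(** The unit of the exterior algebra. *)
Definition vac : {fset J} -> R := fun S => (S == fset0)%:R.

(** Operators on the exterior algebra are plain functions here; this is the only
    property of a linear map that the computations use. *)
Definition linop (L : ({fset J} -> R) -> {fset J} -> R) :=
  forall v c w, L (axpy v c w) = axpy (L v) c (L w).

(** The binomial expansion of [(L + B)^(m+1)] stops after the term that is linear
    in [B]. It is applied to [B] a multiple of [p /\ q /\ _], and to
    [B = x /\ _]. *)
Lemma iter_add_nilpotent (L B : ({fset J} -> R) -> {fset J} -> R) f m :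
  linop L -> linop B -> (forall g, L (B g) = B (L g)) ->
  (forall g, B (B g) = fun=> 0) ->
  iter m.+1 (fun g => axpy (L g) 1 (B g)) f =
  axpy (iter m.+1 L f) m.+1%:R (B (iter m L f)).
Proof.
move=> lL lB LB BB; elim: m => [//|m IH].
rewrite iterS IH lL lB LB BB; apply/funext => S.
by rewrite /axpy -!iterS -[m.+2%:R]natr1; ring.
Qed.

End WedgeOperators.

(** * The exponential of finitely many planes *)

Section FiniteExponential.
Context {R : realType} {d : Order.disp_t} {J : orderType d}.
Implicit Types (i j : J) (F S T : {fset J}) (f v w : {fset J} -> R) (y : J -> R).
Variables (a : nat -> R) (p q : nat -> J -> R).

Definition vpair (p q : J -> R) f := vcre p (vcre q f).

Lemma vpair_lin r s : linop (vpair r s).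
Proof. by move=> v c w; rewrite /vpair !vcre_axpy. Qed.

Lemma vcreCfun y z f : vcre y (vcre z f) = fun S => - vcre z (vcre y f) S.
Proof. by apply/funext => S; rewrite vcreC. Qed.

Lemma linop0 (L : ({fset J} -> R) -> {fset J} -> R) : linop L ->
  L (fun=> 0) = fun=> 0.
Proof.
move=> lL; have -> : (fun=> 0) = axpy (fun=> 0) (-1) (fun=> 0) :> ({fset J} -> R).
  by apply/funext => S; rewrite /axpy; ring.
by rewrite lL; apply/funext => S; rewrite /axpy; ring.
Qed.

Lemma linopZ (L : ({fset J} -> R) -> {fset J} -> R) c f : linop L ->
  L (fun S => c * f S) = fun S => c * L f S.
Proof.
move=> lL; have -> : (fun S => c * f S) = axpy (fun=> 0) c f.
  by apply/funext => S; rewrite /axpy; ring.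
by rewrite lL linop0 //; apply/funext => S; rewrite /axpy; ring.
Qed.

Lemma vcre_lin y : linop (vcre y).
Proof. exact: vcre_axpy. Qed.

Lemma vcre0 y : vcre y (fun=> 0) = fun=> 0.
Proof. exact: linop0 (vcre_lin y). Qed.

(** Moving a vector past a two-form takes two transpositions. *)
Lemma vpair_vcre y r s f : vpair r s (vcre y f) = vcre y (vpair r s f).
Proof.
have opp g : (fun S => - g S) = (fun S => -1 * g S) :> ({fset J} -> R).
  by apply/funext => S; rewrite mulN1r.
rewrite /vpair (vcreCfun s y) opp linopZ; last exact: vcre_lin.
rewrite (vcreCfun r y).
by apply/funext => S; rewrite mulN1r opprK.
Qed.

Lemma vpair_sqr0 r s f : vpair r s (vpair r s f) = fun=> 0.
Proof.
rewrite -[X in vpair r s X]/(vcre r (vcre s f)) (vpair_vcre r) (vpair_vcre s r s f).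
have sq0 z g : vcre z (vcre z g) = fun=> 0.
  by apply/funext => S; rewrite vcre_sqr0.
rewrite /vpair (vcreCfun s r) sq0 vcre0 -[in RHS](vcre0 r); congr vcre.
by apply/funext => S; rewrite oppr0.
Qed.

(** The part of degree [2m] of the product over [k < n] of the factors
    [1 + 2 a_k (p_k /\ q_k)], defined by recursion on the number of factors. *)
Fixpoint fin_exp (n m : nat) : {fset J} -> R :=
  if n is n'.+1 then
    axpy (fin_exp n' m) (2 * a n')
      (if m is m'.+1 then vpair (p n') (q n') (fin_exp n' m') else fun=> 0)
  else if m is 0%N then vac else fun=> 0.

(** Multiplication by [sum_(k < n) 2 a_k (p_k /\ q_k)]. *)
Fixpoint fin_op (n : nat) f : {fset J} -> R :=
  if n is n'.+1 then axpy (fin_op n' f) (2 * a n') (vpair (p n') (q n') f)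
  else fun=> 0.

Lemma fin_op_lin n : linop (fin_op n).
Proof.
elim: n => [|n IH] v c w /=; first by apply/funext => S; rewrite /axpy; ring.
by rewrite IH vpair_lin; apply/funext => S; rewrite /axpy; ring.
Qed.

Lemma fin_op_vcre n y f : fin_op n (vcre y f) = vcre y (fin_op n f).
Proof.
elim: n => [|n IH] /=; first by rewrite vcre0.
by rewrite IH vpair_vcre vcre_axpy.
Qed.

(** The summands of [fin_op n] commute and square to zero, so each exponential
    [exp (2 a_k (p_k /\ q_k))] is [1 + 2 a_k (p_k /\ q_k)], and the exponential of
    the sum is their product. *)
Lemma iter_fin_op n m : iter m (fin_op n) vac = fun S => m`!%:R * fin_exp n m S.
Proof.
elim: n m => [|n IH] [|m].
- by apply/funext => S /=; rewrite fact0 mul1r.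
- by apply/funext => S /=; rewrite mulr0.
- apply/funext => S /=; rewrite fact0 mul1r -/(iter 0 (fin_op n) vac) IH.
  by rewrite fact0 /axpy; ring.
pose B f := axpy (fun=> 0) (2 * a n) (vpair (p n) (q n) f).
have opE : fin_op n.+1 = fun g => axpy (fin_op n g) 1 (B g).
  by apply/funext => g; apply/funext => S; rewrite /= /axpy /B /axpy; ring.
have opB : linop B.
  move=> v c w; rewrite /B vpair_lin; apply/funext => S; rewrite /axpy; ring.
have LB g : fin_op n (B g) = B (fin_op n g).
  rewrite /B fin_op_lin (linop0 (fin_op_lin n)).
  by rewrite /vpair !fin_op_vcre.
have BB g : B (B g) = fun=> 0.
  rewrite {2}/B /B vpair_lin vpair_sqr0 (linop0 (vpair_lin _ _)).
  by apply/funext => S; rewrite /axpy; ring.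
rewrite opE iter_add_nilpotent //; last exact: fin_op_lin.
rewrite !IH [B _]linopZ //; apply/funext => S; rewrite /= factS natrM /axpy /B /axpy.
ring.
Qed.

Lemma vcre_supp k y f : (forall S, #|` S| != k -> f S = 0) ->
  forall S, #|` S| != k.+1 -> vcre y f S = 0.
Proof.
move=> fk S Sk; rewrite /vcre big1_seq // => i /andP[_ iS].
rewrite /cre iS fk ?mulr0 //; apply: contra Sk => /eqP <-.
by rewrite (cardfsD1 i S) iS.
Qed.

Lemma fin_exp_supp n m S : #|` S| != m.*2 -> fin_exp n m S = 0.
Proof.
elim: n m S => [|n IH] [|m] S Sm //=.
- by rewrite /vac; case: (S =P fset0) Sm => // ->; rewrite cardfs0.
- by rewrite /axpy mulr0 addr0 IH.
rewrite /axpy IH // /vpair (vcre_supp (k := m.*2.+1)) ?mulr0 ?addr0 // => T Tm.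
by rewrite (vcre_supp (k := m.*2)) // => U Um; exact: IH.
Qed.

(** The matrix of [sum_(k < n) a_k (p_k /\ q_k)]. *)
Definition fin_form n (i j : J) : R :=
  \sum_(k < n) a k * (p k i * q k j - p k j * q k i).

Lemma wedge_fin_form n f : wedge (fun T => 2 * form2 (fin_form n) T) f = fin_op n f.
Proof.
have -> : (fun T => 2 * form2 (fin_form n) T) = fun T =>
    2 * form2 (fin_form n) T + 0 by apply/funext => T; rewrite addr0.
elim: n => [|n IH].
  rewrite [X in wedge X](_ : _ = (fun T => 0 * vac T)).
    by apply/funext => S; rewrite wedgeZl mul0r.
  apply/funext => T; rewrite /form2 mul0r addr0.
  by case: (increasing T) => [|i [|j [|? ?]]]; rewrite /fin_form ?big_ord0 mulr0.
rewrite /= -IH /vpair -wedge_form2_decomposable; apply/funext => S.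
rewrite /axpy -wedgeZl -wedgeDl; congr (wedge _ f S); apply/funext => T.
rewrite /form2; case: (increasing T) => [|i [|j [|? ?]]]; try ring.
by rewrite /fin_form big_ord_recr /=; ring.
Qed.

Definition wform x (b : J -> J -> R) T : R := form1 x T + 2 * form2 b T.

(** [x /\ _] commutes with [fin_op n] and squares to zero, so it enters each power
    at most once. *)
Lemma wedge_pow_fin n x m : wedge_pow m.+1 (wform x (fin_form n)) =
  fun S => m.+1`!%:R * (fin_exp n m.+1 S + vcre x (fin_exp n m) S).
Proof.
have E g : wedge (wform x (fin_form n)) g = axpy (fin_op n g) 1 (vcre x g).
  apply/funext => S; rewrite /wform wedgeDl -wedge_fin_form -wedge_form1 /axpy.
  by rewrite mul1r addrC.
rewrite /wedge_pow (_ : wedge _ = fun g => axpy (fin_op n g) 1 (vcre x g)); last first.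
  by apply/funext.
rewrite iter_add_nilpotent; first last.
- by move=> g; apply/funext => S; rewrite vcre_sqr0.
- exact: fin_op_vcre.
- exact: vcre_lin.
- exact: fin_op_lin.
rewrite !iter_fin_op linopZ; last exact: vcre_lin.
by apply/funext => S; rewrite /axpy factS natrM; ring.
Qed.

Lemma wedge_pow_fin0 n m : wedge_pow m (fun T => 2 * form2 (fin_form n) T) =
  fun S => m`!%:R * fin_exp n m S.
Proof.
rewrite -iter_fin_op /wedge_pow; congr (iter m _ vac).
by apply/funext => g; exact: wedge_fin_form.
Qed.

End FiniteExponential.

Lemma cvg_sum_seq (R : realType) (T : Type) (I : Type) (FF : set_system T) (r : seq I)
    (P : pred I) (f : I -> T -> R) (l : I -> R) : Filter FF ->
  (forall k, P k -> f k x @[x --> FF] --> l k) ->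
  (\sum_(k <- r | P k) f k x) @[x --> FF] --> \sum_(k <- r | P k) l k.
Proof.
by move=> FFF fl; apply: cvg_big => //; exact: add_continuous.
Qed.

(** * The exponential of infinitely many planes *)

Section Limit.
Context {R : realType} {d : Order.disp_t} {J : orderType d}.
Implicit Types (i j : J) (F S T : {fset J}) (f v w : {fset J} -> R) (y : J -> R).

Lemma wedge_cvg (vn wn : nat -> {fset J} -> R) v w S :
  (forall T, vn n T @[n --> \oo] --> v T) ->
  (forall T, wn n T @[n --> \oo] --> w T) ->
  wedge (vn n) (wn n) S @[n --> \oo] --> wedge v w S.
Proof.
move=> vv ww; apply: cvg_sum_seq => T _.
by apply: cvgM; [exact: cvg_cst | apply: cvgM].
Qed.

Lemma wedge_pow_cvg (vn : nat -> {fset J} -> R) v m S :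
  (forall T, vn n T @[n --> \oo] --> v T) ->
  wedge_pow m (vn n) S @[n --> \oo] --> wedge_pow m v S.
Proof.
move=> vv; elim: m S => [|m IH] S; first exact: cvg_cst.
by apply: wedge_cvg => // T; exact: IH.
Qed.

Lemma vcre_cvg y (wn : nat -> {fset J} -> R) w S :
  (forall T, wn n T @[n --> \oo] --> w T) ->
  vcre y (wn n) S @[n --> \oo] --> vcre y w S.
Proof.
move=> ww; rewrite -wedge_form1.
under eq_cvg do rewrite -wedge_form1.
by apply: wedge_cvg => // T; exact: cvg_cst.
Qed.

Variables (a : nat -> R) (p q : nat -> J -> R) (b : J -> J -> R) (x : J -> R).
Hypothesis ab : forall i j, fin_form a p q n i j @[n --> \oo] --> b i j.

(** The part of degree [2m] of [exp (2 b)], for a two-form [b]. *)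
Definition full_exp m S : R := wedge_pow m (fun T => 2 * form2 b T) S / m`!%:R.

Lemma factr_neq0 m : m`!%:R != 0 :> R.
Proof. by rewrite pnatr_eq0 -lt0n fact_gt0. Qed.

Lemma form2_cvg T : form2 (fin_form a p q n) T @[n --> \oo] --> form2 b T.
Proof.
rewrite /form2; case: (increasing T) => [|i [|j [|? ?]]]; try exact: cvg_cst.
exact: ab.
Qed.

(** Each coefficient of a power of a form is a polynomial in finitely many of its
    coefficients, so the coefficientwise limit passes through the powers. *)
Lemma fin_exp_cvg m S : fin_exp a p q n m S @[n --> \oo] --> full_exp m S.
Proof.
have E n : fin_exp a p q n m S =
    wedge_pow m (fun T => 2 * form2 (fin_form a p q n) T) S / m`!%:R.
  by rewrite wedge_pow_fin0 mulrC mulKf // factr_neq0.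
under eq_cvg do rewrite E.
apply: cvgM; last exact: cvg_cst.
by apply: wedge_pow_cvg => T; apply: cvgM; [exact: cvg_cst | exact: form2_cvg].
Qed.

Lemma full_exp_supp m S : #|` S| != m.*2 -> full_exp m S = 0.
Proof.
move=> Sm; apply: (cvg_unique _ (@fin_exp_cvg m S)) => //.
by rewrite (_ : (fun n => _) = fun=> 0); [exact: cvg_cst |
  apply/funext => n; rewrite fin_exp_supp].
Qed.

Lemma wedge_pow_full m S : wedge_pow m.+1 (wform x b) S / m.+1`!%:R =
  full_exp m.+1 S + vcre x (full_exp m) S.
Proof.
have H1 : wedge_pow m.+1 (wform x (fin_form a p q n)) S / m.+1`!%:R @[n --> \oo] -->
    wedge_pow m.+1 (wform x b) S / m.+1`!%:R.
  apply: cvgM; last exact: cvg_cst.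
  apply: wedge_pow_cvg => T; apply: cvgD; first exact: cvg_cst.
  by apply: cvgM; [exact: cvg_cst | exact: form2_cvg].
apply: (cvg_unique _ H1) => //.
rewrite (_ : (fun n => _) = fun n =>
    fin_exp a p q n m.+1 S + vcre x (fin_exp a p q n m) S); last first.
  by apply/funext => n; rewrite wedge_pow_fin mulrC mulKf ?factr_neq0.
by apply: cvgD; [exact: fin_exp_cvg | apply: vcre_cvg => T; exact: fin_exp_cvg].
Qed.

Lemma vcre_full_exp_supp m S : #|` S| != m.*2.+1 -> vcre x (full_exp m) S = 0.
Proof. by apply: vcre_supp => T; exact: full_exp_supp. Qed.

Lemma exp_wedge_term m S : wedge_pow m (wform x b) S / m`!%:R =
  if #|` S| == m.*2 then full_exp m S
  else if #|` S|.+1 == m.*2 then vcre x (full_exp m.-1) S else 0.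
Proof.
case: m => [|m].
  by rewrite /full_exp /wedge_pow /= fact0 divr1 cardfs_eq0; case: eqP.
rewrite wedge_pow_full; case: eqP => [Sm|/eqP Sm].
  rewrite vcre_full_exp_supp ?addr0 // Sm; lia.
rewrite full_exp_supp // add0r /=; case: eqP => // /eqP Sm'.
by rewrite vcre_full_exp_supp //; apply: contra Sm' => /eqP ->.
Qed.

(** At a fixed [S] only the power of order [uphalf #|S|] of the form contributes
    to the exponential series: the one that has room for [#|S|./2] planes and,
    in odd degree, one factor [x]. *)
Lemma exp_wedgeE S : exp_wedge (wform x b) S =
  if odd #|` S| then vcre x (full_exp (#|` S|)./2) S else full_exp (#|` S|)./2 S.
Proof.
rewrite /exp_wedge; set rhs := RHS.
pose N := (uphalf #|` S|).
have E n : (N < n)%N -> series (fun n0 => wedge_pow n0 (wform x b) S / n0`!%:R) n = rhs.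
  move=> Nn; rewrite /series /=.
  rewrite (bigD1_seq N) ?mem_index_iota ?iota_uniq //= big1 ?addr0.
    rewrite exp_wedge_term /rhs /N uphalf_half; have := odd_double_half #|` S|.
    case: (odd _) => /= SE; last by rewrite add0n -{1}SE add0n eqxx.
    rewrite add1n /=; case: eqP => [|_]; first lia.
    by case: eqP => //; lia.
  move=> m mN; rewrite exp_wedge_term.
  case: eqP => [Sm|_]; first by move: mN; rewrite /N Sm; lia.
  by case: eqP => // Sm; move: mN; rewrite /N; lia.
apply/cvg_lim => //; apply: cvg_near_cst.
by exists N.+1 => // n /= Nn; exact: E.
Qed.

End Limit.

#[global] Existing Instance totally_filter.

(** * Fock norms as limits over finite sets of coordinates *)

Section Asymptotics.
Context {R : realType} {d : Order.disp_t} {J : orderType d}.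
Implicit Types (i j : J) (F G S T : {fset J}) (f v w : {fset J} -> R) (x y z : J -> R).

(** The inner product of two coordinate families is [g], as the limit of its
    finite parts. *)
Definition gram y z (g : R) := dotf F y z @[F --> totally] --> g.
Definition normlim w (l : R) := nrm F w @[F --> totally] --> l.
(** Contraction with [y] annihilates [w] in the limit. On each finite part the
    contraction is in general not zero, because the truncated vectors are no
    longer orthogonal. *)
Definition anull y w := nrm F (vann F y w) @[F --> totally] --> (0 : R).

Lemma gramC y z g : gram y z g -> gram z y g.
Proof.
rewrite /gram (_ : (fun F => dotf F y z) = fun F => dotf F z y) //.
by apply/funext => F; apply: eq_bigr => i _; rewrite mulrC.
Qed.

Lemma gram_axpyl y c z x g h : gram y x g -> gram z x h ->
  gram (fun i => y i + c * z i) x (g + c * h).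
Proof.
move=> yx zx; rewrite /gram.
rewrite (_ : (fun F => _) = fun F => dotf F y x + c * dotf F z x).
  by apply: cvgD => //; apply: cvgM => //; exact: cvg_cst.
apply/funext => F; rewrite /dotf mulr_sumr -big_split; apply: eq_bigr => i _ /=.
by ring.
Qed.

Lemma dotf_ge0 F y : 0 <= dotf F y y.
Proof. by apply: sumr_ge0 => i _; rewrite -expr2 sqr_ge0. Qed.

Lemma nrm_vcre_le F y w : nrm F (vcre y w) <= dotf F y y * nrm F w.
Proof. by rewrite nrm_vcre gerBl nrm_ge0. Qed.

Lemma nrm_axpy_le F v c w : nrm F (axpy v c w) <= 2 * nrm F v + 2 * c ^+ 2 * nrm F w.
Proof.
have := nrm_ge0 F (axpy v (- c) w); rewrite !nrm_axpy.
by rewrite sqrrN; lra.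
Qed.

Lemma eq_nrm F v w : agree F v w -> nrm F v = nrm F w.
Proof. by move=> vw; exact: eq_bil. Qed.

Lemma cvg0_squeeze (u v : {fset J} -> R) : (forall F, 0 <= u F <= v F) ->
  v F @[F --> totally] --> (0 : R) -> u F @[F --> totally] --> (0 : R).
Proof.
move=> uv v0; apply: (squeeze_cvgr _ (cvg_cst 0) v0).
by near=> F; exact: uv.
Unshelve. all: by end_near. Qed.

Lemma cvg0_sqr (u v : {fset J} -> R) : (forall F, u F ^+ 2 <= v F) ->
  v F @[F --> totally] --> (0 : R) -> u F @[F --> totally] --> (0 : R).
Proof.
move=> uv v0; apply/cvgr0Pnorm_lt => e e0.
have e2 : 0 < e ^+ 2 by rewrite exprn_gt0.
move/cvgr0Pnorm_lt: v0 => /(_ _ e2); apply: filterS => F /= vF.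
rewrite -(@ltr_pXn2r _ 2) ?nnegrE ?normr_ge0 ?ltW // real_normK ?num_real //.
by apply: le_lt_trans (uv F) _; apply: le_lt_trans (ler_norm _) vF.
Qed.

(** When [y] contracts [w] to zero, only the product of norms is left in [nrm_vcre]. *)
Lemma normlim_vcre y w g l : gram y y g -> normlim w l -> anull y w ->
  normlim (vcre y w) (g * l).
Proof.
move=> yg wl yw; rewrite /normlim (_ : (fun F => _) = fun F =>
    dotf F y y * nrm F w - nrm F (vann F y w)).
  by rewrite -[g * l]subr0; apply: cvgB => //; apply: cvgM.
by apply/funext => F; rewrite nrm_vcre.
Qed.

(** Contraction with [y] anticommutes with multiplication by [z] up to the inner
    product of [y] and [z], which tends to zero. *)
Lemma anull_vcre y z w g l : gram y z 0 -> gram z z g -> normlim w l ->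
  anull y w -> anull y (vcre z w).
Proof.
move=> yz zg wl yw.
apply: (cvg0_squeeze (v := fun F => 2 * (dotf F y z ^+ 2 * nrm F w) +
    2 * (dotf F z z * nrm F (vann F y w)))) => [F|].
  rewrite nrm_ge0 /=.
  rewrite (eq_nrm (w := axpy (fun S => dotf F y z * w S) (-1)
    (vcre z (vann F y w)))); last first.
    by move=> S SF; rewrite vann_vcre // /axpy; ring.
  apply: le_trans (nrm_axpy_le _ _ _ _) _.
  rewrite sqrrN expr1n mulr1 lerD ?ler_pM2l ?nrm_vcre_le //.
  rewrite /nrm /bil mulr_sumr le_eqVlt; apply/orP; left; apply/eqP.
  by apply: eq_bigr => S _; ring.
rewrite [X in _ --> X](_ : 0 = 2 * (0 ^+ 2 * l) + 2 * (g * 0) :> R); last by ring.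
apply: cvgD; apply: cvgM; try exact: cvg_cst; apply: cvgM => //.
by apply: cvgM.
Qed.

Lemma anull_axpy y v c w : anull y v -> anull y w -> anull y (axpy v c w).
Proof.
move=> yv yw; apply: (cvg0_squeeze (v := fun F => 2 * nrm F (vann F y v) +
   2 * c ^+ 2 * nrm F (vann F y w))) => [F|].
  by rewrite nrm_ge0 vann_axpy nrm_axpy_le.
rewrite [X in _ --> X](_ : 0 = 2 * 0 + 2 * c ^+ 2 * 0 :> R); last by ring.
by apply: cvgD; apply: cvgM => //; exact: cvg_cst.
Qed.

(** Pythagoras. *)
Lemma normlim_axpy v c w l l' : normlim v l -> normlim w l' ->
  bil F v w @[F --> totally] --> (0 : R) -> normlim (axpy v c w) (l + c ^+ 2 * l').
Proof.
move=> vl wl vw; rewrite /normlim; under eq_cvg do rewrite nrm_axpy.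
have -> : l + c ^+ 2 * l' = l + 2 * c * 0 + c ^+ 2 * l' by ring.
by apply: cvgD; [apply: cvgD => //|]; apply: cvgM => //; exact: cvg_cst.
Qed.

(** Multiplication by [y] moves to the other side as a contraction. *)
Lemma bil_null y v w l : anull y v -> normlim w l ->
  bil F v (vcre y w) @[F --> totally] --> (0 : R).
Proof.
move=> yv wl; apply: (cvg0_sqr (v := fun F => nrm F (vann F y v) * nrm F w)) => [F|].
  by rewrite bilC vcre_adjoint bilC bil_CS.
by rewrite -(mul0r l); apply: cvgM.
Qed.

(** The anticommutation relation turns the inner product into one multiple of
    that of [v] and [w] and one term with a contraction of [v] by [y]. *)
Lemma bil_vcre_null x y v w g gx l : gram y x g -> gram x x gx -> anull y v ->
  normlim w l -> bil F v w @[F --> totally] --> (0 : R) ->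
  bil F (vcre x v) (vcre y w) @[F --> totally] --> (0 : R).
Proof.
move=> yx xx yv wl vw.
rewrite (_ : (fun F => _) = fun F => dotf F y x * bil F v w -
    bil F (vcre x (vann F y v)) w); last first.
  apply/funext => F; rewrite bilC vcre_adjoint bilC.
  rewrite /bil mulr_sumr -sumrB; apply: eq_big_seq => S; rewrite fpowersetE => SF.
  by rewrite vann_vcre //; ring.
rewrite -[X in _ --> X](subr0) -[X in X - _](mulr0 g).
apply: cvgB; first by apply: cvgM.
apply: (cvg0_sqr (v := fun F => (dotf F x x * nrm F (vann F y v)) * nrm F w)) => [F|].
  by apply: le_trans (bil_CS _ _ _) _; rewrite ler_wpM2r ?nrm_ge0 ?nrm_vcre_le.
by rewrite -[X in _ --> X](mul0r l) -[X in X * l](mulr0 gx); apply: cvgM => //; apply: cvgM.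
Qed.

Lemma nrm_mono F G w : (F `<=` G)%fset -> nrm F w <= nrm G w.
Proof.
move=> FG; rewrite /nrm /bil (big_fsetID _ [in fpowerset F] (fpowerset G)) /=.
rewrite [X in X + _](_ : _ = \sum_(S <- fpowerset F) w S * w S).
  by rewrite lerDl sumr_ge0 // => S _; rewrite -expr2 sqr_ge0.
apply: eq_fbigl => S; rewrite !inE /= !fpowersetE.
by case: (boolP (S `<=` F)%fset) => [SF|]; rewrite ?andbF ?andbT // (fsubset_trans SF FG).
Qed.

Lemma normlim_ge w l F : normlim w l -> nrm F w <= l.
Proof.
move=> wl; rewrite -(cvg_lim _ wl) //; apply: limr_ge; first by apply/cvg_ex; exists l.
by exists F => // G /= FG; exact: nrm_mono.
Qed.

(** A finite family of index sets lies in the power set of its union, so the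
    finite parts [nrm F] are cofinal among the partial sums of the norm. *)
Lemma fock_norm2_ub w (l : R) : (forall F, nrm F w <= l) -> (fock_norm2 w <= l%:E)%E.
Proof.
move=> wl; apply: ge_ereal_sup => _ [X [finX _] <-].
rewrite fsbig_finite //= sumEFin lee_fin.
pose F := (\bigcup_(S <- fset_set X) S)%fset.
apply: le_trans (wl F); rewrite /nrm /bil.
rewrite (big_fsetID _ [in fset_set X] (fpowerset F)) /=.
rewrite [X in _ <= X + _](_ : _ = \sum_(S <- fset_set X) w S ^+ 2).
  by rewrite lerDl sumr_ge0 // => S _; rewrite -expr2 sqr_ge0.
under eq_bigr do rewrite -expr2; apply: eq_fbigl => S; rewrite !inE /= fpowersetE.
case: (boolP (S \in fset_set X)) => SX; rewrite ?andbF // andbT.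
by apply/fsubsetP => j jS; apply/bigfcupP; exists S; rewrite ?SX.
Qed.

Lemma nrm_le_fock_norm2 w F : ((nrm F w)%:E <= fock_norm2 w)%E.
Proof.
rewrite /nrm /bil; apply: ereal_sup_ubound => /=.
exists [set` fpowerset F]; first by split => //; exact: finite_fset.
rewrite fsbig_finite /=; last exact: finite_fset.
by rewrite set_fsetK sumEFin.
Qed.

Lemma fock_norm2_lim w l : normlim w l -> fock_norm2 w = l%:E.
Proof.
move=> wl; apply/eqP; rewrite eq_le fock_norm2_ub /=; last by move=> F; exact: normlim_ge.
apply/lee_addgt0Pr => e e0; rewrite -leeBlDr // -EFinD.
have /cvgrPdist_lt/(_ _ e0) := wl.
move=> [F _ /(_ F (fsubset_refl F))] /= le.
apply: le_trans (nrm_le_fock_norm2 w F); rewrite lee_fin lerBlDr -lerBlDl.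
by apply: le_trans (ltW le); exact: ler_norm.
Qed.

(** An approximation in norm that is uniform in [F] lets the limits in [m] and in
    [F] be exchanged. *)
Lemma normlim_approx (wn : nat -> {fset J} -> R) w (r l : nat -> R) l' :
  (forall m F, nrm F (axpy w (-1) (wn m)) <= r m) -> r m @[m --> \oo] --> (0 : R) ->
  (forall m, normlim (wn m) (l m)) -> l m @[m --> \oo] --> l' -> normlim w l'.
Proof.
move=> wr r0 wl ll.
have r_ge0 m : 0 <= r m by apply: le_trans (wr m fset0); exact: nrm_ge0.
have l_ge0 m : 0 <= l m.
  by apply: le_trans (normlim_ge fset0 (wl m)); exact: nrm_ge0.
have bd m F : `|nrm F w - nrm F (wn m)| <= 2 * Num.sqrt (l m * r m) + r m.
  have -> : nrm F w - nrm F (wn m) = 2 * bil F (wn m) (axpy w (-1) (wn m)) +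
      nrm F (axpy w (-1) (wn m)).
    by rewrite nrm_axpy bil_axpyr /nrm (bilC _ w); ring.
  apply: le_trans (ler_normD _ _) _; rewrite lerD //; last first.
    by rewrite ger0_norm ?nrm_ge0.
  rewrite normrM ger0_norm // ler_pM2l // -sqrtr_sqr ler_wsqrtr //.
  apply: le_trans (bil_CS _ _ _) _.
  by rewrite ler_pM ?nrm_ge0 //; exact: normlim_ge.
have b0 : 2 * Num.sqrt (l m * r m) + r m + `|l' - l m| @[m --> \oo] --> (0 : R).
  rewrite -[X in _ --> X](addr0) -[X in X + _](addr0) -[X in X + _ + _](mulr0 2).
  apply: cvgD; last first.
    rewrite -(normr0 R); apply: cvg_norm; rewrite -(subrr l').
    by apply: cvgB => //; exact: cvg_cst.
  apply: cvgD => //; apply: cvgM; first exact: cvg_cst.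
  rewrite -(sqrtr0 R) -(mulr0 l').
  by apply: (@cvg_comp _ _ _ _ Num.sqrt _ (nbhs (l' * 0))); [apply: cvgM | exact: sqrt_continuous].
apply/cvgrPdist_lt => e e0.
have e2 : 0 < e / 2 by rewrite divr_gt0.
have /cvgr0Pnorm_lt/(_ _ e2)[m _ /(_ m (leqnn m))] := b0.
rewrite /= => bm.
have /cvgrPdist_lt/(_ _ e2) := wl m; apply: filterS => F /= lF.
have -> : l' - nrm F w = (l' - l m) + (l m - nrm F (wn m)) - (nrm F w - nrm F (wn m)).
  by ring.
apply: le_lt_trans (ler_normB _ _) _.
apply: le_lt_trans (lerD (ler_normD _ _) (bd m F)) _.
move: bm; rewrite ger0_norm; last first.
  by rewrite !addr_ge0 // mulr_ge0 // sqrtr_ge0.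
lra.
Qed.

End Asymptotics.

(** * Norms of the exponential of finitely many planes *)

Section ElementarySymmetric.
Context {R : realType}.
Implicit Types (c mu : nat -> R).

(** The elementary symmetric polynomial of degree [m] in [c 0, ..., c (n - 1)]. *)
Fixpoint esp c (n m : nat) : R :=
  if n is n'.+1 then esp c n' m + (if m is m'.+1 then c n' * esp c n' m' else 0)
  else if m is 0%N then 1 else 0.

(** [omega c mu X n m] is the sum, over the [m]-element sets [U] of indices below
    [n], of [(X - sum_(u in U) mu u) * prod_(u in U) c u]. With [X = |x|^2] and
    [mu k] the energy of [x] in the [k]-th plane, the first factor is the energy
    of [x] off the planes in [U]. *)
Fixpoint omega c mu (X : R) (n m : nat) : R :=
  if n is n'.+1 then omega c mu X n' m +
    (if m is m'.+1 then c n' * (omega c mu X n' m' - mu n' * esp c n' m') else 0)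
  else if m is 0%N then X else 0.

(** Shifting [X] subtracts [t] from the weight of every [U]. *)
Lemma omega_sub c mu X t n m : omega c mu (X - t) n m = omega c mu X n m - t * esp c n m.
Proof.
elim: n m => [|n IH] [|m] //=; rewrite ?mulr0 ?subr0 ?mulr1 //.
  by rewrite !addr0 IH.
by rewrite !IH; ring.
Qed.

Lemma omegaS0 c mu X n m : c n = 0 -> omega c mu X n.+1 m = omega c mu X n m.
Proof. by move=> cn /=; case: m => [|m]; rewrite ?cn ?mul0r addr0. Qed.

Lemma espS0 c n m : c n = 0 -> esp c n.+1 m = esp c n m.
Proof. by move=> cn /=; case: m => [|m]; rewrite ?cn ?mul0r addr0. Qed.

Lemma esp_ge0 c n m : (forall k, 0 <= c k) -> 0 <= esp c n m.
Proof.
move=> c0; elim: n m => [|n IH] [|m] //=; first by rewrite addr_ge0.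
by rewrite addr_ge0 // mulr_ge0.
Qed.

End ElementarySymmetric.

Section FiniteEnergies.
Context {R : realType} {d : Order.disp_t} {J : orderType d}.
Implicit Types (i j : J) (F G S T : {fset J}) (f v w : {fset J} -> R) (x y z : J -> R).
Variables (a : nat -> R) (p q : nat -> J -> R).
Hypothesis a_ge0 : forall k, 0 <= a k.
Hypothesis pp : forall k l, 0 < a k -> 0 < a l -> gram (p k) (p l) (k == l)%:R.
Hypothesis qq : forall k l, 0 < a k -> 0 < a l -> gram (q k) (q l) (k == l)%:R.
Hypothesis pq : forall k l, 0 < a k -> 0 < a l -> gram (p k) (q l) 0.

Let c k := a k ^+ 2.
Let E n m := 4 ^+ m * esp c n m.

Lemma fin_expS0 n m : a n = 0 -> fin_exp a p q n.+1 m = fin_exp a p q n m.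
Proof.
by move=> an; apply/funext => S; rewrite /= /axpy an mulr0 mul0r addr0.
Qed.

Lemma fin_exp0 n : fin_exp a p q n 0 = vac.
Proof.
elim: n => [//|n IH]; apply/funext => S.
by rewrite /= /axpy mulr0 addr0 IH.
Qed.

Lemma normlim_vac : normlim (vac : {fset J} -> R) 1.
Proof.
rewrite /normlim (_ : (fun F => _) = fun=> 1); first exact: cvg_cst.
apply/funext => F; rewrite /nrm /bil /vac.
by rewrite (@big_delta R _ _ fset0 (fun S => (S == fset0)%:R)) ?eqxx // fpowersetE fsub0set.
Qed.

Lemma nrm0 F : nrm F (fun=> 0 : R) = 0.
Proof. by rewrite /nrm /bil big1 // => S _; rewrite mulr0. Qed.

Lemma normlim0 : normlim ((fun=> 0) : {fset J} -> R) (0 : R).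
Proof.
rewrite /normlim (_ : (fun F : {fset J} => _) = fun=> 0); first exact: cvg_cst.
by apply/funext => F; rewrite nrm0.
Qed.

Lemma vann_vac F y : vann F y vac = fun=> 0.
Proof.
apply/funext => S; rewrite /vann big1 // => i _; rewrite /ann /vac.
case: ifP => _; rewrite ?mulr0 //.
by rewrite (_ : _ == fset0 = false) ?mulr0 //; apply/eqP => /fsetP/(_ i); rewrite !inE eqxx.
Qed.

Lemma vann0 F y : vann F y (fun=> 0) = fun=> 0.
Proof.
apply/funext => S; rewrite /vann big1 // => i _; rewrite /ann.
by case: ifP; rewrite ?mulr0.
Qed.

Lemma anull_vac y : anull y (vac : {fset J} -> R).
Proof.
rewrite /anull (_ : (fun F => _) = fun=> 0); first exact: cvg_cst.
by apply/funext => F; rewrite vann_vac nrm0.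
Qed.

Lemma anull0 y : anull y (fun=> 0 : R).
Proof.
rewrite /anull (_ : (fun F => _) = fun=> 0); first exact: cvg_cst.
by apply/funext => F; rewrite vann0 nrm0.
Qed.

(** The unit vectors [p n] and [q n] contract [w] to zero, so wedging with them
    preserves the norm. *)
Lemma normlim_vpair n w l : 0 < a n -> normlim w l -> anull (p n) w ->
  anull (q n) w -> normlim (vpair (p n) (q n) w) l.
Proof.
move=> an wl pw qw.
have pn := pp an an; have qn := qq an an; rewrite eqxx in pn qn.
rewrite -[l]mul1r -[l in X in normlim _ X]mul1r; apply: normlim_vcre => //.
  exact: normlim_vcre.
by apply: anull_vcre qn wl pw; exact: pq.
Qed.

Lemma anull_vpair n y w l : 0 < a n -> gram y (p n) 0 -> gram y (q n) 0 ->
  normlim w l -> anull y w -> anull (q n) w -> anull y (vpair (p n) (q n) w).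
Proof.
move=> an yp yq wl yw qw.
have pn := pp an an; have qn := qq an an; rewrite eqxx in pn qn.
apply: anull_vcre pn _ _ => //; first by apply: normlim_vcre qn wl qw.
by apply: anull_vcre qn wl yw.
Qed.

(** By induction on the number of planes: the [n]-th plane is orthogonal to the
    earlier ones, so its vectors contract their exponential to zero. Hence the
    new term [2 a_n (p_n /\ q_n /\ _)] multiplies squared norms by [4 a_n^2] and
    is orthogonal to the old one, which is the recursion of [esp]. The statement on
    contractions has to be carried along in the induction. *)
Lemma fin_exp_norm n m :
  normlim (fin_exp a p q n m) (E n m) /\
  (forall y, (forall k, (k < n)%N -> 0 < a k -> gram y (p k) 0 /\ gram y (q k) 0) ->
     anull y (fin_exp a p q n m)).
Proof.
elim: n m => [|n IH] m.
  split; case: m => [|m]; rewrite /E /= ?mulr0 ?mulr1 ?expr0.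
  - exact: normlim_vac.
  - exact: normlim0.
  - by move=> y _; exact: anull_vac.
  - by move=> y _; exact: anull0.
have IHy m' y : (forall k, (k < n.+1)%N -> 0 < a k -> gram y (p k) 0 /\ gram y (q k) 0) ->
    anull y (fin_exp a p q n m').
  by move=> yk; apply: (IH m').2 => k kn; apply: yk; exact: leq_trans kn _.
have [an|an] : a n = 0 \/ 0 < a n.
  by move: (a_ge0 n); rewrite le_eqVlt => /orP[/eqP <-|]; [left|right].
  rewrite fin_expS0 //; split; last by move=> y; exact: IHy.
  by rewrite /E espS0 /c ?an ?expr0n //; exact: (IH m).1.
case: m => [|m].
  rewrite fin_exp0; split; last by move=> y _; exact: anull_vac.
  rewrite /E expr0 mul1r; suff -> : esp c n.+1 0 = 1 by exact: normlim_vac.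
  by elim: (n.+1) => //= k ->; rewrite addr0.
have pnull m' : anull (p n) (fin_exp a p q n m').
  apply: (IH m').2 => k kn ak; split; last exact: pq.
  by have := pp an ak; rewrite gtn_eqF.
have qnull m' : anull (q n) (fin_exp a p q n m').
  apply: (IH m').2 => k kn ak; split; first by apply: gramC; exact: pq.
  by have := qq an ak; rewrite gtn_eqF.
have nvp := normlim_vpair an (IH m).1 (pnull m) (qnull m).
split=> [|y yk].
  have -> : E n.+1 m.+1 = E n m.+1 + (2 * a n) ^+ 2 * E n m.
    by rewrite /E /= /c !exprS; ring.
  apply: normlim_axpy nvp _; first exact: (IH m.+1).1.
  apply: (bil_null (l := 1 * E n m)) => //; apply: normlim_vcre => //.
    by have := qq an an; rewrite eqxx.
  exact: (IH m).1.
apply: anull_axpy; first exact: IHy.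
have [yp yq] := yk n (ltnSn n) an.
by apply: (anull_vpair an yp yq (IH m).1) => //; exact: IHy.
Qed.

Lemma fin_exp_anull_p n m : 0 < a n -> anull (p n) (fin_exp a p q n m).
Proof.
move=> an; apply: (fin_exp_norm n m).2 => k kn ak; split; last exact: pq.
by have := pp an ak; rewrite gtn_eqF.
Qed.

Lemma fin_exp_anull_q n m : 0 < a n -> anull (q n) (fin_exp a p q n m).
Proof.
move=> an; apply: (fin_exp_norm n m).2 => k kn ak.
split; first by apply: gramC; exact: pq.
by have := qq an ak; rewrite gtn_eqF.
Qed.

(** The successive increments in [n] are orthogonal, so the distance is the
    difference of the squared norms. *)
Lemma fin_exp_increment n n' m : (n' <= n)%N ->
  normlim (axpy (fin_exp a p q n m) (-1) (fin_exp a p q n' m)) (E n m - E n' m).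
Proof.
move=> nn'.
have H : bil F (fin_exp a p q n m) (fin_exp a p q n' m) @[F --> totally] --> E n' m.
  elim: n nn' => [|n IH].
    by rewrite leqn0 => /eqP ->; exact: (fin_exp_norm 0 m).1.
  rewrite leq_eqVlt => /orP[/eqP ->|]; first exact: (fin_exp_norm n.+1 m).1.
  rewrite ltnS => n'n; have [an|an] : a n = 0 \/ 0 < a n.
    by move: (a_ge0 n); rewrite le_eqVlt => /orP[/eqP <-|]; [left|right].
    by rewrite fin_expS0 //; exact: IH.
  case: m IH => [|m] IH; first by rewrite fin_exp0 -(fin_exp0 n); exact: IH.
  rewrite (_ : (fun F => _) = fun F => bil F (fin_exp a p q n m.+1) (fin_exp a p q n' m.+1)
     + (2 * a n) * bil F (fin_exp a p q n' m.+1) (vpair (p n) (q n) (fin_exp a p q n m))).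
    rewrite -[X in _ --> X]addr0 -[X in _ + X](mulr0 (2 * a n)); apply: cvgD.
      exact: IH.
    apply: cvgM; first exact: cvg_cst.
    apply: (bil_null (l := 1 * E n m)).
      apply: (fin_exp_norm n' m.+1).2 => k kn' ak; split; last exact: pq.
      by have := pp an ak; rewrite gtn_eqF // (leq_trans kn').
    apply: normlim_vcre (fin_exp_norm n m).1 (fin_exp_anull_q m an).
    by have := qq an an; rewrite eqxx.
  by apply/funext => F; rewrite /= bil_axpyl (bilC _ (vpair _ _ _)).
rewrite /normlim (_ : (fun F => _) = fun F => nrm F (fin_exp a p q n m) +
    (-2) * bil F (fin_exp a p q n m) (fin_exp a p q n' m) + nrm F (fin_exp a p q n' m)).
  rewrite (_ : E n m - E n' m = E n m + -2 * E n' m + E n' m); last by ring.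
  apply: cvgD; last exact: (fin_exp_norm n' m).1.
  apply: cvgD; first exact: (fin_exp_norm n m).1.
  by apply: cvgM => //; exact: cvg_cst.
by apply/funext => F; rewrite nrm_axpy; ring.
Qed.

(** The component of [x] in the plane of [p n] and [q n] does not contribute to
    [x /\ (p n /\ q n) /\ w]. *)
Lemma vcre_vpair_sub n x (P Q : R) w :
  vcre x (vpair (p n) (q n) w) =
  vpair (p n) (q n) (vcre (fun i => x i + - P * p n i + - Q * q n i) w).
Proof.
have vcreD y c' z f : vcre (fun i => y i + c' * z i) f = axpy (vcre y f) c' (vcre z f).
  apply/funext => S; rewrite /axpy /vcre mulr_sumr -big_split /=.
  by apply: eq_bigr => i _; ring.
have sq0 z g : vcre z (vcre z g) = fun=> 0.
  by apply/funext => S; rewrite vcre_sqr0.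
rewrite vpair_vcre !vcreD.
have -> : vcre (p n) (vpair (p n) (q n) w) = fun=> 0 by rewrite /vpair sq0.
have -> : vcre (q n) (vpair (p n) (q n) w) = fun=> 0.
  by rewrite -vpair_vcre /vpair sq0 vcre0.
by apply/funext => S; rewrite /axpy; ring.
Qed.

(** In the term that contains the [n]-th plane, [x] may be replaced by its
    component [y] orthogonal to that plane; [y] has the same inner products with
    the earlier planes and the energy [X] diminished by that of the plane, which
    is the recursion of [omega]. *)
Lemma vcre_fin_exp_norm n m x (X : R) (P Q : nat -> R) : gram x x X ->
  (forall k, (k < n)%N -> 0 < a k -> gram x (p k) (P k) /\ gram x (q k) (Q k)) ->
  normlim (vcre x (fin_exp a p q n m))
    (4 ^+ m * omega c (fun k => P k ^+ 2 + Q k ^+ 2) X n m).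
Proof.
elim: n m x X P Q => [|n IH] m x X P Q xX xPQ.
  case: m => [|m] /=; last by rewrite mulr0 vcre0; exact: normlim0.
  rewrite expr0 mul1r -[X]mulr1; apply: normlim_vcre => //; first exact: normlim_vac.
  exact: anull_vac.
have xPQ' k : (k < n)%N -> 0 < a k -> gram x (p k) (P k) /\ gram x (q k) (Q k).
  by move=> kn; apply: xPQ; exact: ltnW.
have [an|an] : a n = 0 \/ 0 < a n.
  by move: (a_ge0 n); rewrite le_eqVlt => /orP[/eqP <-|]; [left|right].
  rewrite fin_expS0 // omegaS0; last by rewrite /c an expr0n.
  exact: IH.
case: m => [|m].
  rewrite /= addr0 (_ : axpy _ _ _ = fin_exp a p q n 0); first exact: IH.
  by apply/funext => S; rewrite /axpy mulr0 addr0.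
pose y i := x i + - P n * p n i + - Q n * q n i.
have [xp xq] := xPQ n (ltnSn n) an.
have pn := pp an an; have qn := qq an an; rewrite eqxx in pn qn.
have yz z (g g1 g2 : R) : gram x z g -> gram (p n) z g1 -> gram (q n) z g2 ->
    gram y z (g - P n * g1 - Q n * g2).
  by move=> h h1 h2; rewrite -!mulNr; do 2 apply: gram_axpyl => //.
have yp : gram y (p n) 0.
  have := yz _ _ _ _ xp pn (gramC (pq an an)).
  by rewrite mulr1 mulr0 subr0 subrr.
have yq : gram y (q n) 0.
  have := yz _ _ _ _ xq (pq an an) qn.
  by rewrite mulr1 mulr0 subr0 subrr.
have yy : gram y y (X - (P n ^+ 2 + Q n ^+ 2)).
  rewrite (_ : X - _ = X - P n * P n - Q n * Q n - P n * 0 - Q n * 0); last by ring.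
  apply: (yz); try exact: gramC.
  by apply: gramC; apply: (yz) => //; exact: gramC.
have yk k : (k < n)%N -> 0 < a k -> gram y (p k) (P k) /\ gram y (q k) (Q k).
  move=> kn ak; have [xpk xqk] := xPQ' k kn ak; split.
    have := yz _ _ _ _ xpk (pp an ak) (gramC (pq ak an)).
    by rewrite gtn_eqF //= !mulr0 !subr0.
  have := yz _ _ _ _ xqk (pq an ak) (qq an ak).
  by rewrite gtn_eqF //= !mulr0 !subr0.
have IHy m' := IH m' y _ P Q yy yk.
have pnull : anull (p n) (vcre y (fin_exp a p q n m)).
  by apply: anull_vcre yy (fin_exp_norm n m).1 (fin_exp_anull_p m an); exact: gramC.
have qnull : anull (q n) (vcre y (fin_exp a p q n m)).
  by apply: anull_vcre yy (fin_exp_norm n m).1 (fin_exp_anull_q m an); exact: gramC.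
rewrite vcre_axpy (vcre_vpair_sub n x (P n) (Q n)) -/y.
have -> : 4 ^+ m.+1 * omega c (fun k => P k ^+ 2 + Q k ^+ 2) X n.+1 m.+1 =
    4 ^+ m.+1 * omega c (fun k => P k ^+ 2 + Q k ^+ 2) X n m.+1 +
    (2 * a n) ^+ 2 * (4 ^+ m * omega c (fun k => P k ^+ 2 + Q k ^+ 2)
      (X - (P n ^+ 2 + Q n ^+ 2)) n m).
  by rewrite omega_sub /= /c !exprS; ring.
apply: normlim_axpy; first exact: IH.
  exact: normlim_vpair (IHy m) pnull qnull.
have qv : normlim (vcre (q n) (vcre y (fin_exp a p q n m))) (1 * _) :=
  normlim_vcre qn (IHy m) qnull.
apply: (bil_vcre_null (gramC xp) xX (fin_exp_anull_p m.+1 an) qv).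
exact: bil_null (fin_exp_anull_q m.+1 an) (IHy m).
Qed.

End FiniteEnergies.

(** * Exchange of limits and series *)

Section Tannery.
Context {R : realType}.
Implicit Types (f g u v : nat -> R).

Lemma cvgn_le u v (l l' : R) K : u n @[n --> \oo] --> l -> v n @[n --> \oo] --> l' ->
  (forall n, (K <= n)%N -> u n <= v n) -> l <= l'.
Proof.
move=> ul vl uv; rewrite -(cvg_lim _ ul) // -(cvg_lim _ vl) //.
apply: ler_lim; [by apply/cvg_ex; exists l | by apply/cvg_ex; exists l' |].
by exists K.
Qed.

Lemma series_le_lim g (G : R) n : (forall k, 0 <= g k) ->
  series g n @[n --> \oo] --> G -> series g n <= G.
Proof.
move=> g0 gG; rewrite -(cvg_lim _ gG) //.
apply: nondecreasing_cvgn_le; last by apply/cvg_ex; exists G.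
exact: nondecreasing_series.
Qed.

Lemma series_tail_le f g (s G : R) K : (forall k, `|f k| <= g k) ->
  series f n @[n --> \oo] --> s -> series g n @[n --> \oo] --> G ->
  `|s - series f K| <= G - series g K.
Proof.
move=> fg fs gG.
have H : `|series f n - series f K| @[n --> \oo] --> `|s - series f K|.
  by apply: cvg_norm; apply: cvgB => //; exact: cvg_cst.
apply: (cvgn_le (K := K) H (cvg_cst _)) => n Kn.
have g_ge0 k : 0 <= g k by apply: le_trans (fg k).
have E h : series h n - series h K = \sum_(K <= k < n) h k.
  by have := sub_series_geq h Kn.
rewrite E; apply: le_trans (ler_norm_sum _ _ _) _.
apply: (@le_trans _ _ (series g n - series g K)); first by rewrite E ler_sum.
by rewrite lerB // series_le_lim.
Qed.

Lemma cvg_series_le f g (G : R) : (forall k, `|f k| <= g k) ->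
  series g n @[n --> \oo] --> G -> cvgn (series f).
Proof.
move=> fg gG; apply: normed_cvg.
have g_ge0 k : 0 <= g k by apply: le_trans (fg k).
apply: (@series_le_cvg _ (fun k => `|f k|) g) => //.
by apply/cvg_ex; exists G.
Qed.

(** Dominated convergence for series: a finite number of terms converges, and the
    tails are bounded by those of [g]. *)
Lemma tannery (F : nat -> nat -> R) g (l s : nat -> R) (G : R) :
  (forall n k, `|F n k| <= g k) -> series g n @[n --> \oo] --> G ->
  (forall k, F n k @[n --> \oo] --> l k) ->
  (forall n, (series (F n) : nat -> R) @ \oo --> s n) ->
  exists L : R, (series l n @[n --> \oo] --> L) /\ (s n @[n --> \oo] --> L).
Proof.
move=> Fg gG Fl Fs.
have lg k : `|l k| <= g k.
  by apply: (cvgn_le (K := 0) (cvg_norm (Fl k)) (cvg_cst _)).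
have cl : cvgn (series l) := cvg_series_le lg gG.
pose L := limn (series l).
have lL : series l n @[n --> \oo] --> L := cl.
exists L; split => //; apply/cvgrPdist_lt => e e0.
have e4 : 0 < e / 4 by rewrite divr_gt0.
have /cvgrPdist_lt/(_ _ e4)[K _ /(_ K (leqnn K)) /= GK] := gG.
have FK : (fun n => series (F n) K : R) @ \oo --> (series l K : R) by apply: cvg_sum_seq.
have /cvgrPdist_lt/(_ _ e4) := FK; apply: filterS => n /= nK.
have := series_tail_le K lg lL gG.
have := series_tail_le K (Fg n) (Fs n) gG.
have := le_lt_trans (ler_norm _) GK.
rewrite -/(series g K) => h1 h2 h3.
have -> : L - s n = (L - series l K) + (series l K - series (F n) K) -
  (s n - series (F n) K) by ring.
apply: le_lt_trans (ler_normB _ _) _.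
apply: le_lt_trans (lerD (ler_normD _ _) (lexx _)) _.
rewrite -/(series (F n) K) -/(series l K) in nK; lra.
Qed.

End Tannery.

Section ComplexLimits.
Context {R : realType}.
Local Notation C := R[i]^o.
Local Notation Re := (@complex.Re R).
Local Notation Im := (@complex.Im R).
Implicit Types (u : nat -> C) (l z : C).

Lemma ReD (z w : R[i]) : Re (z + w) = Re z + Re w.
Proof. by case: z; case: w. Qed.
Lemma ImD (z w : R[i]) : Im (z + w) = Im z + Im w.
Proof. by case: z; case: w. Qed.
Lemma Re_le_norm (z : R[i]) : `|Re z| <= Re `|z|.
Proof.
by rewrite normc_def /= -sqrtr_sqr ler_wsqrtr // lerDl sqr_ge0.
Qed.
Lemma Im_le_norm (z : R[i]) : `|Im z| <= Re `|z|.
Proof.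
by rewrite normc_def /= -sqrtr_sqr ler_wsqrtr // lerDr sqr_ge0.
Qed.
(** The norm of [R[i]] has values in [R[i]]; its real part is the modulus. *)
Lemma norm_ReIm (z : R[i]) : `|z| = (Re `|z|)%:C.
Proof. by rewrite RRe_real // normr_real. Qed.

Lemma cvg_real_complex (r : nat -> R) (x : R) : r n @[n --> \oo] --> x ->
  (fun n => (r n)%:C : C) @ \oo --> (x%:C : C).
Proof.
move=> rx; apply/cvgrPdist_lt => e e0.
have [eIm eRe] : Im e = 0 /\ 0 < Re e.
  by move: e0; rewrite ltcE /= => /andP[/eqP <-].
move/cvgrPdist_lt: rx => /(_ _ eRe); apply: filterS => n /= xn.
rewrite -rmorphB /= normc_def /= expr0n addr0 sqrtr_sqr ltcE /= eIm eqxx /=.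
exact: xn.
Qed.

Lemma cvg_complex u l : Re (u n) @[n --> \oo] --> Re l ->
  Im (u n) @[n --> \oo] --> Im l -> u @ \oo --> l.
Proof.
move=> ur ui; rewrite (complexE l).
rewrite (_ : u = fun n => (Re (u n))%:C + 'i%C * (Im (u n))%:C : C); last first.
  by apply/funext => n; rewrite -complexE.
apply: cvgD; first exact: cvg_real_complex.
by apply: cvgM; [exact: cvg_cst | exact: cvg_real_complex].
Qed.

Lemma cvg_Re u l : u @ \oo --> l -> Re (u n) @[n --> \oo] --> Re l.
Proof.
move=> ul; apply/cvgrPdist_lt => e e0.
have e0' : 0 < e%:C :> C by rewrite ltcR.
move/cvgrPdist_lt: ul => /(_ _ e0'); apply: filterS => n /= ln.
have -> : Re l - Re (u n) = Re (l - u n) by case: (l); case: (u n).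
apply: le_lt_trans (Re_le_norm _) _.
by move: ln; rewrite norm_ReIm ltcR.
Qed.

Lemma cvg_Im u l : u @ \oo --> l -> Im (u n) @[n --> \oo] --> Im l.
Proof.
move=> ul; apply/cvgrPdist_lt => e e0.
have e0' : 0 < e%:C :> C by rewrite ltcR.
move/cvgrPdist_lt: ul => /(_ _ e0'); apply: filterS => n /= ln.
have -> : Im l - Im (u n) = Im (l - u n) by case: (l); case: (u n).
apply: le_lt_trans (Im_le_norm _) _.
by move: ln; rewrite norm_ReIm ltcR.
Qed.

Lemma Re_sum (I : Type) (r : seq I) (P : pred I) (f : I -> R[i]) :
  Re (\sum_(i <- r | P i) f i) = \sum_(i <- r | P i) Re (f i).
Proof. by apply: (big_morph Re ReD). Qed.

Lemma Im_sum (I : Type) (r : seq I) (P : pred I) (f : I -> R[i]) :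
  Im (\sum_(i <- r | P i) f i) = \sum_(i <- r | P i) Im (f i).
Proof. by apply: (big_morph Im ImD). Qed.

Lemma tannery_complex (F : nat -> nat -> C) (g : nat -> R) (l s : nat -> C) (G : R) :
  (forall n k, Re `|F n k| <= g k) -> series g n @[n --> \oo] --> G ->
  (forall k, (fun n => F n k) @ \oo --> l k) ->
  (forall n, (series (F n) : nat -> C) @ \oo --> s n) ->
  exists L : C, (series l : nat -> C) @ \oo --> L /\ s @ \oo --> L.
Proof.
move=> Fg gG Fl Fs.
have [L1 [l1 s1]] : exists L : R, series (fun k => Re (l k)) n @[n --> \oo] --> L /\
    Re (s n) @[n --> \oo] --> L.
  apply: (tannery (F := fun n k => Re (F n k)) _ gG).
  - by move=> n k; apply: le_trans (Re_le_norm _) (Fg n k).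
  - by move=> k; exact: cvg_Re.
  - by move=> n; have := cvg_Re (Fs n); under eq_cvg do rewrite Re_sum.
have [L2 [l2 s2]] : exists L : R, series (fun k => Im (l k)) n @[n --> \oo] --> L /\
    Im (s n) @[n --> \oo] --> L.
  apply: (tannery (F := fun n k => Im (F n k)) _ gG).
  - by move=> n k; apply: le_trans (Im_le_norm _) (Fg n k).
  - by move=> k; exact: cvg_Im.
  - by move=> n; have := cvg_Im (Fs n); under eq_cvg do rewrite Im_sum.
exists (L1 +i* L2)%C; split; apply: cvg_complex => //=.
  by under eq_cvg do rewrite Re_sum.
by under eq_cvg do rewrite Im_sum.
Qed.

End ComplexLimits.

(** * Elementary symmetric functions of a summable sequence *)

Section EspLimits.
Context {R : realType}.
Implicit Types (c mu M : nat -> R).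

Lemma espn0 c n : esp c n 0 = 1.
Proof. by elim: n => //= n ->; rewrite addr0. Qed.

Lemma esp_nd c m : (forall k, 0 <= c k) -> nondecreasing_seq (fun n => esp c n m).
Proof.
move=> c0; apply/nondecreasing_seqP => n /=; rewrite lerDl.
by case: m => // m; rewrite mulr_ge0 // esp_ge0.
Qed.

(** The first two terms of the binomial expansion. This is the step of the
    induction that bounds [e_m (c)] by [(sum c)^m / m!]. *)
Lemma exp_coeffS_ge (s t : R) m : 0 <= s -> 0 <= t ->
  exp_coeff s m.+1 + t * exp_coeff s m <= exp_coeff (s + t) m.+1.
Proof.
move=> s0 t0; have H k : s ^+ k.+1 + k.+1%:R * (t * s ^+ k) <= (s + t) ^+ k.+1.
  elim: k => [|k IH]; first by rewrite !expr1 expr0; lra.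
  rewrite [leRHS]exprS; apply: le_trans (ler_wpM2l _ IH); last exact: addr_ge0.
  rewrite -[k.+2%:R]natr1 -subr_ge0 [leRHS](_ : _ = k.+1%:R * (t * t * s ^+ k)).
    by rewrite !mulr_ge0 // exprn_ge0.
  by rewrite !exprS; ring.
rewrite /exp_coeff /= factS natrM invfM.
have f0 : 0 < m`!%:R :> R by rewrite ltr0n fact_gt0.
have -> : t * (s ^+ m / m`!%:R) = m.+1%:R * (t * s ^+ m) * (m.+1%:R^-1 / m`!%:R).
  by field; rewrite (gt_eqF f0) nat1r pnatr_eq0.
by rewrite -mulrDl ler_pM2r // divr_gt0 // invr_gt0 ltr0n.
Qed.

Lemma exp_coeff_le (s t : R) m : 0 <= s -> s <= t -> exp_coeff s m <= exp_coeff t m.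
Proof.
move=> s0 st; rewrite /exp_coeff /= ler_pM2r ?invr_gt0 ?ltr0n ?fact_gt0 //.
by rewrite lerXn2r // nnegrE // (le_trans s0).
Qed.

Lemma esp_le c n m : (forall k, 0 <= c k) ->
  esp c n m <= exp_coeff (\sum_(k < n) c k) m.
Proof.
move=> c0; elim: n m => [|n IH] [|m].
- by rewrite /exp_coeff /= expr0 fact0 divr1.
- by rewrite /= big_ord0 /exp_coeff /= expr0n mul0r.
- by rewrite espn0 /exp_coeff /= expr0 fact0 divr1.
rewrite big_ord_recr /=; apply: le_trans (exp_coeffS_ge _ _ (c0 n)).
  by rewrite lerD // ler_wpM2l.
by apply: sumr_ge0.
Qed.

(** Stated along a ring morphism so as to cover real and complex [z]. *)
Lemma esp_prod (K : comNzRingType) (phi : {rmorphism R -> K}) c (z : K) n N :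
  (n < N)%N -> \sum_(0 <= m < N) z ^+ m * phi (esp c n m) =
  \prod_(k < n) (1 + z * phi (c k)).
Proof.
elim: n N => [|n IH] [|N] // nN.
  rewrite big_ord0 big_nat_recl // big1_seq ?addr0; first by rewrite expr0 rmorph1 mulr1.
  by move=> m _; rewrite /= rmorph0 mulr0.
rewrite big_ord_recr /= mulrDr mulr1 -{1}(IH N.+1) 1?ltnW // -(IH N) //.
rewrite [LHS]big_nat_recl // [X in _ = X + _]big_nat_recl //= addr0 -addrA.
congr (_ + _); rewrite mulr_suml -big_split /=; apply: eq_bigr => m _.
by rewrite rmorphD rmorphM exprS; ring.
Qed.

Lemma esp_shift c n m : esp c n.+1 m.+1 =
  esp (fun k => c k.+1) n m.+1 + c 0%N * esp (fun k => c k.+1) n m.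
Proof.
elim: n m => [|n IH] m; first by case: m.
rewrite -[LHS]/(esp c n.+1 m.+1 + c n.+1 * esp c n.+1 m) IH.
case: m => [|m]; first by rewrite !espn0 /= !espn0; ring.
by rewrite IH /=; ring.
Qed.

(** The elementary symmetric function of degree [m] of an infinite sequence, that
    is, the [m]-th Taylor coefficient of [prod_k (1 + z c_k)]. *)
Definition einf c m : R := limn (fun n => esp c n m).

Section Bounded.
Variables (c : nat -> R) (C : R).
Hypothesis c_ge0 : forall k, 0 <= c k.
Hypothesis c_sum : forall n, \sum_(k < n) c k <= C.

Lemma esp_le_coeff n m : esp c n m <= exp_coeff C m.
Proof.
by apply: le_trans (esp_le _ _ c_ge0) _; rewrite exp_coeff_le // sumr_ge0.
Qed.

Lemma esp_cvg m : esp c n m @[n --> \oo] --> einf c m.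
Proof.
apply: nondecreasing_is_cvgn; first exact: esp_nd.
by exists (exp_coeff C m) => _ [n _ <-]; exact: esp_le_coeff.
Qed.

Lemma einf_ge0 m : 0 <= einf c m.
Proof. by apply: (cvgn_le (K := 0) (cvg_cst _) (@esp_cvg m)) => n _; exact: esp_ge0. Qed.

Lemma einf_le m : einf c m <= exp_coeff C m.
Proof.
by apply: (cvgn_le (K := 0) (@esp_cvg m) (cvg_cst _)) => n _; exact: esp_le_coeff.
Qed.

Lemma einf0 : einf c 0 = 1.
Proof.
apply: cvg_lim => //; rewrite (_ : (fun n => _) = fun=> 1); first exact: cvg_cst.
by apply/funext => n; rewrite espn0.
Qed.

Lemma einf1_lim : \sum_(k < n) c k @[n --> \oo] --> einf c 1.
Proof.
rewrite (_ : (fun n => _) = fun n => esp c n 1); first exact: esp_cvg.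
apply/funext; elim=> [|n IH]; first by rewrite big_ord0.
by rewrite big_ord_recr /= IH espn0 mulr1.
Qed.

Lemma exp_coeffM (r : R) k : r ^+ k * exp_coeff C k = exp_coeff (r * C) k.
Proof. by rewrite /exp_coeff /= exprMn mulrA. Qed.

Lemma einf_series_real (z : R) : exists L : R,
  (series (fun k => z ^+ k * einf c k) n @[n --> \oo] --> L) /\
  (\prod_(k < n) (1 + z * c k) @[n --> \oo] --> L).
Proof.
apply: (tannery (F := fun n k => z ^+ k * esp c n k)
    (g := exp_coeff (`|z| * C)) (G := limn (series (exp_coeff (`|z| * C))))).
- move=> n k; rewrite normrM normrX -exp_coeffM ler_wpM2l ?exprn_ge0 //.
  by rewrite ger0_norm ?esp_ge0 // esp_le_coeff.
- exact: is_cvg_series_exp_coeff.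
- by move=> k; apply: cvgM; [exact: cvg_cst | exact: esp_cvg].
- move=> n; apply: cvg_near_cst; exists n.+1 => // N /= nN.
  by rewrite /series /= (esp_prod idfun).
Qed.

(** The bound [e_m <= C^m / m!] dominates the expansions of the finite products
    uniformly in their length. *)
Lemma einf_series (z : R[i]^o) : exists L : R[i]^o,
  ((series (fun k => z ^+ k * (einf c k)%:C) : nat -> R[i]^o) @ \oo --> L) /\
  ((fun n => \prod_(k < n) (1 + z * (c k)%:C) : R[i]^o) @ \oo --> L).
Proof.
apply: (tannery_complex (F := fun n k => z ^+ k * (esp c n k)%:C)
    (g := exp_coeff (complex.Re `|z| * C))
    (G := limn (series (exp_coeff (complex.Re `|z| * C))))).
- move=> n k; have ReC (r : R) : complex.Re r%:C = r by [].
  rewrite normrM normrX [X in _ * X]ger0_norm ?ler0c ?esp_ge0 // norm_ReIm.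
  rewrite -rmorphXn -rmorphM ReC -exp_coeffM ler_wpM2l ?esp_le_coeff //.
  by rewrite exprn_ge0 // -ler0c -norm_ReIm.
- exact: is_cvg_series_exp_coeff.
- move=> k; apply: cvgM; first exact: cvg_cst.
  by apply: cvg_real_complex; exact: esp_cvg.
- move=> n; apply: cvg_near_cst; exists n.+1 => // N /= nN.
  by rewrite /series /= (esp_prod (real_complex R)).
Qed.

(** The moments of the measure with mass [mu k] at [c k], completed by a mass at
    zero that makes the total mass [X]. *)
Definition fmoment mu (X : R) n j : R :=
  if j is 0%N then X else \sum_(k < n) c k ^+ j * mu k.

(** [sum_m omega_m z^m] is the product of [sum_m e_m z^m] and the series of the
    moments with alternating signs, because [c_k / (1 + z c_k)] is a geometric
    series in [- z c_k]. The identity is proved as one between coefficients, by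
    the recursion on [n]. *)
Lemma omegaE mu X n m : omega c mu X n m =
  \sum_(j < m.+1) (-1) ^+ j * esp c n (m - j) * fmoment mu X n j.
Proof.
elim: n m => [|n IH] m.
  rewrite big_ord_recl big1 ?addr0 /=.
    by case: m => [|m] /=; rewrite ?subn0 /=; ring.
  by move=> j _; rewrite /fmoment /= big_ord0 mulr0.
case: m => [|m].
  by rewrite [LHS]/= addr0 IH !big_ord1 !subn0 !espn0.
pose e := esp c n; pose f := fmoment mu X n.
pose conv (h : nat -> R) m' := \sum_(j < m'.+1) (-1) ^+ j * e (m' - j)%N * h j.
pose h j := if j is 0%N then 0 else c n ^+ j * mu n.
have fS j : fmoment mu X n.+1 j = f j + h j.
  by case: j => [|j]; rewrite /f /h /fmoment ?addr0 // big_ord_recr.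
have -> : omega c mu X n.+1 m.+1 = omega c mu X n m.+1 +
   c n * (omega c mu X n m - mu n * e m) by [].
have -> : \sum_(j < m.+2) (-1) ^+ j * esp c n.+1 (m.+1 - j) * fmoment mu X n.+1 j =
    conv (fun j => f j + h j) m.+1 + c n * conv (fun j => f j + h j) m.
  have e'S i : esp c n.+1 i.+1 = e i.+1 + c n * e i by [].
  have e'0 : esp c n.+1 0 = e 0 by rewrite /e !espn0.
  under eq_bigr do rewrite fS; move: (esp c n.+1) e'S e'0 => e' e'S e'0.
  rewrite /conv big_ord_recr [in RHS]big_ord_recr /= !subnn e'0.
  rewrite addrAC mulr_sumr -big_split /=; congr (_ + _).
  apply: eq_bigr => j _; rewrite subSn ?e'S; last by rewrite -ltnS.
  by ring.
have convD g1 g2 m' : conv (fun j => g1 j + g2 j) m' = conv g1 m' + conv g2 m'.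
  by rewrite /conv -big_split /=; apply: eq_bigr => j _; ring.
have convh : conv h m.+1 = - c n * (conv h m + mu n * e m).
  have -> : conv h m + mu n * e m = conv (fun j => c n ^+ j * mu n) m.
    rewrite /conv [in LHS]big_ord_recl [RHS]big_ord_recl /= subn0.
    rewrite mulr0 add0r addrC !expr0; congr (_ + _); first by ring.
  rewrite /conv [LHS]big_ord_recl /= mulr0 add0r mulr_sumr; apply: eq_bigr => j _.
  by rewrite /bump /= add1n subSS !exprS; ring.
rewrite !convD convh !IH -/(conv f m.+1) -/(conv f m).
by ring.
Qed.

Lemma omega_cvg mu (X : R) (M : nat -> R) m : M 0 = X ->
  (forall j, (0 < j)%N -> \sum_(k < n) c k ^+ j * mu k @[n --> \oo] --> M j) ->
  omega c mu X n m @[n --> \oo] -->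
    \sum_(j < m.+1) (-1) ^+ j * einf c (m - j) * M j.
Proof.
move=> M0 MM; under eq_cvg do rewrite omegaE.
apply: cvg_sum_seq => j _; apply: cvgM.
  by apply: cvgM; [exact: cvg_cst | exact: esp_cvg].
by case: (j : nat) => [|k]; [rewrite M0; exact: cvg_cst | exact: MM].
Qed.

(** The summand [mu k] occurs for the sets [U] that contain [k], which contribute
    [z c_k] times the product of the other factors. *)
Lemma omega_prod mu (X z : R) n N : (n < N)%N -> (forall k, 1 + z * c k != 0) ->
  \sum_(0 <= m < N) z ^+ m * omega c mu X n m =
  \prod_(k < n) (1 + z * c k) *
    (X - \sum_(k < n) z * c k / (1 + z * c k) * mu k).
Proof.
move=> nN z0; elim: n N nN => [|n IH] [|N] // nN.
  rewrite !big_ord0 big_nat_recl // big1_seq ?addr0; first by rewrite expr0 !mul1r subr0.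
  by move=> m _; rewrite /= mulr0.
rewrite !big_ord_recr /=; set P := \prod_(k < n) _; set S := \sum_(k < n) _.
have E1 := IH N.+1 (ltnW nN); have E2 := IH N nN.
transitivity (\sum_(0 <= m < N.+1) z ^+ m * omega c mu X n m +
   z * c n * (\sum_(0 <= m < N) z ^+ m * omega c mu X n m -
    mu n * \sum_(0 <= m < N) z ^+ m * esp c n m)).
  rewrite [LHS]big_nat_recl // [X in _ = X + _]big_nat_recl //= addr0 -addrA.
  congr (_ + _); rewrite mulr_sumr -sumrB mulr_sumr -big_split /=.
  by apply: eq_bigr => m _; rewrite exprS; ring.
rewrite E1 E2 (esp_prod idfun) //= -/P -/S.
by field; exact: z0.
Qed.

End Bounded.

(** Beyond some index the [t k] sum up to at most [1/2], and there Weierstrass'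
    inequality [prod (1 - t) >= 1 - sum t] applies; the finitely many factors
    before it are positive. *)
Lemma prod_one_sub_bounded_below (t : nat -> R) (C : R) :
  (forall k, 0 <= t k < 1) -> (forall n, \sum_(k < n) t k <= C) ->
  exists2 r : R, 0 < r & forall n, r <= \prod_(k < n) (1 - t k).
Proof.
move=> t01 tC.
have t0 k : 0 <= t k by case/andP: (t01 k).
have t1 k : 0 < 1 - t k by case/andP: (t01 k); rewrite subr_gt0.
have tl := einf1_lim t0 tC.
have h0 : 0 < (2 : R)^-1 by rewrite invr_gt0.
move/cvgrPdist_lt: (tl) => /(_ _ h0)[K _ /(_ K (leqnn K)) /= HK].
have P0 n : 0 < \prod_(k < n) (1 - t k) by apply: prodr_gt0.
exists (\prod_(k < K) (1 - t k) / 2); first by rewrite divr_gt0.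
have nd n : \prod_(k < n.+1) (1 - t k) <= \prod_(k < n) (1 - t k).
  by rewrite big_ord_recr /= ler_piMr ?(ltW (P0 n)) // gerBl.
have tail n : \prod_(k < K) (1 - t k) * (1 - \sum_(K <= k < K + n) t k) <=
    \prod_(k < K + n) (1 - t k).
  elim: n => [|n IH]; first by rewrite addn0 big_geq // subr0 mulr1.
  rewrite addnS big_ord_recr /= big_nat_recr /= ?leq_addr //.
  have h : \prod_(k < K + n) (1 - t k) <= \prod_(k < K) (1 - t k).
    by elim: (n) => [|n' IH']; rewrite ?addn0 // addnS (le_trans (nd _)).
  rewrite opprD addrA mulrBr [leRHS]mulrBr mulr1.
  by rewrite lerB // ler_wpM2r.
have tail2 n : \sum_(K <= k < K + n) t k <= 2^-1.
  have -> : \sum_(K <= k < K + n) t k = \sum_(k < K + n) t k - \sum_(k < K) t k.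
    rewrite -!(big_mkord xpredT t) (big_cat_nat (leq0n K) (leq_addr n K)) /=.
    by rewrite addrC addrK.
  have Kn : \sum_(k < K + n) t k <= einf t 1.
    apply: (cvgn_le (K := (K + n)%N) (cvg_cst _) tl) => m Knm.
    by rewrite -!(big_mkord xpredT t) (big_cat_nat (leq0n (K + n)) Knm) /= lerDl sumr_ge0.
  have := le_lt_trans (ler_norm _) HK; lra.
move=> n; have [nK|Kn] := leqP n K.
  apply: (@le_trans _ _ (\prod_(k < K) (1 - t k))).
    by have := P0 K; lra.
  rewrite -(subnKC nK); elim: (K - n)%N => [|m IH]; first by rewrite addn0.
  by rewrite addnS (le_trans (nd _)).
rewrite -(subnKC (ltnW Kn)); apply: le_trans (tail (n - K)%N).
by rewrite ler_wpM2l ?(ltW (P0 K)) //; have := tail2 (n - K)%N; lra.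
Qed.

Lemma einf_shift c C : (forall k, 0 <= c k) -> (forall n, \sum_(k < n) c k <= C) ->
  forall m,
  einf c m.+1 = einf (fun k => c k.+1) m.+1 + c 0%N * einf (fun k => c k.+1) m.
Proof.
move=> c0 cC m.
have cC' n : \sum_(k < n) c k.+1 <= C.
  by apply: le_trans (cC n.+1); rewrite big_ord_recl lerDr.
have H : esp c n.+1 m.+1 @[n --> \oo] --> einf c m.+1.
  by rewrite (cvg_shiftS (fun n => esp c n m.+1)); exact: esp_cvg c0 cC _.
apply: (cvg_unique _ H) => //.
rewrite (_ : (fun n => _) = fun n => esp (fun k => c k.+1) n m.+1 +
   c 0%N * esp (fun k => c k.+1) n m).
  apply: cvgD; first exact: (esp_cvg (c := fun k => c k.+1) _ cC').
  apply: cvgM; first exact: cvg_cst.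
  exact: (esp_cvg (c := fun k => c k.+1) _ cC').
by apply/funext => n; rewrite esp_shift.
Qed.

(** At [z = - 1 / c 0] the product for [c] vanishes. If [c 0] exceeded [c' 0], all
    factors of the product for [c'] would be positive there, and the product
    would not vanish. *)
Lemma einf_head_le c c' C C' : (forall k, 0 <= c k) -> (forall k, 0 <= c' k) ->
  (forall k, c' k.+1 <= c' k) ->
  (forall n, \sum_(k < n) c k <= C) -> (forall n, \sum_(k < n) c' k <= C') ->
  (forall m, einf c m = einf c' m) -> c 0%N <= c' 0%N.
Proof.
move=> c0 c'0 c'd cC cC' E; rewrite leNgt; apply/negP => lt.
have p0 : 0 < c 0%N by exact: le_lt_trans (c'0 0%N) lt.
have [L [L1 L2]] := einf_series_real c0 cC (- (c 0%N)^-1).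
have [L' [L1' L2']] := einf_series_real c'0 cC' (- (c 0%N)^-1).
have LL : L = L'.
  apply: (cvg_unique _ L1) => //.
  suff -> : einf c = einf c' by [].
  by apply/funext => k; rewrite E.
have L0 : L = 0.
  apply: (cvg_unique _ L2) => //; apply: cvg_near_cst; exists 1%N => // -[//|n] _.
  by rewrite big_ord_recl /= mulNr mulVf ?gt_eqF // subrr mul0r.
have c'le k : c' k <= c' 0%N by elim: k => // k IH; rewrite (le_trans (c'd k)).
have [k|n|r r0 rP] := @prod_one_sub_bounded_below (fun k => (c 0%N)^-1 * c' k)
    ((c 0%N)^-1 * C').
- rewrite mulr_ge0 ?invr_ge0 //= ltr_pdivrMl // mulr1.
  by apply: le_lt_trans (c'le k) lt.
- by rewrite -mulr_sumr ler_wpM2l // invr_ge0.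
have : r <= L'.
  apply: (cvgn_le (K := 0) (cvg_cst _) L2') => n _.
  by under eq_bigr do rewrite mulNr; exact: rP.
by rewrite -LL L0 leNgt r0.
Qed.

(** The largest terms agree by [einf_head_le]; dividing both products by this
    factor leaves those of the shifted sequences. *)
Lemma einf_inj c c' C C' : (forall k, 0 <= c k) -> (forall k, 0 <= c' k) ->
  (forall k, c k.+1 <= c k) -> (forall k, c' k.+1 <= c' k) ->
  (forall n, \sum_(k < n) c k <= C) -> (forall n, \sum_(k < n) c' k <= C') ->
  (forall m, einf c m = einf c' m) -> forall k, c k = c' k.
Proof.
move=> c0 c'0 cd c'd cC cC' E k.
elim: k c c' c0 c'0 cd c'd cC cC' E => [|k IH] c c' c0 c'0 cd c'd cC cC' E.
  apply/eqP; rewrite eq_le (einf_head_le c0 c'0 c'd cC cC' E).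
  by rewrite (einf_head_le c'0 c0 cd cC' cC).
have h0 : c 0%N = c' 0%N.
  apply/eqP; rewrite eq_le (einf_head_le c0 c'0 c'd cC cC' E).
  by rewrite (einf_head_le c'0 c0 cd cC' cC).
have tC (g : nat -> R) (D : R) : (forall k, 0 <= g k) -> (forall n, \sum_(k < n) g k <= D) ->
    forall n, \sum_(k < n) g k.+1 <= D.
  by move=> g0 gD n; apply: le_trans (gD n.+1); rewrite big_ord_recl lerDr.
apply: (IH (fun k => c k.+1) (fun k => c' k.+1)) => //; try exact: tC.
elim=> [|m IHm].
  by rewrite !einf0.
have := E m.+1; rewrite (einf_shift c0 cC m) (einf_shift c'0 cC' m) h0 IHm.
by move/addIr.
Qed.

End EspLimits.

(** * Orthonormal systems in a Hilbert space *)

Section Hilbert.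
Context {R : realType} {H : completeNormedModType R}.
Variable ip : {dot H for idfun}.
Hypothesis ip_norm : hilbert_inner ip.
Implicit Types (x y z u v : H).

Lemma ipC u v : ip u v = ip v u.
Proof. by have := hermC ip u v; rewrite /= expr0 mul1r. Qed.
Lemma ipDl u v w : ip (u + v) w = ip u w + ip v w.
Proof. exact: linearDl. Qed.
Lemma ipDr u v w : ip w (u + v) = ip w u + ip w v.
Proof. exact: linearDr. Qed.
Lemma ipBl u v w : ip (u - v) w = ip u w - ip v w.
Proof. exact: linearBl. Qed.
Lemma ipBr u v w : ip w (u - v) = ip w u - ip w v.
Proof. exact: linearBr. Qed.
Lemma ipNl u w : ip (- u) w = - ip u w.
Proof. exact: linearNl. Qed.
Lemma ipNr u w : ip w (- u) = - ip w u.
Proof. exact: linearNr. Qed.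
Lemma ip0l w : ip 0 w = 0.
Proof. exact: linear0l. Qed.
Lemma ip0r w : ip w 0 = 0.
Proof. exact: linear0r. Qed.
Lemma ipZl a u w : ip (a *: u) w = a * ip u w.
Proof. by rewrite linearZl_LR. Qed.
Lemma ipZr a u w : ip w (a *: u) = a * ip w u.
Proof. by rewrite linearZr_LR. Qed.
Lemma ip_suml (I : Type) (r : seq I) (P : pred I) (f : I -> H) w :
  ip (\sum_(i <- r | P i) f i) w = \sum_(i <- r | P i) ip (f i) w.
Proof. exact: linear_sumlz. Qed.
Lemma ip_sumr (I : Type) (r : seq I) (P : pred I) (f : I -> H) w :
  ip w (\sum_(i <- r | P i) f i) = \sum_(i <- r | P i) ip w (f i).
Proof. by rewrite ipC ip_suml; apply: eq_bigr => i _; rewrite ipC. Qed.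

Lemma ip_ge0 u : 0 <= ip u u.
Proof. by rewrite ip_norm exprn_ge0. Qed.

Lemma ip_eq0 u : ip u u = 0 -> u = 0.
Proof.
by rewrite ip_norm => /eqP; rewrite sqrf_eq0 normr_eq0 => /eqP.
Qed.

Lemma ip_inj u v : (forall w, ip u w = ip v w) -> u = v.
Proof.
move=> uv; apply/eqP; rewrite -subr_eq0; apply/eqP/ip_eq0.
by rewrite ipBl uv subrr.
Qed.

Lemma ip_CS u v : `|ip u v| <= `|u| * `|v|.
Proof.
have h (s : R) : s ^+ 2 = 1 -> s * ip u v <= `|u| * `|v|.
  move=> s1; have := ip_ge0 (`|v| *: u - s *: (`|u| *: v)).
  rewrite !(ipBl, ipBr, ipZl, ipZr) !ip_norm (ipC v u) => h.
  have : 0 <= 2 * (`|u| * `|v|) * (`|u| * `|v| - s * ip u v).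
    apply: le_trans h _; rewrite le_eqVlt; apply/orP; left; apply/eqP.
    transitivity (`|v| ^+ 2 * `|u| ^+ 2 + s ^+ 2 * (`|u| ^+ 2 * `|v| ^+ 2) -
       2 * s * (`|v| * `|u|) * ip u v); first by ring.
    by rewrite s1; ring.
  have := mulr_ge0 (normr_ge0 u) (normr_ge0 v).
  rewrite le_eqVlt => /orP[/eqP uv0|uv0].
    move/eqP: (esym uv0); rewrite mulf_eq0 !normr_eq0 => /orP[] /eqP ->.
      by rewrite ip0l mulr0 mulr_ge0.
    by rewrite ip0r mulr0 mulr_ge0.
  by rewrite pmulr_rge0 ?subr_ge0 // mulr_gt0.
rewrite ler_norml; apply/andP; split.
  by rewrite lerNl -mulN1r h // sqrrN expr1n.
by rewrite -[ip u v]mul1r h // expr1n.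
Qed.

Lemma cvg_ipl (T : Type) (FF : set_system T) (f : T -> H) u v : Filter FF ->
  f t @[t --> FF] --> u -> ip (f t) v @[t --> FF] --> ip u v.
Proof.
move=> FFF fu; apply/cvgrPdist_lt => e e0.
have e1 : 0 < e / (`|v| + 1) by rewrite divr_gt0 // ltr_wpDl.
move/cvgrPdist_lt: fu => /(_ _ e1); apply: filterS => x ux.
rewrite -ipBl; apply: le_lt_trans (ip_CS _ _) _.
apply: le_lt_trans (_ : `|u - f x| * (`|v| + 1) < e).
  by rewrite ler_wpM2l // lerDl.
by rewrite -ltr_pdivlMr // ltr_wpDl.
Qed.

(** A net is Cauchy when its increments are controlled by those of a convergent
    real net. Both the expansion in a basis, along finite sets, and that in an
    orthonormal sequence are obtained in this way. *)
Lemma cvg_of_energy (T : Type) (FF : set_system T) (z : T -> H) (E : T -> R) (M : R) :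
  ProperFilter FF -> E t @[t --> FF] --> M ->
  (forall t0, \forall t \near FF, `|z t - z t0| ^+ 2 <= E t - E t0) ->
  cvg (z t @[t --> FF]).
Proof.
move=> FFF EM zE; apply: cauchy_cvg; apply: cauchy_exP => e e0.
have e2 : 0 < e ^+ 2 / 2 by rewrite divr_gt0 // exprn_gt0.
move/cvgrPdist_lt: EM => /(_ _ e2) EM.
have [t0 /= Et0] := filter_ex EM.
exists (z t0); apply: filterS2 EM (zE t0) => t /= Et zt.
rewrite -ball_normE /= distrC -(@ltr_pXn2r _ 2) ?nnegrE ?normr_ge0 ?ltW //.
apply: le_lt_trans zt _.
have := ler_norm (M - E t0); have := ler_norm (-(M - E t)); rewrite normrN.
lra.
Qed.

Lemma cvg_totally_nd (K : choiceType) (E : {fset K} -> R) (M : R) :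
  (forall F G, (F `<=` G)%fset -> E F <= E G) -> (forall F, E F <= M) ->
  exists L : R, E F @[F --> totally] --> L.
Proof.
move=> Emono EM; exists (sup (range E)).
have hs : has_sup (range E).
  by split; [exists (E fset0); exists fset0 | exists M => _ [F _ <-]].
apply/cvgrPdist_lt => e e0.
have [_ [F _ <-] EF] := sup_adherent e0 hs.
exists F => // G /= FG; have := Emono _ _ FG.
have : E G <= sup (range E) by apply: ub_le_sup; [case: hs | exists G].
by move=> h1 h2; rewrite ger0_norm ?subr_ge0 //; lra.
Qed.

(** An orthonormal system, padded with zero vectors off [kappa]. This encodes a
    possibly finite sequence of planes by a family over [nat]. *)
Definition osys (K : eqType) (f : K -> H) (kappa : pred K) :=
  forall i j, ip (f i) (f j) = (kappa i && (i == j))%:R.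

Section OrthonormalSystem.
Context {K : choiceType}.
Variables (f : K -> H) (kappa : pred K).
Hypothesis fK : osys f kappa.

Lemma osys0 i : ~~ kappa i -> f i = 0.
Proof. by move=> /negbTE ki; apply: ip_eq0; rewrite fK ki. Qed.

Lemma ip_kappa i y : (kappa i)%:R * ip y (f i) = ip y (f i).
Proof.
by case: (boolP (kappa i)) => [_|/osys0 ->]; rewrite ?mul1r // ip0r mulr0.
Qed.

Lemma ip_comb (r : seq K) (c : K -> R) j : uniq r ->
  ip (\sum_(i <- r) c i *: f i) (f j) = (j \in r)%:R * (c j * (kappa j)%:R).
Proof.
move=> ur; rewrite ip_suml; under eq_bigr do rewrite ipZl fK.
case: (boolP (j \in r)) => jr.
  rewrite (bigD1_seq j) //= eqxx andbT mul1r big1 ?addr0 // => i /negbTE ->.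
  by rewrite andbF mulr0.
rewrite mul0r big1_seq // => i /andP[_ ir].
case: eqP => [ij|_]; first by rewrite -ij ir in jr.
by rewrite andbF mulr0.
Qed.

Lemma norm_comb (r : seq K) (c : K -> R) : uniq r ->
  `|\sum_(i <- r) c i *: f i| ^+ 2 = \sum_(i <- r) c i ^+ 2 * (kappa i)%:R.
Proof.
move=> ur; rewrite -ip_norm ip_sumr; apply: eq_big_seq => i ir.
by rewrite ipZr ip_comb // ir mul1r expr2 mulrA.
Qed.

Lemma bessel_dist (r : seq K) y : uniq r ->
  `|y - \sum_(i <- r) ip y (f i) *: f i| ^+ 2 =
  `|y| ^+ 2 - \sum_(i <- r) ip y (f i) ^+ 2.
Proof.
move=> ur; rewrite -ip_norm ipBl !ipBr !ip_norm norm_comb //.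
rewrite ip_sumr ip_suml.
have E : \sum_(i <- r) ip y (f i) ^+ 2 * (kappa i)%:R = \sum_(i <- r) ip y (f i) ^+ 2.
  by apply: eq_bigr => i _; rewrite mulrC expr2 mulrA ip_kappa.
have E1 : \sum_(i <- r) ip y (ip y (f i) *: f i) = \sum_(i <- r) ip y (f i) ^+ 2.
  by apply: eq_bigr => i _; rewrite ipZr expr2.
have E2 : \sum_(i <- r) ip (ip y (f i) *: f i) y = \sum_(i <- r) ip y (f i) ^+ 2.
  by apply: eq_bigr => i _; rewrite ipZl (ipC (f i)) expr2.
by rewrite E E1 E2; ring.
Qed.

Lemma bessel (r : seq K) y : uniq r -> \sum_(i <- r) ip y (f i) ^+ 2 <= `|y| ^+ 2.
Proof. by move=> ur; rewrite -subr_ge0 -bessel_dist // exprn_ge0. Qed.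

End OrthonormalSystem.

Section Parseval.
Context {K : choiceType} (e : K -> H).
Hypothesis e_basis : orthonormal_basis ip e.

Lemma basis_osys : osys e xpredT.
Proof. by move=> i j; rewrite e_basis.1. Qed.

Let P y (F : {fset K}) := \sum_(i <- F) ip y (e i) *: e i.

(** The projections onto finite parts of the basis form a Cauchy net; the limit
    has the coefficients of [y], and maximality of the family identifies it. *)
Lemma basis_expansion y : P y F @[F --> totally] --> y.
Proof.
have Pe F G : (F `<=` G)%fset -> `|P y G - P y F| ^+ 2 =
    \sum_(i <- G) ip y (e i) ^+ 2 - \sum_(i <- F) ip y (e i) ^+ 2.
  move=> FG; have PFG : ip (P y F) (P y G) = \sum_(i <- F) ip y (e i) ^+ 2.
    rewrite /P ip_suml; apply: eq_big_seq => i iF.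
    rewrite ipZl (ipC (e i)) (ip_comb basis_osys) ?fset_uniq // (fsubsetP FG) //=.
    by rewrite mul1r mulr1 expr2.
  have PP F' : `|P y F'| ^+ 2 = \sum_(i <- F') ip y (e i) ^+ 2.
    by rewrite (norm_comb basis_osys) ?fset_uniq //; under eq_bigr do rewrite mulr1.
  rewrite -ip_norm ipBl !ipBr !ip_norm (ipC (P y G)) PFG !PP.
  by ring.
have [L EL] : exists L : R, (\sum_(i <- F) ip y (e i) ^+ 2) @[F --> totally] --> L.
  apply: (cvg_totally_nd (M := `|y| ^+ 2)) => [F G FG|F].
    by rewrite -subr_ge0 -Pe // exprn_ge0.
  by apply: (bessel basis_osys); exact: fset_uniq.
have cP : cvg (P y F @[F --> totally]).
  by apply: (cvg_of_energy totally_filter EL) => F0; exists F0 => // F /= FF; rewrite Pe.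
pose y' := lim (P y F @[F --> totally]).
have cP' : P y F @[F --> totally] --> y' := cP.
suff E : y' = y by rewrite -[X in _ --> X]E.
apply/eqP; rewrite -subr_eq0; apply/eqP; apply: e_basis.2 => i.
rewrite ipBl; apply/eqP; rewrite subr_eq0; apply/eqP.
apply: (cvg_unique _ (cvg_ipl (v := e i) _ cP')) => //.
apply: cvg_near_cst; exists [fset i]%fset => // F /=; rewrite fsub1set => iF.
by rewrite (ip_comb basis_osys) ?fset_uniq // iF mul1r mulr1.
Qed.

Lemma parseval y z :
  \sum_(i <- F) ip y (e i) * ip z (e i) @[F --> totally] --> ip y z.
Proof.
have := cvg_ipl (v := z) _ (@basis_expansion y).
rewrite (_ : (fun F => ip (P y F) z) = fun F => \sum_(i <- F) ip y (e i) * ip z (e i)).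
  exact.
by apply/funext => F; rewrite ip_suml; apply: eq_bigr => i _; rewrite ipZl (ipC (e i)).
Qed.

End Parseval.

Section DiagonalOperators.
Variables (g : nat -> H) (kappa : pred nat).
Hypothesis gK : osys g kappa.

Definition phi_part (s : nat -> R) y n := \sum_(0 <= i < n) (s i * ip y (g i)) *: g i.
(** The operator that is diagonal in the system [g], with eigenvalues [s]. *)
Definition phi (s : nat -> R) y : H := limn (phi_part s y).
Definition sbounded (s : nat -> R) := exists B : R, forall i, `|s i| <= B.

Lemma phi_cvg s y : sbounded s -> phi_part s y n @[n --> \oo] --> phi s y.
Proof.
move=> [B sB]; pose E n : R := \sum_(0 <= i < n) (s i * ip y (g i)) ^+ 2.
have ndE : nondecreasing_seq E.
  by apply: nondecreasing_series => n _ _; exact: sqr_ge0.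
have cE : cvgn E.
  apply: nondecreasing_is_cvgn => //; exists (B ^+ 2 * `|y| ^+ 2) => _ [n _ <-].
  apply: (@le_trans _ _ (B ^+ 2 * \sum_(0 <= i < n) ip y (g i) ^+ 2)).
    rewrite /E mulr_sumr ler_sum // => i _; rewrite exprMn ler_wpM2r ?sqr_ge0 //.
    by rewrite -[s i ^+ 2]real_normK ?num_real // lerXn2r ?nnegrE ?normr_ge0 // (le_trans _ (sB i)).
  by rewrite ler_wpM2l ?sqr_ge0 // (bessel gK) ?iota_uniq.
apply: (cvg_of_energy (E := E) (M := limn E)) => // m; exists m => // n /= mn.
have subl (V : zmodType) (X Y : V) : X + Y - X = Y by rewrite addrC addKr.
rewrite /phi_part /E !(big_cat_nat (leq0n m) mn) /= !subl.
rewrite (norm_comb gK) ?iota_uniq // ler_sum // => i _.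
by case: (kappa i); rewrite ?mulr1 // mulr0 sqr_ge0.
Qed.

Lemma phi_ip s y z : sbounded s ->
  \sum_(0 <= i < n) s i * ip y (g i) * ip z (g i) @[n --> \oo] --> ip (phi s y) z.
Proof.
move=> sB; have := cvg_ipl (v := z) _ (@phi_cvg s y sB).
rewrite (_ : (fun n => ip (phi_part s y n) z) =
  fun n => \sum_(0 <= i < n) s i * ip y (g i) * ip z (g i)); first exact.
by apply/funext => n; rewrite ip_suml; apply: eq_bigr => i _; rewrite ipZl (ipC (g i)).
Qed.

Lemma phi_coef s y i : sbounded s -> ip (phi s y) (g i) = s i * ip y (g i).
Proof.
move=> sB; apply: (cvg_unique _ (cvg_ipl (v := g i) _ (@phi_cvg s y sB))) => //.
apply: cvg_near_cst; exists i.+1 => // n /= ni.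
rewrite (ip_comb gK) ?iota_uniq // mem_index_iota /= ni mul1r.
by rewrite mulrAC -mulrA ip_kappa.
Qed.

Lemma sbounded1 : sbounded (fun=> 1).
Proof. by exists 1 => i; rewrite normr1. Qed.

(** [T] vanishes on the difference between [y] and its projection to the closed
    span of [g]. *)
Lemma linear_expansion (T : {linear H -> H}) y : continuous T ->
  (forall w, (forall i, ip w (g i) = 0) -> T w = 0) ->
  \sum_(0 <= i < n) ip y (g i) *: T (g i) @[n --> \oo] --> T y.
Proof.
move=> cT T0; have -> : T y = T (phi (fun=> 1) y).
  apply/eqP; rewrite -subr_eq0 -linearB; apply/eqP/T0 => i.
  by rewrite ipBl (phi_coef _ _ sbounded1) mul1r subrr.
have := cvg_comp _ _ (@phi_cvg _ y sbounded1) (@cT (phi (fun=> 1) y)).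
rewrite (_ : T \o phi_part (fun=> 1) y = fun n => \sum_(0 <= i < n) ip y (g i) *: T (g i)).
  exact.
apply/funext => n; rewrite /= linear_sum; apply: eq_bigr => i _.
by rewrite mul1r linearZ.
Qed.

End DiagonalOperators.

End Hilbert.

(** * The energies of the response *)

Section Setup.
Context {R : realType} {H : completeNormedModType R}.
Variable ip : {dot H for idfun}.
Hypothesis ip_norm : hilbert_inner ip.

(** The planes of the skew singular value decomposition as one sequence
    [u 0, v 0, u 1, v 1, ...], with zeros where the singular value is zero. *)
Definition skew_frame (A : H -> H) (a : nat -> R) (g : nat -> H) :=
  [/\ osys ip g (fun i => 0 < a i./2),
      forall k, A (g k.*2) = a k *: g k.*2.+1,
      forall k, A (g k.*2.+1) = - (a k *: g k.*2) &
      forall w, (forall i, ip w (g i) = 0) -> A w = 0].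

Lemma skew_frame_exists (A : {linear H -> H}) (a : nat -> R) :
  skew_singular_values ip A a -> exists g, skew_frame A a g.
Proof.
move=> [a0 _ [u [v [uv Auv Aker]]]].
exists (fun i => if 0 < a i./2 then (if odd i then v i./2 else u i./2) else 0).
split=> [i j|k|k|w gw].
- case: (boolP (0 < a i./2)) => ai; last by rewrite ip0l.
  case: (boolP (0 < a j./2)) => aj; last first.
    by rewrite ip0r; case: eqP => // ij; rewrite -ij ai in aj.
  have [uu vv uv0] := uv _ _ ai aj; have [_ _ vu0] := uv _ _ aj ai.
  have ij : (i == j) = (odd i == odd j) && (i./2 == j./2).
    apply/eqP/andP => [->//|[/eqP oij /eqP hij]].
    by rewrite -(odd_double_half i) -(odd_double_half j) oij hij.
  case oi: (odd i); case oj: (odd j); rewrite ij oi oj ?andbT /=.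
  + by rewrite vv.
  + by rewrite ipC.
  + by rewrite uv0.
  + by rewrite uu.
- rewrite doubleK odd_double /= uphalf_double odd_double /=.
  case: ifPn => ak; first by have [-> _] := Auv k ak.
  by rewrite linear0 scaler0.
- rewrite /= uphalf_double doubleK odd_double /=.
  case: ifPn => ak; first by have [_ ->] := Auv k ak.
  by rewrite linear0 scaler0 oppr0.
- apply: Aker => j aj; split.
    by have := gw j.*2; rewrite doubleK odd_double aj.
  by have := gw j.*2.+1; rewrite /= uphalf_double odd_double aj.
Qed.

Lemma adjoint_skew (A : {linear H -> H}) v : skew_adjoint ip A ->
  adjoint ip A v = - A v.
Proof.
move=> As; apply: (ip_inj ip_norm) => w; rewrite /adjoint ipC.
have ex : [set w' | forall u, ip (A u) v = ip u w'] (- A v).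
  by move=> u /=; rewrite As ipNr.
have /= <- := xgetPex 0 (ex_intro _ _ ex).
by rewrite As (ipC _ (- _)) ipNr.
Qed.

End Setup.

Section SumDouble.
Context {R : realType}.

Lemma sum_double (V : zmodType) (F : nat -> V) n :
  \sum_(0 <= i < n.*2) F i = \sum_(k < n) (F k.*2 + F k.*2.+1).
Proof.
elim: n => [|n IH]; first by rewrite big_ord0 big_geq.
by rewrite doubleS !big_nat_recr //= IH big_ord_recr /= addrA.
Qed.

Lemma cvg_double (V : topologicalType) (u : nat -> V) (l : V) :
  u n @[n --> \oo] --> l -> u n.*2 @[n --> \oo] --> l.
Proof.
move=> ul; apply: (cvg_comp _ _ _ ul) => A [N _ NA]; exists N => // n /= Nn.
by apply: NA => /=; apply: leq_trans Nn _; rewrite -addnn leq_addr.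
Qed.

End SumDouble.

Section Response.
Context {R : realType} {H : completeNormedModType R}.
Variable ip : {dot H for idfun}.
Hypothesis ip_norm : hilbert_inner ip.
Context {d : Order.disp_t} {J : orderType d}.
Variable e : J -> H.
Hypothesis e_basis : orthonormal_basis ip e.
Variables (A : {linear H -> H}) (a : nat -> R) (g : nat -> H) (C : R).
Hypothesis A_cont : continuous A.
Hypothesis A_skew : skew_adjoint ip A.
Hypothesis a_ge0 : forall k, 0 <= a k.
Hypothesis gA : skew_frame ip A a g.
Hypothesis a_sum : forall n, \sum_(k < n) a k ^+ 2 <= C.
Implicit Types (x y z : H) (S : {fset J}).

Let c k := a k ^+ 2.
Let c_ge0 k : 0 <= c k. Proof. exact: sqr_ge0. Qed.
Let c_sum n : \sum_(k < n) c k <= C. Proof. exact: a_sum. Qed.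

Definition coord y : J -> R := fun j => ip y (e j).

Lemma gram_coord y z : gram (coord y) (coord z) (ip y z).
Proof. exact: parseval. Qed.

Let p k := coord (g k.*2.+1).
Let q k := coord (g k.*2).
Let gK : osys ip g (fun i => 0 < a i./2). Proof. by case: gA. Qed.

Lemma frame_ker w : (forall i, ip w (g i) = 0) -> A w = 0.
Proof. by case: gA => _ _ _; apply. Qed.

Lemma frame_even k : A (g k.*2) = a k *: g k.*2.+1.
Proof. by case: gA. Qed.

Lemma frame_odd k : A (g k.*2.+1) = - (a k *: g k.*2).
Proof. by case: gA. Qed.

Lemma frame_sqr i : A (A (g i)) = - (a i./2 ^+ 2 *: g i).
Proof.
rewrite -(odd_double_half i); case: (odd i); rewrite ?add1n ?add0n /=.
  rewrite frame_odd linearN linearZ /= frame_even uphalf_double scalerA expr2.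
  by [].
by rewrite frame_even linearZ /= frame_odd doubleK scalerN scalerA expr2.
Qed.

Let pp k l : 0 < a k -> 0 < a l -> gram (p k) (p l) (k == l)%:R.
Proof.
move=> ak al; have := @gram_coord (g k.*2.+1) (g l.*2.+1).
by rewrite gK /= uphalf_double ak eqSS (inj_eq double_inj).
Qed.

Let qq k l : 0 < a k -> 0 < a l -> gram (q k) (q l) (k == l)%:R.
Proof.
move=> ak al; have := @gram_coord (g k.*2) (g l.*2).
by rewrite gK doubleK ak (inj_eq double_inj).
Qed.

Let pq k l : 0 < a k -> 0 < a l -> gram (p k) (q l) 0.
Proof.
move=> ak al; have := @gram_coord (g k.*2.+1) (g l.*2).
rewrite gK (_ : (_ == _) = false) ?andbF //.
by apply/eqP => /(congr1 odd); rewrite /= !odd_double.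
Qed.

(** The energy of [x] in the [k]-th plane. *)
Definition sqform x k : R := ip x (g k.*2.+1) ^+ 2 + ip x (g k.*2) ^+ 2.

Definition matrix_coef (i j : J) : R := ip (A (e j)) (e i).

(** The expansion of [A] in its planes, read off on the matrix entries: [A] acts
    on the [k]-th plane as [a_k (v_k /\ u_k)]. *)
Lemma fin_form_cvg i j : fin_form a p q n i j @[n --> \oo] --> matrix_coef i j.
Proof.
have := cvg_ipl (v := e i) ip_norm _
  (cvg_double (linear_expansion ip_norm gK (y := e j) A_cont frame_ker)).
rewrite (_ : (fun n => ip _ (e i)) = fun n => fin_form a p q n i j); first exact.
apply/funext => n; rewrite sum_double ip_suml; apply: eq_bigr => k _.
rewrite frame_even frame_odd ipDl !ipZl ipNl ipZl /p /q /coord.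
by rewrite (ipC _ (e j) (g k.*2)) (ipC _ (e j) (g k.*2.+1)); ring.
Qed.

Lemma gram_A_cvg y z :
  \sum_(k < n) c k * (ip y (g k.*2.+1) * ip z (g k.*2.+1) +
     ip y (g k.*2) * ip z (g k.*2)) @[n --> \oo] --> ip (A y) (A z).
Proof.
have := cvg_ipl (v := A z) ip_norm _
  (cvg_double (linear_expansion ip_norm gK (y := y) A_cont frame_ker)).
rewrite (_ : (fun n => ip _ (A z)) = fun n => \sum_(k < n) c k *
   (ip y (g k.*2.+1) * ip z (g k.*2.+1) + ip y (g k.*2) * ip z (g k.*2))); first exact.
apply/funext => n; rewrite sum_double ip_suml; apply: eq_bigr => k _.
have E i : ip (A (g i)) (A z) = a i./2 ^+ 2 * ip z (g i).
  by rewrite -[LHS]opprK -A_skew frame_sqr ipNl opprK ipZl (ipC _ (g i)).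
by rewrite ipDl !ipZl !E doubleK /= uphalf_double /c; ring.
Qed.

Lemma dotf_coord_le F y : dotf F (coord y) (coord y) <= `|y| ^+ 2.
Proof.
have := bessel ip_norm (basis_osys e_basis) (r := F) y (fset_uniq F).
by rewrite /dotf; under eq_bigr do rewrite expr2.
Qed.

Lemma nrm_cvg F (wn : nat -> {fset J} -> R) w :
  (forall S, wn n S @[n --> \oo] --> w S) -> nrm F (wn n) @[n --> \oo] --> nrm F w.
Proof. by move=> ww; apply: cvg_sum_seq => S _; apply: cvgM. Qed.

Lemma axpy_cvg (wn : nat -> {fset J} -> R) w b v S :
  (forall S, wn n S @[n --> \oo] --> w S) ->
  axpy (wn n) b v S @[n --> \oo] --> axpy w b v S.
Proof. by move=> ww; apply: cvgD => //; exact: cvg_cst. Qed.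

(** The distance of two finite approximations is known from [fin_exp_increment],
    and on a finite part of the coordinates the limit may be taken in the longer
    one. *)
Lemma full_exp_approx F n m :
  nrm F (axpy (full_exp matrix_coef m) (-1) (fin_exp a p q n m)) <=
  4 ^+ m * (einf c m - esp c n m).
Proof.
have H1 : nrm F (axpy (fin_exp a p q k m) (-1) (fin_exp a p q n m)) @[k --> \oo] -->
    nrm F (axpy (full_exp matrix_coef m) (-1) (fin_exp a p q n m)).
  by apply: nrm_cvg => S; apply: axpy_cvg => T; exact: fin_exp_cvg fin_form_cvg _ _.
have H2 : 4 ^+ m * (esp c k m - esp c n m) @[k --> \oo] -->
    4 ^+ m * (einf c m - esp c n m).
  apply: cvgM; first exact: cvg_cst.
  by apply: cvgB; [exact: esp_cvg c_ge0 c_sum _ | exact: cvg_cst].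
apply: (cvgn_le (K := n) H1 H2) => k nk; rewrite mulrBr.
by apply: normlim_ge; apply: (fin_exp_increment a_ge0 pp qq pq).
Qed.

Lemma einf_sub_cvg m (b : R) :
  b * (4 ^+ m * (einf c m - esp c n m)) @[n --> \oo] --> (0 : R).
Proof.
rewrite -[X in _ --> X](mulr0 b) -[X in b * X](mulr0 (4 ^+ m)) -(subrr (einf c m)).
apply: cvgM; first exact: cvg_cst.
apply: cvgM; first exact: cvg_cst.
by apply: cvgB; [exact: cvg_cst | exact: esp_cvg c_ge0 c_sum _].
Qed.

Lemma normlim_full_exp m : normlim (full_exp matrix_coef m) (4 ^+ m * einf c m).
Proof.
apply: (normlim_approx (wn := fun n => fin_exp a p q n m)
   (r := fun n => 1 * (4 ^+ m * (einf c m - esp c n m)))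
   (l := fun n => 4 ^+ m * esp c n m)).
- by move=> n F; rewrite mul1r full_exp_approx.
- exact: einf_sub_cvg.
- by move=> n; exact: (fin_exp_norm a_ge0 pp qq pq n m).1.
- by apply: cvgM; [exact: cvg_cst | exact: esp_cvg c_ge0 c_sum _].
Qed.

(** [omega] is the limit of the norms of [x /\ w], which are at most
    [|x|^2 * |w|^2]. *)
Lemma omega_le x n m : 0 <= 4 ^+ m * omega c (sqform x) (ip x x) n m <=
  `|x| ^+ 2 * (4 ^+ m * esp c n m).
Proof.
have nl : normlim (vcre (coord x) (fin_exp a p q n m))
    (4 ^+ m * omega c (sqform x) (ip x x) n m).
  apply: (vcre_fin_exp_norm (P := fun k => ip x (g k.*2.+1))
    (Q := fun k => ip x (g k.*2)) a_ge0 pp qq pq); first exact: gram_coord.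
  by move=> k _ _; split; exact: gram_coord.
apply/andP; split.
  by apply: le_trans (normlim_ge fset0 nl); exact: nrm_ge0.
rewrite -(cvg_lim _ nl) //; apply: limr_le; first by apply/cvg_ex; eexists; exact: nl.
apply: nearW => F; apply: le_trans (nrm_vcre_le _ _ _) _.
apply: ler_pM; rewrite ?dotf_ge0 ?nrm_ge0 ?dotf_coord_le //.
by apply: normlim_ge; exact: (fin_exp_norm a_ge0 pp qq pq n m).1.
Qed.

(** [A^* A], for skew-adjoint [A]. *)
Definition tT y : H := - A (A y).

Lemma tT_ip y z : ip (tT y) z = ip (A y) (A z).
Proof. by rewrite /tT ipNl A_skew opprK. Qed.

Lemma tT_coef y i : ip (tT y) (g i) = a i./2 ^+ 2 * ip y (g i).
Proof. by rewrite tT_ip A_skew frame_sqr ipNr opprK ipZr. Qed.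

Lemma tT_sym y z : ip (tT y) z = ip y (tT z).
Proof. by rewrite tT_ip ipC -tT_ip ipC. Qed.

Lemma iter_tT_coef j y i :
  ip (iter j tT y) (g i) = (a i./2 ^+ 2) ^+ j * ip y (g i).
Proof.
elim: j => [|j IH]; first by rewrite expr0 mul1r.
by rewrite iterS tT_coef IH mulrA -exprS.
Qed.

Definition moment x j : R := ip (iter j tT x) x.

(** For [j = 0] the limit would be the energy of the component of [x] orthogonal to
    the kernel of [A]. *)
Lemma moment_cvg x j : (0 < j)%N ->
  \sum_(k < n) c k ^+ j * sqform x k @[n --> \oo] --> moment x j.
Proof.
case: j => // j _; rewrite /moment iterS tT_ip.
have := @gram_A_cvg (iter j tT x) x.
rewrite (_ : (fun n => \sum_(k < n) c k * _) = fun n => \sum_(k < n) c k ^+ j.+1 * sqform x k).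
  exact.
apply/funext => n; apply: eq_bigr => k _.
by rewrite !iter_tT_coef doubleK /= uphalf_double -/(c k) /sqform exprS; ring.
Qed.

(** The limit of [omega] in the number of planes, written with the moments
    [<(A^* A)^j x, x>], hence without reference to the planes. *)
Definition oinf x m : R := \sum_(j < m.+1) (-1) ^+ j * einf c (m - j) * moment x j.

Lemma omega_oinf x m :
  omega c (sqform x) (ip x x) n m @[n --> \oo] --> oinf x m.
Proof.
apply: (omega_cvg c_ge0 c_sum) => [//|j j0]; exact: moment_cvg.
Qed.

Lemma oinf_bound x m : 0 <= oinf x m <= `|x| ^+ 2 * einf c m.
Proof.
have h n : 0 <= omega c (sqform x) (ip x x) n m <= `|x| ^+ 2 * esp c n m.
  have := omega_le x n m; rewrite mulrCA pmulr_rge0 ?exprn_gt0 //.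
  by rewrite ler_pM2l ?exprn_gt0.
apply/andP; split.
  by apply: (cvgn_le (K := 0) (cvg_cst _) (@omega_oinf x m)) => n _; case/andP: (h n).
have h2 : `|x| ^+ 2 * esp c n m @[n --> \oo] --> `|x| ^+ 2 * einf c m.
  by apply: cvgM; [exact: cvg_cst | exact: esp_cvg c_ge0 c_sum _].
by apply: (cvgn_le (K := 0) (@omega_oinf x m) h2) => n _; case/andP: (h n).
Qed.

Lemma normlim_vcre_full_exp x m :
  normlim (vcre (coord x) (full_exp matrix_coef m)) (4 ^+ m * oinf x m).
Proof.
apply: (normlim_approx (wn := fun n => vcre (coord x) (fin_exp a p q n m))
   (r := fun n => `|x| ^+ 2 * (4 ^+ m * (einf c m - esp c n m)))
   (l := fun n => 4 ^+ m * omega c (sqform x) (ip x x) n m)).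
- move=> n F; rewrite -vcre_axpy; apply: le_trans (nrm_vcre_le _ _ _) _.
  by apply: ler_pM; rewrite ?dotf_ge0 ?nrm_ge0 ?dotf_coord_le ?full_exp_approx.
- exact: einf_sub_cvg.
- move=> n; apply: (vcre_fin_exp_norm (P := fun k => ip x (g k.*2.+1))
    (Q := fun k => ip x (g k.*2)) a_ge0 pp qq pq); first exact: gram_coord.
  by move=> k _ _; split; exact: gram_coord.
- by apply: cvgM; [exact: cvg_cst | exact: omega_oinf].
Qed.

(** The response is [(1 + x) /\ exp (2 alpha)]: the even part is the exponential,
    the odd part its wedge product with [x]. *)
Lemma responseE x S : response ip e x A S =
  if odd #|` S| then vcre (coord x) (full_exp matrix_coef (#|` S|)./2) S
  else full_exp matrix_coef (#|` S|)./2 S.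
Proof. by rewrite -(exp_wedgeE (coord x) fin_form_cvg). Qed.

Lemma Xi_even x m : Xi ip e m.*2 x A = full_exp matrix_coef m.
Proof.
apply/funext => S; rewrite /Xi /homogeneous; case: eqP => [Sm|/eqP Sm].
  by rewrite responseE Sm odd_double doubleK.
by rewrite (full_exp_supp fin_form_cvg).
Qed.

Lemma Xi_odd x m : Xi ip e m.*2.+1 x A = vcre (coord x) (full_exp matrix_coef m).
Proof.
apply/funext => S; rewrite /Xi /homogeneous; case: eqP => [Sm|/eqP Sm].
  by rewrite responseE Sm /= odd_double uphalf_double.
by rewrite (vcre_full_exp_supp _ fin_form_cvg).
Qed.

Lemma fock_norm_sqr (w : {fset J} -> R) l : normlim w l -> fock_norm w ^+ 2 = l.
Proof.
move=> wl; rewrite /fock_norm (fock_norm2_lim wl) /= sqr_sqrtr //.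
by apply: le_trans (normlim_ge fset0 wl); exact: nrm_ge0.
Qed.

Lemma energy_even x m : energy ip e x A m.*2 = 4 ^+ m * einf c m.
Proof. by rewrite /energy Xi_even; apply: fock_norm_sqr; exact: normlim_full_exp. Qed.

Lemma energy_odd x m : energy ip e x A m.*2.+1 = 4 ^+ m * oinf x m.
Proof. by rewrite /energy Xi_odd; apply: fock_norm_sqr; exact: normlim_vcre_full_exp. Qed.

Lemma wedge_vac (w : {fset J} -> R) : wedge w vac = w.
Proof.
apply/funext => S; rewrite /wedge.
rewrite (eq_big_seq (fun T => (T == S)%:R * w T)); last first.
  move=> T; rewrite fpowersetE => TS; rewrite /vac.
  have [TE|ST] := eqVneq (S `\` T)%fset fset0.
    have -> : T = S.
      by apply/eqP; rewrite eqEfsubset TS -fsetD_eq0 TE eqxx.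
    rewrite fsetDv sign_inversions big1 => [|t _]; first by rewrite !eqxx; ring.
    by rewrite /sgf -sum1_count big_mkcond big_seq_fset0.
  have /negbTE -> : T != S by apply: contra ST => /eqP ->; rewrite fsetDv.
  by rewrite !mulr0 mul0r.
by rewrite big_delta // fpowersetE.
Qed.

(** [2 alpha] is the part of degree two of the exponential. *)
Lemma normlim_alpha : normlim (fock_alpha ip e A) (einf c 1).
Proof.
have := @normlim_full_exp 1.
have -> : full_exp matrix_coef 1 = fun S => 2 * fock_alpha ip e A S.
  by apply/funext => S; rewrite /full_exp /wedge_pow /= wedge_vac divr1.
rewrite /normlim (_ : (fun F => nrm F _) = fun F => 4 * nrm F (fock_alpha ip e A)); last first.
  by apply/funext => F; rewrite /nrm /bil mulr_sumr; apply: eq_bigr => S _; ring.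
move=> h; have K (r : R) : r = 4^-1 * (4 ^+ 1 * r) by rewrite expr1 mulKf.
rewrite (_ : (fun F => nrm F (fock_alpha ip e A)) =
  fun F => 4^-1 * (4 ^+ 1 * nrm F (fock_alpha ip e A))); last by apply/funext => F; exact: K.
by rewrite [einf c 1]K; apply: cvgM; [exact: cvg_cst | rewrite expr1 in h *].
Qed.

(** The homogeneous parts have disjoint supports, so the norm of the response is
    the sum of their norms. For a finite set of coordinates only finitely many
    degrees occur, and conversely finitely many degrees are approximated by a
    finite set of coordinates. *)
Lemma fock_norm2_response x (L : R) :
  series (fun m => 4 ^+ m * einf c m + 4 ^+ m * oinf x m) n @[n --> \oo] --> L ->
  fock_norm2 (response ip e x A) = L%:E.
Proof.
move=> sL; pose w := response ip e x A.
pose t m : {fset J} -> R := fun S => full_exp matrix_coef m S ^+ 2 +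
   vcre (coord x) (full_exp matrix_coef m) S ^+ 2.
have tE N S : \sum_(0 <= m < N) t m S = (#|` S|./2 < N)%:R * w S ^+ 2.
  have tS m : t m S = (m == #|` S|./2)%:R * w S ^+ 2.
    rewrite /t /w responseE; case: eqP => [->|mS]; last first.
      rewrite (full_exp_supp fin_form_cvg); last by apply/eqP; lia.
      rewrite (vcre_full_exp_supp _ fin_form_cvg); last by apply/eqP; lia.
      by rewrite expr0n addr0 mul0r.
    rewrite mul1r; have := odd_double_half #|` S|; case: (odd _) => SE.
      by rewrite (full_exp_supp fin_form_cvg) ?expr0n ?add0r //; apply/eqP; lia.
    by rewrite (vcre_full_exp_supp _ fin_form_cvg) ?expr0n ?addr0 //; apply/eqP; lia.
  under eq_bigr do rewrite tS.
  rewrite -mulr_suml; congr (_ * _); case: ltnP => SN.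
    rewrite (bigD1_seq #|` S|./2) ?mem_index_iota ?iota_uniq //= eqxx big1 ?addr0 //.
    by move=> i /negbTE ->.
  rewrite big1_seq // => i; rewrite mem_index_iota => /andP[_ iN].
  by rewrite ltn_eqF //; lia.
have tF F N : \sum_(S <- fpowerset F) \sum_(0 <= m < N) t m S =
    \sum_(0 <= m < N) (nrm F (full_exp matrix_coef m) +
      nrm F (vcre (coord x) (full_exp matrix_coef m))).
  rewrite exchange_big /=; apply: eq_bigr => m _; rewrite -big_split /=.
  by apply: eq_bigr => S _; rewrite /t !expr2.
have ge0 m : 0 <= 4 ^+ m * einf c m + 4 ^+ m * oinf x m.
  rewrite -mulrDr mulr_ge0 ?exprn_ge0 // addr_ge0 ?(einf_ge0 c_ge0 c_sum) //.
  by case/andP: (oinf_bound x m).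
have up F : nrm F w <= L.
  have -> : nrm F w = \sum_(S <- fpowerset F) \sum_(0 <= m < #|` F|.+1) t m S.
    apply: eq_big_seq => S; rewrite fpowersetE => SF; rewrite tE ltnS.
    have := fsubset_leq_card SF => SF'.
    by rewrite (leq_trans _ SF') ?half_leq // ?mul1r ?expr2 //; lia.
  rewrite tF; apply: le_trans (series_le_lim #|` F|.+1 ge0 sL).
  by apply: ler_sum => m _; rewrite lerD //; apply: normlim_ge;
    [exact: normlim_full_exp | exact: normlim_vcre_full_exp].
have uL := fock_norm2_ub up.
have fin : fock_norm2 w \is a fin_num.
  rewrite fin_numElt (le_lt_trans uL) ?ltry // andbT.
  by apply: lt_le_trans (nrm_le_fock_norm2 w fset0); exact: ltNyr.
apply/eqP; rewrite eq_le uL /= -[fock_norm2 w]fineK // lee_fin.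
apply: (cvgn_le (K := 0) sL (cvg_cst _)) => N _.
have cN : \sum_(0 <= m < N) (nrm F (full_exp matrix_coef m) +
      nrm F (vcre (coord x) (full_exp matrix_coef m))) @[F --> totally] -->
    series (fun m => 4 ^+ m * einf c m + 4 ^+ m * oinf x m) N.
  apply: cvg_sum_seq => m _; apply: cvgD; first exact: normlim_full_exp.
  exact: normlim_vcre_full_exp.
rewrite -(cvg_lim _ cN) //; apply: limr_le; first by apply/cvg_ex; eexists; exact: cN.
apply: nearW => F; rewrite -tF -lee_fin fineK //.
apply: le_trans (nrm_le_fock_norm2 w F); rewrite lee_fin.
apply: ler_sum => S _; rewrite tE -expr2.
by case: (_ < _)%N; rewrite ?mul1r // mul0r sqr_ge0.
Qed.

End Response.

(** * Generating series and the resolvent *)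

Section HilbertSchmidtSum.
Context {R : realType} {H : completeNormedModType R}.
Variable ip : {dot H for idfun}.
Hypothesis ip_norm : hilbert_inner ip.

(** The squared Hilbert-Schmidt norm dominates the squared norms of [A] on the
    orthonormal system [u k], by Parseval in the given basis and Bessel for the
    system. *)
Lemma hs_sum (A : {linear H -> H}) (a : nat -> R) g : (forall k, 0 <= a k) ->
  hilbert_schmidt ip A -> skew_adjoint ip A ->
  skew_frame ip A a g -> exists C : R, forall n, \sum_(k < n) a k ^+ 2 <= C.
Proof.
move=> a0 [_ [J [e [eb /= eA]]]] As [gK Ag0 _ _].
pose s := (\esum_(j in [set: J]) (`|A (e j)| ^+ 2)%:E)%E.
have s0 : (0 <= s)%E by apply: esum_ge0 => j _; rewrite lee_fin sqr_ge0.
have sfin : s \is a fin_num by rewrite ge0_fin_numE.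
have [M sF] : exists M : R, forall F : {fset J}, \sum_(j <- F) `|A (e j)| ^+ 2 <= M.
  exists (fine s) => F; rewrite -lee_fin fineK //; apply: ereal_sup_ubound => /=.
  exists [set` F]; first by split => //; exact: finite_fset.
  by rewrite fsbig_finite /= ?set_fsetK ?sumEFin //; exact: finite_fset.
exists M => n.
have uK : osys ip (fun k => g k.*2) (fun k => 0 < a k).
  by move=> k l; rewrite gK doubleK (inj_eq double_inj).
have E k : a k ^+ 2 = ip (A (g k.*2)) (A (g k.*2)).
  rewrite Ag0 ipZl ipZr gK eqxx andbT /= uphalf_double.
  have := a0 k; rewrite le_eqVlt => /orP[/eqP <-|ak]; first by rewrite !mul0r expr0n.
  by rewrite ak mulr1 expr2.
have H1 : (fun F : {fset J} =>
      \sum_(k < n) \sum_(j <- F) ip (A (g k.*2)) (e j) * ip (A (g k.*2)) (e j))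
    @ totally --> \sum_(k < n) a k ^+ 2.
  by apply: cvg_sum_seq => k _; rewrite E; exact: parseval.
rewrite -(cvg_lim _ H1) //; apply: limr_le; first by apply/cvg_ex; eexists; exact: H1.
apply: nearW => F; rewrite exchange_big /=.
apply: (@le_trans _ _ (\sum_(j <- F) `|A (e j)| ^+ 2)); last exact: sF.
apply: ler_sum => j _.
have := bessel ip_norm uK (A (e j)) (iota_uniq 0 (n - 0)).
rewrite -[iota 0 (n - 0)]/(index_iota 0 n) big_mkord => h; apply: (le_trans _ h).
apply: ler_sum => k _; rewrite [ip (A (g _)) _]As mulrNN -expr2.
by rewrite ipC.
Qed.

End HilbertSchmidtSum.

Section Analytic.
Context {R : realType} {H : completeNormedModType R}.
Variable ip : {dot H for idfun}.
Hypothesis ip_norm : hilbert_inner ip.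
Context {d : Order.disp_t} {J : orderType d}.
Variable e : J -> H.
Hypothesis e_basis : orthonormal_basis ip e.
Variables (A : {linear H -> H}) (a : nat -> R) (g : nat -> H) (C : R).
Hypothesis A_cont : continuous A.
Hypothesis A_skew : skew_adjoint ip A.
Hypothesis a_ge0 : forall k, 0 <= a k.
Hypothesis gA : skew_frame ip A a g.
Hypothesis a_sum : forall n, \sum_(k < n) a k ^+ 2 <= C.
Implicit Types (x y w : H) (z : R).

Let c k := a k ^+ 2.
Let c_ge0 k : 0 <= c k. Proof. exact: sqr_ge0. Qed.
Let c_sum n : \sum_(k < n) c k <= C. Proof. exact: a_sum. Qed.
Let gK : osys ip g (fun i => 0 < a i./2). Proof. by case: gA. Qed.
Local Notation T := (tT A).
Local Notation oinf := (oinf ip A a).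

Lemma adjoint_compE : (fun y => adjoint ip A (A y)) = T.
Proof. by apply/funext => y; rewrite (adjoint_skew ip_norm). Qed.

Lemma c_le_C k : c k <= C.
Proof.
apply: le_trans (c_sum k.+1); rewrite big_ord_recr /= lerDr.
by apply: sumr_ge0.
Qed.

Lemma sbounded_c : sbounded (fun i => c i./2).
Proof. by exists C => i; rewrite ger0_norm // c_le_C. Qed.

Lemma T_phi y : T y = phi ip g (fun i => c i./2) y.
Proof.
apply: (ip_inj ip_norm) => w; rewrite (tT_ip A_skew).
have h1 := cvg_double (phi_ip ip_norm gK (y := y) (z := w) sbounded_c).
have h2 := @gram_A_cvg _ _ _ ip_norm A a g A_cont A_skew gA y w.
apply: (cvg_unique _ h2) => //.
rewrite (_ : (fun n => _) = fun n => \sum_(0 <= i < n.*2) c i./2 * ip y (g i) * ip w (g i)).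
  exact: h1.
apply/funext => n; rewrite sum_double; apply: eq_bigr => k _.
by rewrite /= doubleK uphalf_double /c; ring.
Qed.

Lemma one_zc_gt0 z k : 0 <= z -> 0 < 1 + z * c k.
Proof. by move=> z0; rewrite ltr_pwDl // mulr_ge0. Qed.

(** [1 - rcoef z i] is the eigenvalue [1 / (1 + z c_(i/2))] of the resolvent at [g i]. *)
Definition rcoef z i : R := z * c i./2 / (1 + z * c i./2).

Lemma rcoef_bound z i : 0 <= z -> 0 <= rcoef z i <= 1.
Proof.
move=> z0; have h := one_zc_gt0 i./2 z0.
rewrite /rcoef divr_ge0 ?mulr_ge0 ?(ltW h) //= ler_pdivrMr // mul1r.
by rewrite lerDr.
Qed.

Lemma sbounded_rcoef z : 0 <= z -> sbounded (rcoef z).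
Proof.
move=> z0; exists 1 => i; have /andP[h0 h1] := rcoef_bound i z0.
by rewrite ger0_norm.
Qed.

(** The identity minus a diagonal operator, so that it is the identity on the
    kernel of [A], which [g] does not see. *)
Definition rinv z y : H := y - phi ip g (rcoef z) y.

Lemma rinvK z y : 0 <= z -> rinv z y + z *: T (rinv z y) = y.
Proof.
move=> z0; apply: (ip_inj ip_norm) => w.
rewrite T_phi {1}/rinv ipDl ipBl ipZl.
have h1 := phi_ip ip_norm gK (y := y) (z := w) (sbounded_rcoef z0).
have h2 : (fun n => z * \sum_(0 <= i < n) c i./2 * ip (rinv z y) (g i) * ip w (g i))
    @ \oo --> z * ip (phi ip g (fun i => c i./2) (rinv z y)) w.
  have h := phi_ip ip_norm gK (y := rinv z y) (z := w) sbounded_c.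
  by apply: cvgM; [exact: cvg_cst | exact: h].
have -> : z * ip (phi ip g (fun i => c i./2) (rinv z y)) w = ip (phi ip g (rcoef z) y) w.
  apply: (cvg_unique _ h2) => //.
  rewrite (_ : (fun n => _) = fun n => \sum_(0 <= i < n) rcoef z i * ip y (g i) * ip w (g i)).
    exact: h1.
  apply/funext => n /=; rewrite mulr_sumr; apply: eq_bigr => i _.
  rewrite /rinv ipBl (phi_coef ip_norm gK _ _ (sbounded_rcoef z0)) /rcoef.
  by field; rewrite gt_eqF // one_zc_gt0.
by rewrite subrK.
Qed.

Lemma T_sub y w : T (y - w) = T y - T w.
Proof. by rewrite /tT !linearB. Qed.

(** [<(Id + z T) y, y> >= |y|^2] because [T] is nonnegative. *)
Lemma one_zT_inj z : 0 <= z -> injective (fun y => y + z *: T y).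
Proof.
move=> z0 y w /eqP; rewrite -subr_eq0 opprD addrACA -scalerBr -T_sub => /eqP E.
apply/eqP; rewrite -subr_eq0; apply/eqP/(ip_eq0 ip_norm)/eqP.
have := congr1 (fun u => ip u (y - w)) E.
rewrite /= ipDl ipZl (tT_ip A_skew) ip0l => /eqP.
by rewrite paddr_eq0 ?mulr_ge0 ?(ip_ge0 ip_norm) // => /andP[].
Qed.

Lemma one_zT_bij z : 0 <= z -> bijective (fun y => y + z *: T y).
Proof.
move=> z0; exists (rinv z) => y; last exact: rinvK.
by apply: (one_zT_inj z0); rewrite /= rinvK.
Qed.

Lemma resolventE z y : 0 <= z -> resolvent T z y = rinv z y.
Proof.
move=> z0; apply: (one_zT_inj z0); rewrite rinvK //= /resolvent.
rewrite (@pinvK _ _ _ _ (fun y => y + z *: T y)) // inE.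
by exists (rinv z y) => //=; rewrite rinvK.
Qed.

Lemma resolvent_ip_cvg z y : 0 <= z ->
  ip y y - \sum_(k < n) z * c k / (1 + z * c k) * sqform ip g y k @[n --> \oo] -->
  ip (resolvent T z y) y.
Proof.
move=> z0; rewrite resolventE // /rinv ipBl; apply: cvgB; first exact: cvg_cst.
have h1 := cvg_double (phi_ip ip_norm gK (y := y) (z := y) (sbounded_rcoef z0)).
rewrite (_ : (fun n => _) = fun n => \sum_(0 <= i < n.*2) rcoef z i * ip y (g i) * ip y (g i)).
  exact: h1.
apply/funext => n; rewrite sum_double; apply: eq_bigr => k _.
by rewrite /rcoef /= doubleK uphalf_double /sqform; ring.
Qed.

Lemma resolvent_le z y : 0 <= z -> ip (resolvent T z y) y <= ip y y.
Proof.
move=> z0; apply: (cvgn_le (K := 0) (resolvent_ip_cvg (y := y) z0) (cvg_cst _)) => n _.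
rewrite gerBl sumr_ge0 // => k _; rewrite mulr_ge0 ?addr_ge0 ?sqr_ge0 //.
by rewrite divr_ge0 ?mulr_ge0 ?(ltW (one_zc_gt0 k z0)).
Qed.

Lemma skew_det_cvg (z : R[i]^o) :
  (skew_det_partial a z @ \oo --> skew_det a z) /\
  ((series (fun k => z ^+ k * (einf c k)%:C) : nat -> R[i]^o) @ \oo --> skew_det a z).
Proof.
have [L [h1 h2]] := einf_series c_ge0 c_sum z.
by have -> : skew_det a z = L by apply: cvg_lim.
Qed.

Lemma series_C (f : nat -> R) (l : R) : series f n @[n --> \oo] --> l ->
  (series (fun k => (f k)%:C) : nat -> R[i]^o) @ \oo --> (l%:C : R[i]^o).
Proof.
move=> fl; rewrite (_ : series _ = fun n => (series f n)%:C : R[i]^o).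
  exact: cvg_real_complex.
by apply/funext => n; rewrite /series /= rmorph_sum.
Qed.

Lemma skew_det_real z : exists2 r : R, skew_det a z%:C = r%:C &
  (series (fun k => z ^+ k * einf c k) n @[n --> \oo] --> r) /\
  (\prod_(k < n) (1 + z * c k) @[n --> \oo] --> r).
Proof.
have [r [h1 h2]] := einf_series_real c_ge0 c_sum z.
exists r => //; apply: (cvg_unique _ (skew_det_cvg z%:C).2) => //.
rewrite (_ : (fun k => _) = fun k => (z ^+ k * einf c k)%:C); first exact: series_C.
by apply/funext => k; rewrite rmorphM rmorphXn.
Qed.

Lemma energy_series_even x (z : R[i]^o) :
  energy_series (fun N => energy ip e x A N.*2) z @ \oo --> skew_det a z.
Proof.
rewrite /energy_series (_ : (fun N => _) = fun N => z ^+ N * (einf c N)%:C).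
  exact: (skew_det_cvg z).2.
apply/funext => N; rewrite (energy_even ip_norm e_basis A_cont a_ge0 gA a_sum).
by rewrite rmorphM rmorphXn /= rmorph_nat mulrA divfK // expf_neq0 // pnatr_eq0.
Qed.

(** The finite sums are evaluated by [omega_prod]; their second factor tends to
    the quadratic form of the resolvent. Tannery's theorem applies because
    [omega] is at most [|x|^2 e_m]. *)
Lemma oinf_series x z : 0 <= z -> exists2 r : R, skew_det a z%:C = r%:C &
  series (fun k => z ^+ k * oinf x k) n @[n --> \oo] --> r * ip (resolvent T z x) x.
Proof.
move=> z0; have [r rE [r1 r2]] := skew_det_real z; exists r => //.
pose X := ip x x.
have ob := oinf_bound ip_norm e_basis A_cont A_skew a_ge0 gA a_sum x.
have [L [L1 L2]] : exists L : R, (series (fun k => z ^+ k * oinf x k) n @[n --> \oo] --> L) /\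
   ((\prod_(k < n) (1 + z * c k) *
    (ip x x - \sum_(k < n) z * c k / (1 + z * c k) * sqform ip g x k)) @[n --> \oo] --> L).
  apply: (tannery (F := fun n k => z ^+ k * omega c (sqform ip g x) X n k)
    (g := fun k => `|x| ^+ 2 * exp_coeff (z * C) k)
    (G := `|x| ^+ 2 * limn (series (exp_coeff (z * C))))).
  - move=> n k; rewrite normrM normrX (ger0_norm z0) -exp_coeffM mulrCA.
    rewrite ler_wpM2l ?exprn_ge0 //.
    have := omega_le ip_norm e_basis a_ge0 gA x n k.
    rewrite mulrCA pmulr_rge0 ?exprn_gt0 // ler_pM2l ?exprn_gt0 // => /andP[h0 h1].
    rewrite ger0_norm //; apply: le_trans h1 _; rewrite ler_wpM2l ?sqr_ge0 //.
    exact: esp_le_coeff.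
  - rewrite (_ : series _ = fun n => `|x| ^+ 2 * series (exp_coeff (z * C)) n).
      by apply: cvgM; [exact: cvg_cst | exact: is_cvg_series_exp_coeff].
    by apply/funext => n; rewrite /series /= mulr_sumr.
  - move=> k; apply: cvgM; first exact: cvg_cst.
    exact: (omega_oinf ip_norm A_cont A_skew gA a_sum).
  - move=> n; apply: cvg_near_cst; exists n.+1 => // N /= nN.
    rewrite /series /= omega_prod // => k.
    by rewrite gt_eqF // one_zc_gt0.
have -> : r * ip (resolvent T z x) x = L.
  by apply: (cvg_unique _ (cvgM r2 (resolvent_ip_cvg (y := x) z0)) L2).
exact: L1.
Qed.

Lemma energy_series_odd x z : 0 <= z ->
  energy_series (fun N => energy ip e x A N.*2.+1) z%:C @ \oo -->
  skew_det a z%:C * (ip (resolvent T z x) x)%:C.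
Proof.
move=> z0; have [r -> rs] := oinf_series x z0.
rewrite -rmorphM /energy_series.
rewrite (_ : (fun N => _) = fun N => (z ^+ N * oinf x N)%:C).
  exact: series_C.
apply/funext => N; rewrite (energy_odd ip_norm e_basis A_cont A_skew a_ge0 gA a_sum).
by rewrite !rmorphM !rmorphXn /= rmorph_nat mulrA divfK // expf_neq0 // pnatr_eq0.
Qed.

Lemma fock_norm2_response_total x : exists2 r : R, skew_det a 4 = r%:C &
  fock_norm2 (response ip e x A) = (r * (1 + ip (resolvent T 4 x) x))%:E.
Proof.
have [r rE [r1 _]] := skew_det_real 4.
have [r' rE' r2] := oinf_series x (ler0n R 4).
have rr' : r' = r by apply: complexI; rewrite -rE -rE'.
exists r; first by rewrite -rE rmorph_nat.
apply: (fock_norm2_response ip_norm e_basis A_cont A_skew a_ge0 gA a_sum).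
rewrite (_ : series _ = fun n => series (fun k => 4 ^+ k * einf c k) n +
  series (fun k => 4 ^+ k * oinf x k) n).
  by rewrite mulrDr mulr1; apply: cvgD => //; rewrite -rr'.
by apply/funext => n; rewrite /series /= -big_split.
Qed.

(** [e_m (c) <= (sum c)^m / m!], term by term. *)
Lemma skew_det_le_exp z r : 0 <= z -> skew_det a z%:C = r%:C -> r <= expR (z * einf c 1).
Proof.
move=> z0; have [r' -> [r1 _]] := skew_det_real z => /complexI <-.
have c1 n : \sum_(k < n) c k <= einf c 1.
  apply: (cvgn_le (K := n) (cvg_cst _) (einf1_lim c_ge0 c_sum)) => m nm.
  by rewrite -!(big_mkord xpredT c) (big_cat_nat (leq0n n) nm) /= lerDl sumr_ge0.
apply: (cvgn_le (K := 0) r1 (@is_cvg_series_exp_coeff _ (z * einf c 1))) => n _.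
apply: ler_sum => k _; rewrite -exp_coeffM ler_wpM2l ?exprn_ge0 //.
exact: einf_le.
Qed.

Lemma skew_det_ge1 z r : 0 <= z -> skew_det a z%:C = r%:C -> 1 <= r.
Proof.
move=> z0; have [r' -> [_ r1]] := skew_det_real z => /complexI <-.
apply: (cvgn_le (K := 0) (cvg_cst _) r1) => n _.
elim: n => [|n IH]; first by rewrite big_ord0.
rewrite big_ord_recr /= -[leLHS]mulr1 ler_pM //.
by rewrite lerDl mulr_ge0.
Qed.

End Analytic.

(** * Gram determinants and minors *)

Section Exterior.
Context {R : realType} {d : Order.disp_t} {J : orderType d}.
Implicit Types (F S T : {fset J}) (f v w : {fset J} -> R).

(** The wedge product [y 0 /\ ... /\ y (k - 1)]. *)
Fixpoint extn (k : nat) (y : nat -> J -> R) : {fset J} -> R :=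
  if k is k'.+1 then vcre (y 0%N) (extn k' (fun i => y i.+1)) else vac.

Lemma eq_extn k (y z : nat -> J -> R) : (forall i, (i < k)%N -> y i = z i) ->
  extn k y = extn k z.
Proof.
elim: k y z => //= k IH y z yz; rewrite yz //; congr vcre.
by apply: IH => i ik; exact: yz.
Qed.

Lemma extn_supp k y S : #|` S| != k -> extn k y S = 0.
Proof.
elim: k y S => [|k IH] y S Sk /=; last by apply: vcre_supp Sk => T; exact: IH.
by rewrite /vac; case: (S =P fset0) Sk => // ->; rewrite cardfs0.
Qed.

Lemma vcre_sum y (I : Type) (r : seq I) (c : I -> R) (h : I -> {fset J} -> R) S :
  vcre y (fun T => \sum_(k <- r) c k * h k T) S =
  \sum_(k <- r) c k * vcre y (h k) S.
Proof.
rewrite /vcre; under eq_bigr do rewrite cre_lin mulr_sumr.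
rewrite exchange_big /=; apply: eq_bigr => k _; rewrite mulr_sumr.
by apply: eq_bigr => i _; rewrite mulrCA.
Qed.

(** Contraction is an antiderivation. *)
Lemma vann_extn F (v : J -> R) k (y : nat -> J -> R) : agree F (vann F v (extn k y))
  (fun S => \sum_(j < k) ((-1) ^+ j * dotf F v (y j)) *
     extn k.-1 (fun i => y (bump j i)) S).
Proof.
elim: k y => [|k IH] y S SF.
  by rewrite big_ord0 /= vann_vac.
rewrite /= vann_vcre // big_ord_recl expr0 mul1r; congr (_ + _).
rewrite (@vcre_local _ _ _ F (y 0%N) _ _ (IH (fun i => y i.+1)) S SF).
rewrite vcre_sum -sumrN; apply: eq_bigr => j _.
rewrite /= /bump /= add1n exprS mulN1r !mulNr; congr (- (_ * _)).
case: k j {IH} => [[//]|k] j /=; congr vcre; apply: eq_extn => i _.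
by rewrite /bump ltnS addnS.
Qed.

Lemma bil_sumr F v (I : Type) (r : seq I) (c : I -> R) (h : I -> {fset J} -> R) :
  bil F v (fun S => \sum_(k <- r) c k * h k S) = \sum_(k <- r) c k * bil F v (h k).
Proof.
rewrite /bil; under eq_bigr do rewrite mulr_sumr.
rewrite exchange_big /=; apply: eq_bigr => k _; rewrite mulr_sumr.
by apply: eq_bigr => S _; rewrite mulrCA.
Qed.

(** The Gram determinant: moving one factor across as a contraction is the
    Laplace expansion along the first row. *)
Lemma bil_extn F k (y z : nat -> J -> R) :
  bil F (extn k y) (extn k z) = \det (\matrix_(i < k, j < k) dotf F (y i) (z j)).
Proof.
elim: k y z => [|k IH] y z.
  rewrite det_mx00 /= /bil /vac.
  by rewrite (@big_delta R _ _ fset0 (fun S => (S == fset0)%:R)) ?eqxx // fpowersetE fsub0set.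
rewrite [extn k.+1 y]/= vcre_adjoint.
rewrite (eq_bil (fun _ _ => erefl) (@vann_extn F (y 0%N) k.+1 z)).
rewrite bil_sumr (expand_det_row _ ord0); apply: eq_bigr => j _.
rewrite !mxE /cofactor add0n IH [RHS]mulrCA [RHS]mulrA; congr (_ * _ * \det _).
by apply/matrixP => i l; rewrite !mxE /= /bump leq0n add1n.
Qed.

Lemma gram_normlim k (y : nat -> J -> R) (G : 'M[R]_k) :
  (forall i j : 'I_k, gram (y i) (y j) (G i j)) -> normlim (extn k y) (\det G).
Proof.
move=> yG; rewrite /normlim (_ : (fun F => _) =
    fun F => \det (\matrix_(i < k, j < k) dotf F (y i) (y j))); last first.
  by apply/funext => F; exact: bil_extn.
apply: cvg_sum_seq => s _; apply: cvgM; first exact: cvg_cst.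
apply: cvg_big => [|i _]; first exact: mul_continuous.
by under eq_cvg do rewrite mxE; exact: yG.
Qed.

Definition delta_coord (i : J) : J -> R := fun j => (j == i)%:R.

Lemma vcre_delta i f S : vcre (delta_coord i) f S = cre i f S.
Proof.
rewrite /vcre /delta_coord; case: (boolP (i \in S)) => iS; first by rewrite big_delta.
rewrite {2}/cre (negbTE iS) big1_seq // => j /andP[_ jS].
by case: eqP => [ji|]; [rewrite -ji jS in iS | rewrite mul0r].
Qed.

(** The wedge product of coordinate vectors in increasing order is a basis
    element of the exterior algebra. *)
Lemma extn_delta x0 (s : seq J) T : sorted <%O s ->
  extn (size s) (fun i => delta_coord (nth x0 s i)) T =
  (T == [fset k | k in s]%fset)%:R.
Proof.
elim: s T => [|i s IH] T /=.
  by move=> _; rewrite /vac; congr (nat_of_bool (_ == _))%:R; apply/fsetP => k; rewrite !inE.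
move=> ps; have ss : sorted <%O s by exact: path_sorted ps.
have lts j : j \in s -> (i < j)%O by move: ps => /(order_path_min lt_trans)/allP; apply.
have is0 : i \notin s by apply/negP => /lts; rewrite ltxx.
rewrite vcre_delta /cre IH //.
have E : [fset k | k in i :: s]%fset = (i |` [fset k | k in s])%fset.
  by apply/fsetP => k; rewrite !inE.
rewrite E; case: ifP => iT; last first.
  by case: eqP => // TE; move: iT; rewrite TE !inE eqxx.
have -> : (T `\ i == [fset k | k in s])%fset = (T == i |` [fset k | k in s])%fset.
  apply/eqP/eqP => [<-|->]; first by rewrite fsetD1K.
  by rewrite fsetU1K // !inE.
case: eqP => [TE|_]; last by rewrite mulr0.
rewrite mulr1 TE sgfU1 ?inE // ltxx expr0 mulr1 /sgf (_ : count _ _ = 0%N) //.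
apply/eqP; rewrite -leqn0 leqNgt -has_count; apply/hasPn => j.
by rewrite !inE /= => /lts ij; rewrite -leNgt ltW.
Qed.

(** The coefficient is the inner product with a basis element, which is a wedge
    product of coordinate vectors; so it is a Gram determinant, here a minor. *)
Lemma extn_det x0 k (y : nat -> J -> R) (s : seq J) : sorted <%O s -> size s = k ->
  extn k y [fset i | i in s]%fset = \det (\matrix_(i < k, j < k) y i (nth x0 s j)).
Proof.
move=> ss sk; set S := [fset i | i in s]%fset.
have := bil_extn S k y (fun i => delta_coord (nth x0 s i)); rewrite -sk.
rewrite /bil.
rewrite (eq_bigr (fun T => (T == S)%:R * extn (size s) y T)); last first.
  by move=> T _; rewrite extn_delta // mulrC.
rewrite big_delta ?fpowersetE // => ->; congr (\det _).
apply/matrixP => i j; rewrite !mxE /dotf /delta_coord.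
rewrite (eq_bigr (fun l => (l == nth x0 s j)%:R * y i l)); last first.
  by move=> l _; rewrite mulrC.
by rewrite big_delta // !inE /= mem_nth.
Qed.

End Exterior.

Section IotaSet.
Context {R : realType}.

Definition iotaset n : {fset nat} := [fset i | i in iota 0 n]%fset.

Lemma mem_iotaset n i : (i \in iotaset n) = (i < n)%N.
Proof. by rewrite !inE /= mem_iota. Qed.

Lemma big_iotaset n (f : nat -> R) : \sum_(i <- iotaset n) f i = \sum_(0 <= i < n) f i.
Proof.
rewrite /index_iota subn0; apply: perm_big; apply: uniq_perm.
- exact: fset_uniq.
- exact: iota_uniq.
- by move=> i; rewrite !inE.
Qed.

Lemma big_fpowersetS n (f : {fset nat} -> R) :
  \sum_(U <- fpowerset (iotaset n.+1)) f U =
  \sum_(U <- fpowerset (iotaset n)) (f U + f (n |` U)%fset).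
Proof.
have iE : iotaset n.+1 = (n |` iotaset n)%fset.
  by apply/fsetP => i; rewrite in_fsetU in_fset1 !mem_iotaset ltnS leq_eqVlt.
have nn : n \notin iotaset n by rewrite mem_iotaset ltnn.
rewrite big_split /=.
rewrite (bigID (fun U : {fset nat} => n \notin U)) /=; congr (_ + _).
  rewrite -big_filter; apply: perm_big; apply: uniq_perm.
  - by rewrite filter_uniq // fset_uniq.
  - exact: fset_uniq.
  - move=> U; rewrite mem_filter !fpowersetE iE.
    apply/andP/idP => [[nU UF]|UF].
      apply/fsubsetP => i iU; have := fsubsetP UF i iU; rewrite !inE /=.
      by case: eqP => // ni; rewrite -ni iU in nU.
    split; first by apply: contra nn; exact: (fsubsetP UF).
    by apply: fsubset_trans UF _; exact: fsubsetU1.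
rewrite -big_filter -(big_map (fun U => n |` U)%fset xpredT f).
apply: perm_big; apply: uniq_perm.
- by rewrite filter_uniq // fset_uniq.
- rewrite map_inj_in_uniq ?fset_uniq // => U V; rewrite !fpowersetE => UF VF.
  have nU W : (W `<=` iotaset n)%fset -> n \notin W.
    by move=> WF; apply: contra nn; exact: (fsubsetP WF).
  by move=> /(congr1 (fun W => W `\ n)%fset); rewrite !fsetU1K ?nU.
- move=> U; rewrite mem_filter negbK fpowersetE iE; apply/andP/mapP => [[nU UF]|[V]].
    exists (U `\ n)%fset; last by rewrite fsetD1K.
    by rewrite fpowersetE fsubDset.
  rewrite fpowersetE => VF ->; rewrite fset1U1; split => //.
  exact: fsetUS.
Qed.

(** A set of indices below [n + 1] either contains [n] or not. *)
Lemma esp_fpowerset (c : nat -> R) n k : esp c n k =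
  \sum_(U <- fpowerset (iotaset n)) (#|` U| == k)%:R * \prod_(u <- U) c u.
Proof.
elim: n k => [|n IH] k.
  have -> : iotaset 0 = fset0 by apply/fsetP => i; rewrite !inE.
  rewrite fpowerset0 big_seq_fset1 cardfs0 big_seq_fset0 mulr1.
  by case: k.
rewrite big_fpowersetS big_split /= IH; congr (_ + _).
have nV V : V \in fpowerset (iotaset n) -> n \notin V.
  rewrite fpowersetE => /fsubsetP VF; apply/negP => /VF.
  by rewrite mem_iotaset ltnn.
case: k => [|k].
  rewrite big1_seq // => V /andP[_ VF].
  by rewrite cardfsU1 (nV V VF) mul0r.
rewrite IH mulr_sumr; apply: eq_big_seq => V VF.
by rewrite cardfsU1 (nV V VF) add1n eqSS big_fsetU1 ?nV //=; ring.
Qed.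

End IotaSet.

(** * The Fredholm determinant *)

Section Fredholm.
Context {R : realType} {H : completeNormedModType R}.
Variable ip : {dot H for idfun}.
Hypothesis ip_norm : hilbert_inner ip.
Context {d : Order.disp_t} {J : orderType d}.
Variable e : J -> H.
Hypothesis e_basis : orthonormal_basis ip e.
Variables (A : {linear H -> H}) (a : nat -> R) (g : nat -> H) (C : R).
Hypothesis A_cont : continuous A.
Hypothesis A_skew : skew_adjoint ip A.
Hypothesis a_ge0 : forall k, 0 <= a k.
Hypothesis gA : skew_frame ip A a g.
Hypothesis a_sum : forall n, \sum_(k < n) a k ^+ 2 <= C.
Implicit Types (S F : {fset J}) (U : {fset nat}).

Let gK : osys ip g (fun i => 0 < a i./2). Proof. by case: gA. Qed.
Local Notation T := (tT A).

(** [g i] and [g (partner i)] span one plane. *)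
Definition partner i := if odd i then i.-1 else i.+1.
Definition psign i : R := if odd i then -1 else 1.
(** [A (g i) = a_(i/2) * rot i]. *)
Definition rot i : H := psign i *: g (partner i).
(** The eigenvalues of [A^* A] along [g]; each [a_k^2] occurs twice. *)
Definition dbl i : R := a i./2 ^+ 2.

Lemma half_partner i : (partner i)./2 = i./2.
Proof. by rewrite /partner; case: ifP => oi; lia. Qed.

Lemma partner_eq i j : (partner i == partner j) = (i == j).
Proof.
apply/eqP/eqP => [|-> //]; rewrite /partner.
by case: ifP => oi; case: ifP => oj; lia.
Qed.

Lemma rot_osys : osys ip rot (fun i => 0 < a i./2).
Proof.
move=> i j; rewrite /rot ipZl ipZr gK half_partner partner_eq.
case: eqP => [->|_]; last by rewrite andbF !mulr0.
by rewrite mulrA /psign; case: ifP; rewrite ?mulrNN ?mulr1 mul1r.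
Qed.

Lemma A_rot i : A (g i) = a i./2 *: rot i.
Proof.
rewrite /rot /partner /psign -(odd_double_half i); case: (odd i).
  rewrite add1n (frame_odd gA) /= odd_double /= uphalf_double scaleN1r scalerN.
  by [].
by rewrite add0n (frame_even gA) odd_double doubleK scale1r.
Qed.

(** The row of index [s] of the matrix of [A] between the basis [e] and the system [g]. *)
Definition row_coord (s : J) : nat -> R := fun i => ip (A (e s)) (g i).
Definition rot_coord (i : nat) : J -> R := coord ip e (rot i).

Lemma row_rot s i : row_coord s i = - a i./2 * rot_coord i s.
Proof. by rewrite /row_coord A_skew A_rot ipZr /rot_coord /coord mulNr (ipC _ (e s)). Qed.

(** The rows have the Gram matrix of [A^* A], as if [g] were a basis: moving the
    second [A] to the left by skew-adjointness leaves [A (A e_s)], and what is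
    orthogonal to [g] is in the kernel of [A]. *)
Lemma row_gram s s' :
  dotf (iotaset n) (row_coord s) (row_coord s') @[n --> \oo] --> ip (A (e s)) (A (e s')).
Proof.
rewrite (_ : (fun n => _) = fun n =>
    ip (\sum_(0 <= i < n) ip (A (e s)) (g i) *: g i) (A (e s'))); last first.
  apply/funext => n; rewrite /dotf big_iotaset ip_suml; apply: eq_bigr => i _.
  by rewrite ipZl /row_coord (ipC _ (g i)).
have h n : ip (\sum_(0 <= i < n) ip (A (e s)) (g i) *: g i) (A (e s')) =
    - ip (\sum_(0 <= i < n) ip (A (e s)) (g i) *: A (g i)) (e s').
  rewrite !ip_suml -sumrN; apply: eq_bigr => i _.
  by rewrite !ipZl -mulrN [ip (A (g i)) _]A_skew opprK.
under eq_cvg do rewrite h.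
have -> : ip (A (e s)) (A (e s')) = - ip (A (A (e s))) (e s') by rewrite [in RHS]A_skew opprK.
apply: cvgN; apply: (cvg_ipl ip_norm).
exact: (linear_expansion ip_norm gK A_cont (frame_ker gA)).
Qed.

(** The rows with index in [S], wedged together in the exterior algebra over [nat]. *)
Definition row_wedge S : {fset nat} -> R :=
  extn #|` S| (fun i => nth (fun=> 0) [seq row_coord s | s <- increasing S] i).

(** The vectors [rot u], [u] in [U], wedged together in the exterior algebra over [J]. *)
Definition rot_wedge U : {fset J} -> R :=
  extn #|` U| (fun i => nth (fun=> 0) [seq rot_coord j | j <- increasing U] i).

Lemma fset_increasing (d' : Order.disp_t) (K : orderType d') (U : {fset K}) :
  [fset i | i in increasing U]%fset = U.
Proof. by apply/fsetP => i; rewrite !inE /= mem_increasing. Qed.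

(** Both coefficients are minors of the same matrix [<rot u, e_s>], up to the
    column factors [- a_(u/2)]. *)
Lemma row_wedge_sqr S U :
  row_wedge S U ^+ 2 = \prod_(u <- U) dbl u * rot_wedge U S ^+ 2.
Proof.
have [US|US] := eqVneq #|` U| #|` S|; last first.
  by rewrite /row_wedge /rot_wedge !extn_supp ?expr0n ?mulr0 // eq_sym.
case sS: (increasing S) => [|x0 s'].
  have S0 : S = fset0 by apply/fsetP => j; rewrite -mem_increasing sS !inE.
  have U0 : U = fset0 by apply/eqP; rewrite -cardfs_eq0 US S0 cardfs0.
  rewrite /row_wedge /rot_wedge S0 U0 !cardfs0 /= /vac eqxx big_seq_fset0.
  by rewrite mul1r.
have h1 : row_wedge S U = \det (\matrix_(i < #|` S|, j < #|` S|)
    row_coord (nth x0 (increasing S) i) (nth 0%N (increasing U) j)).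
  rewrite /row_wedge -[in LHS](fset_increasing U).
  rewrite (extn_det 0%N) ?increasing_sorted ?size_increasing //.
  congr (\det _); apply/matrixP => i j; rewrite !mxE.
  by rewrite (nth_map x0) ?size_increasing.
have h2 : rot_wedge U S = \det (\matrix_(i < #|` S|, j < #|` S|)
    rot_coord (nth 0%N (increasing U) i) (nth x0 (increasing S) j)).
  rewrite /rot_wedge -[in LHS](fset_increasing S) US.
  rewrite (extn_det x0) ?increasing_sorted ?size_increasing //.
  congr (\det _); apply/matrixP => i j; rewrite !mxE.
  by rewrite (nth_map 0%N) ?size_increasing ?US.
have -> : row_wedge S U = rot_wedge U S *
    \prod_(j < #|` S|) (- a (nth 0%N (increasing U) j)./2).
  pose D := diag_mx (\row_(j < #|` S|) (- a (nth 0%N (increasing U) j)./2)).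
  have -> : \prod_(j < #|` S|) (- a (nth 0%N (increasing U) j)./2) = \det D.
    by rewrite det_diag; apply: eq_bigr => j _; rewrite mxE.
  rewrite h1 h2 -[X in X * _]det_tr -det_mulmx; congr (\det _).
  by apply/matrixP => i j; rewrite mul_mx_diag !mxE row_rot mulrC.
rewrite exprMn mulrC; congr (_ * _); rewrite -prodrXl.
under eq_bigr do rewrite sqrrN.
rewrite -US -(size_increasing U) -(big_mkord xpredT (fun j => a (nth 0%N (increasing U) j)./2 ^+ 2)).
rewrite -(big_nth 0%N xpredT dbl) /=.
by apply: perm_big; rewrite perm_sort.
Qed.

(** The squared norm of [rot u], which is zero for a padded index. *)
Definition kap (u : nat) : R := ((0 < a u./2)%R : bool)%:R.

Lemma rot_wedge_normlim U :
  normlim (rot_wedge U) (\prod_(u <- U) kap u).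
Proof.
pose k := #|` U|; pose u i := nth 0%N (increasing U) i.
have -> : \prod_(u <- U) kap u =
    \det (\matrix_(i < k, j < k) ip (rot (u i)) (rot (u j))).
  have -> : \matrix_(i < k, j < k) ip (rot (u i)) (rot (u j)) =
      diag_mx (\row_(j < k) kap (u j)).
    apply/matrixP => i j; rewrite !mxE rot_osys /u /kap nth_uniq ?size_increasing ?ltn_ord //.
      by case: eqP => [/val_inj ->|/eqP ij]; rewrite ?eqxx ?andbT ?mulr1n // andbF (negbTE (ij : i != j)).
    by rewrite sort_uniq fset_uniq.
  rewrite det_diag; under [RHS]eq_bigr do rewrite mxE.
  rewrite /k -(size_increasing U) -(big_mkord xpredT (fun j => kap (u j))).
  rewrite -(big_nth 0%N xpredT kap) /=.
  by apply: perm_big; rewrite perm_sym perm_sort.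
apply: gram_normlim => i j; rewrite mxE !(nth_map 0%N) ?size_increasing //.
exact: parseval.
Qed.

Lemma dbl_ge0 i : 0 <= dbl i. Proof. exact: sqr_ge0. Qed.

Lemma dbl_kappa (U : {fset nat}) :
  \prod_(u <- U) dbl u * \prod_(u <- U) kap u = \prod_(u <- U) dbl u.
Proof.
rewrite -big_split /=; apply: eq_bigr => u _; rewrite /dbl /kap.
have := a_ge0 u./2; rewrite le_eqVlt => /orP[/eqP <-|->]; last by rewrite mulr1.
by rewrite expr0n /= mul0r.
Qed.

Lemma dbl_sum n : \sum_(i < n) dbl i <= 2 * C.
Proof.
apply: (@le_trans _ _ (\sum_(i < n.*2) dbl i)).
  rewrite -!(big_mkord xpredT dbl) (big_cat_nat (leq0n n) (_ : (n <= n.*2)%N)) /=.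
    by rewrite lerDl sumr_ge0 // => i _; exact: dbl_ge0.
  by rewrite -addnn leq_addr.
rewrite -(big_mkord xpredT dbl) sum_double /dbl.
rewrite (eq_bigr (fun k : 'I_n => 2 * a k ^+ 2)); last first.
  by move=> k _; rewrite doubleK /= uphalf_double; ring.
by rewrite -mulr_sumr ler_wpM2l ?ler0n ?a_sum.
Qed.

Local Notation pm := (principal_minor ip e T).

(** A principal minor of [A^* A] is the Gram determinant of rows of [A], hence the
    squared norm of a wedge product. *)
Lemma row_wedge_minor S : nrm (iotaset n) (row_wedge S) @[n --> \oo] --> pm S.
Proof.
rewrite /principal_minor.
rewrite (_ : (fun n => _) = fun n => \det (\matrix_(i < size (increasing S),
    j < size (increasing S)) dotf (iotaset n)
      (row_coord (tnth (in_tuple (increasing S)) i))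
      (row_coord (tnth (in_tuple (increasing S)) j)))).
  apply: cvg_sum_seq => s _; apply: cvgM; first exact: cvg_cst.
  apply: cvg_big => [|i _]; first exact: mul_continuous.
  rewrite mxE; under eq_cvg do rewrite mxE.
  by rewrite (tT_ip A_skew) ipC; exact: row_gram.
apply/funext => n; rewrite /row_wedge -(size_increasing S) /nrm bil_extn.
congr (\det _); apply/matrixP => i j; rewrite !mxE.
have x0 := tnth (in_tuple (increasing S)) i.
by rewrite !(nth_map x0) ?size_sort // !(tnth_nth x0).
Qed.

(** Cauchy-Binet on finite parts: the squares of all minors of size [k] are summed
    with the roles of the two bases exchanged. *)
Lemma row_wedge_sum F k n :
  \sum_(S <- fpowerset F) (#|` S| == k)%:R * nrm (iotaset n) (row_wedge S) =
  \sum_(U <- fpowerset (iotaset n)) (#|` U| == k)%:R * \prod_(u <- U) dbl u *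
    nrm F (rot_wedge U).
Proof.
rewrite /nrm /bil; under eq_bigr do rewrite mulr_sumr.
rewrite exchange_big /=; apply: eq_bigr => U _.
rewrite mulr_sumr; apply: eq_bigr => S _.
rewrite -expr2 row_wedge_sqr -expr2 -!mulrA.
have [->//|US] := eqVneq #|` U| #|` S|.
by rewrite /rot_wedge extn_supp ?expr0n ?mulr0 // eq_sym.
Qed.

Lemma minor_ge0 S : 0 <= pm S.
Proof.
by apply: (cvgn_le (K := 0) (cvg_cst _) (@row_wedge_minor S)) => n _; exact: nrm_ge0.
Qed.

Lemma minor_ge S n : nrm (iotaset n) (row_wedge S) <= pm S.
Proof.
apply: (cvgn_le (K := n) (cvg_cst _) (@row_wedge_minor S)) => m nm.
apply: nrm_mono; apply/fsubsetP => i; rewrite !mem_iotaset => iN.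
exact: leq_trans iN nm.
Qed.

(** For fixed [F], the sum over [S] is finite and the limit in [n] may be taken
    inside; after the exchange each squared norm is at most its limit in [F]. *)
Lemma minor_sum_le F k :
  \sum_(S <- fpowerset F) homogeneous k pm S <= einf dbl k.
Proof.
have h : \sum_(S <- fpowerset F) (#|` S| == k)%:R * nrm (iotaset n) (row_wedge S)
    @[n --> \oo] --> \sum_(S <- fpowerset F) homogeneous k pm S.
  apply: cvg_sum_seq => S _; rewrite /homogeneous; case: eqP => _.
    by rewrite -[X in _ --> X]mul1r; apply: cvgM; [exact: cvg_cst | exact: row_wedge_minor].
  by under eq_cvg do rewrite mul0r; exact: cvg_cst.
apply: (cvgn_le (K := 0) h (@esp_cvg _ _ _ dbl_ge0 dbl_sum k)) => n _.
rewrite row_wedge_sum esp_fpowerset; apply: ler_sum => U _.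
rewrite -[in leRHS]dbl_kappa mulrA ler_wpM2l //.
  by rewrite mulr_ge0 ?ler0n // prodr_ge0 // => u _; exact: dbl_ge0.
by apply: normlim_ge; exact: rot_wedge_normlim.
Qed.

(** The lower bound fixes [n] first: finitely many [U] then converge as [F]
    grows. *)
Lemma minor_sum_cvg k :
  (fun F : {fset J} => \sum_(S <- fpowerset F) homogeneous k pm S) @ totally -->
  einf dbl k.
Proof.
apply/cvgrPdist_lt => eps eps0.
have eps2 : 0 < eps / 2 by rewrite divr_gt0.
move/cvgrPdist_lt: (@esp_cvg _ _ _ dbl_ge0 dbl_sum k) => /(_ _ eps2)[n _ /(_ n (leqnn n)) /= hn].
have h : (fun F : {fset J} => \sum_(U <- fpowerset (iotaset n))
    (#|` U| == k)%:R * \prod_(u <- U) dbl u * nrm F (rot_wedge U)) @ totally -->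
    esp dbl n k.
  rewrite esp_fpowerset; apply: cvg_sum_seq => U _.
  rewrite -[in X in _ --> X]dbl_kappa mulrA; apply: cvgM; first exact: cvg_cst.
  exact: rot_wedge_normlim.
move/cvgrPdist_lt: h => /(_ _ eps2); apply: filterS => F /= hF.
have up := minor_sum_le F k.
have lo : \sum_(U <- fpowerset (iotaset n)) (#|` U| == k)%:R * \prod_(u <- U) dbl u *
    nrm F (rot_wedge U) <= \sum_(S <- fpowerset F) homogeneous k pm S.
  rewrite -row_wedge_sum; apply: ler_sum => S _; rewrite /homogeneous.
  by case: eqP => _; rewrite ?mul1r ?mul0r // minor_ge.
rewrite ger0_norm ?subr_ge0 //.
have := ler_norm (einf dbl k - esp dbl n k).
have := ler_norm (esp dbl n k - \sum_(U <- fpowerset (iotaset n))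
  (#|` U| == k)%:R * \prod_(u <- U) dbl u * nrm F (rot_wedge U)).
lra.
Qed.

(** The terms are nonnegative, so convergence along power sets implies convergence
    along all finite families of index sets. *)
Lemma minor_partial_sum_cvg k :
  partial_sum (homogeneous k pm) @ totally --> einf dbl k.
Proof.
have pmE (X : {fset {fset J}}) :
    partial_sum (homogeneous k pm) X = \sum_(S <- X) homogeneous k pm S.
  by rewrite /partial_sum big_seq_fsetE.
have h0 S : 0 <= homogeneous k pm S.
  by rewrite /homogeneous; case: ifP => // _; exact: minor_ge0.
have mono (X Y : {fset {fset J}}) : (X `<=` Y)%fset ->
    \sum_(S <- X) homogeneous k pm S <= \sum_(S <- Y) homogeneous k pm S.
  move=> XY; rewrite (big_fsetID _ [in X] Y) /=.
  rewrite [X in _ <= X + _](_ : _ = \sum_(S <- X) homogeneous k pm S).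
    by rewrite lerDl sumr_ge0.
  apply: eq_fbigl => S; rewrite !inE /=.
  by case: (boolP (S \in X)) => [SX|]; rewrite ?andbF ?andbT // (fsubsetP XY).
apply/cvgrPdist_lt => eps eps0.
move/cvgrPdist_lt: (@minor_sum_cvg k) => /(_ _ eps0)[F _ /(_ F (fsubset_refl F)) /= hF].
exists (fpowerset F) => // X /= FX; rewrite pmE.
have up : \sum_(S <- X) homogeneous k pm S <= einf dbl k.
  apply: le_trans (minor_sum_le (\bigcup_(S <- X) S)%fset k); apply: mono.
  apply/fsubsetP => S SX; rewrite fpowersetE; apply/fsubsetP => j jS.
  by apply/bigfcupP; exists S; rewrite ?SX.
rewrite ger0_norm ?subr_ge0 //.
have := mono _ _ FX; have := le_lt_trans (ler_norm _) hF; lra.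
Qed.

(** [tr (/\^k T)] is the elementary symmetric function of the eigenvalues [dbl], and
    pairing the equal factors gives the square of the product over the planes. *)
Lemma fredholm_det (z : R[i]^o) : is_fredholm_det ip e T z (skew_det a z ^+ 2).
Proof.
exists (einf dbl); split=> [k|]; first exact: minor_partial_sum_cvg.
have [L [h1 h2]] := einf_series dbl_ge0 dbl_sum z.
suff -> : skew_det a z ^+ 2 = L by [].
have h3 := cvg_double h2.
have h4 := (skew_det_cvg a_sum z).1.
have E n : skew_det_partial a z n * skew_det_partial a z n =
    \prod_(k < n.*2) (1 + z * (dbl k)%:C).
  rewrite /skew_det_partial -big_split /=.
  elim: n => [|n IH]; first by rewrite !big_ord0.
  have d0 : dbl n.*2 = a n ^+ 2 by rewrite /dbl doubleK.
  have d1 : dbl n.*2.+1 = a n ^+ 2 by rewrite /dbl /= uphalf_double.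
  by rewrite doubleS !big_ord_recr /= IH d0 d1 mulrA.
have h5 : (fun n => \prod_(k < n.*2) (1 + z * (dbl k)%:C) : R[i]^o) @ \oo -->
    skew_det a z * skew_det a z.
  by rewrite -(funext E); apply: cvgM.
by rewrite expr2; apply: (cvg_unique _ h5 h3).
Qed.

End Fredholm.

(** * Eigenvectors and projection-valued measures *)

Section ProjectionValued.
Context {R : realType} {H : completeNormedModType R}.
Variable ip : {dot H for idfun}.
Hypothesis ip_norm : hilbert_inner ip.
Variable E : pvm ip.
Implicit Types (B : set R) (u y w : H).

Lemma pvm_idem B u : measurable B -> E B (E B u) = E B u.
Proof. by move=> mB; rewrite -pvm_setI // setIid. Qed.

Lemma pvmC B D u : measurable B -> measurable D -> E B (E D u) = E D (E B u).
Proof. by move=> mB mD; rewrite -!pvm_setI // setIC. Qed.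

Lemma pvm_norm B u : measurable B -> `|E B u| ^+ 2 = ip (E B u) u.
Proof. by move=> mB; rewrite -ip_norm -pvm_sym // pvm_idem. Qed.

Lemma pvm_contr B u : measurable B -> `|E B u| <= `|u|.
Proof.
move=> mB; have [->|nz] := eqVneq (E B u) 0; first by rewrite normr0.
rewrite -(ler_pM2l (_ : 0 < `|E B u|)) ?normr_gt0 // -expr2 pvm_norm //.
by apply: le_trans (ler_norm _) _; exact: ip_CS.
Qed.

Lemma pvm_cvg B (f : nat -> H) u : measurable B -> f n @[n --> \oo] --> u ->
  E B (f n) @[n --> \oo] --> E B u.
Proof.
move=> mB fu; apply/cvgrPdist_lt => eps eps0.
move/cvgrPdist_lt: fu => /(_ _ eps0); apply: filterS => n; apply: le_lt_trans.
by rewrite -linearB pvm_contr.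
Qed.

Lemma pvm_setU B D u : measurable B -> measurable D -> B `&` D = set0 ->
  E (B `|` D) u = E B u + E D u.
Proof.
move=> mB mD BD; apply: (ip_inj ip_norm) => v.
have mF n : measurable (bigcup2 B D n) by rewrite /bigcup2; case: n => [|[|n]] //=; exact: measurable0.
have tF : trivIset setT (bigcup2 B D) by rewrite -trivIset_bigcup2 // BD.
have := @pvm_sigma _ _ _ E _ mF tF u v; rewrite bigcup2E => h.
apply: (cvg_unique _ h) => //; apply: cvg_near_cst; exists 2%N => // -[|[|n]] // _.
rewrite !big_nat_recl // big1 ?addr0 ?ipDl // => i _.
by rewrite /bigcup2 /= pvm_set0 ip0l.
Qed.

Lemma cyclicE u B : measurable B -> cyclic_measure E u B = (ip (E B u) u)%:E.
Proof. by move=> mB; rewrite /cyclic_measure asboolT. Qed.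

Variable T : H -> H.
Hypothesis T_add : forall y w, T (y + w) = T y + T w.
Hypothesis T_sym : forall y w, ip (T y) w = ip y (T w).
Hypothesis TE : spectral_measure_of T E.

Lemma spectral_int u : (\int[cyclic_measure E u]_l l%:E = (ip (T u) u)%:E)%E.
Proof.
have [iu <-] := TE u; rewrite /Rintegral fineK //.
exact: integrable_fin_num.
Qed.

(** The cyclic measure of [y + w] is the sum of those of [y] and [w], and so is its
    first moment; the cross terms [2 <T y, w>] must vanish. *)
Lemma spectral_orth B y w : measurable B -> E B y = y -> E B w = 0 -> ip (T y) w = 0.
Proof.
move=> mB yB wB.
have cross D : measurable D -> ip (E D y) w = 0.
  by move=> mD; rewrite -{1}yB pvmC // pvm_sym // wB ip0r.
have mE D : measurable D -> cyclic_measure E (y + w) D =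
    measure_add (cyclic_measure E y) (cyclic_measure E w) D.
  move=> mD; rewrite measure_addE /= !cyclicE // -EFinD (linearD (pvm_proj E D)) ipDl !ipDr.
  by rewrite cross // (ipC _ (E D w)) -pvm_sym // cross // addr0 add0r.
have := spectral_int (y + w).
rewrite (eq_measure_integral (measure_add (cyclic_measure E y) (cyclic_measure E w))); last first.
  by move=> D mD _; exact: mE.
rewrite integral_measure_add //; [|exact: (TE y).1|exact: (TE w).1].
rewrite !spectral_int -EFinD => -[]; rewrite T_add ipDl !ipDr.
rewrite (ipC _ (T w) y) -T_sym; lra.
Qed.

Lemma cyclic_null B y : measurable B -> E B y = y -> cyclic_measure E y (~` B) = 0%E.
Proof.
move=> mB yB; have mC : measurable (~` B) by exact: measurableC.
by rewrite cyclicE // -{1}yB -pvm_setI // setICl pvm_set0 ip0l.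
Qed.

Lemma cyclic_self B y : measurable B -> E B y = y ->
  cyclic_measure E y B = (ip y y)%:E.
Proof. by move=> mB yB; rewrite cyclicE // yB. Qed.

Lemma spectral_int_range B y : measurable B -> E B y = y ->
  (\int[cyclic_measure E y]_(l in B) l%:E = (ip (T y) y)%:E)%E.
Proof.
move=> mB yB; rewrite -spectral_int.
rewrite [RHS](@negligible_integral _ _ _ _ setT (~` B)) //.
- by rewrite setDE setCK setTI.
- exact: measurableC.
- exact: (TE y).1.
- exact: cyclic_null.
Qed.

(** On the range of [E {l}] the form of [T] is [l |y|^2], since the cyclic measures
    there are point masses; polarization gives the bilinear form, and the
    complement of the range is orthogonal for both. *)
Lemma spectral_range_scalar l y : E [set l] y = y -> T y = l *: y.
Proof.
have ml : measurable [set l] by exact: measurable_set1.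
have quad u : E [set l] u = u -> ip (T u) u = l * ip u u.
  move=> uE; have := spectral_int_range ml uE.
  rewrite (eq_integral (cst l%:E)); last by move=> t; rewrite inE /= => ->.
  by rewrite integral_cst //= cyclic_self // -EFinM => -[].
move=> yE; apply: (ip_inj ip_norm) => w; rewrite ipZl.
pose v := E [set l] w.
have vE : E [set l] v = v by rewrite /v pvm_idem.
have E0 : E [set l] (w - v) = 0 by rewrite (linearB (pvm_proj E [set l])) vE subrr.
have -> : w = v + (w - v) by rewrite addrC subrK.
rewrite [ip (T y) (v + _)]ipDr [ip y (v + _)]ipDr (spectral_orth ml yE E0) addr0.
have -> : ip y (w - v) = 0 by rewrite -{1}yE pvm_sym // E0 ip0r.
rewrite addr0.
have := quad (y + v); rewrite (linearD (pvm_proj E [set l])) yE vE => /(_ erefl).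
rewrite T_add !(ipDl, ipDr) (quad y yE) (quad v vE) (T_sym v) (ipC _ v (T y)) (ipC _ v y).
by move=> h; lra.
Qed.

(** Let [y = E B u]. The form of [T] at [y] is [c |y|^2] because the rest of [u] is
    orthogonal to [y], also for the form of [T]; so the integral of [l - c] over [B] against the cyclic
    measure of [y] is zero. The integrand has constant sign [s] on [B], so the
    measure is zero. *)
Lemma eigen_null (B : set R) (s c : R) u : measurable B ->
  (forall t, B t -> 0 < s * (t - c)) -> T u = c *: u -> E B u = 0.
Proof.
move=> mB Bs Tu; pose y := E B u; pose w := u - y.
have yB : E B y = y by exact: pvm_idem.
have wB : E B w = 0 by rewrite /w (linearB (pvm_proj E B)) yB subrr.
have Ty : ip (T y) y = c * ip y y.
  have h := congr1 (fun v => ip v y) Tu; have uE : u = y + w by rewrite /w addrC subrK.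
  have wy : ip w y = 0 by rewrite -yB -pvm_sym // wB ip0l.
  have Twy : ip (T w) y = 0 by rewrite T_sym ipC (spectral_orth mB yB wB).
  have e1 : ip (T (y + w)) y = ip (T y) y by rewrite T_add ipDl Twy addr0.
  have e2 : ip (y + w) y = ip y y by rewrite ipDl wy addr0.
  rewrite -uE in e1 e2; rewrite -e1 -e2.
  by move: h; rewrite /= ipZl.
have iy : (cyclic_measure E y).-integrable B EFin.
  by apply: (integrableS _ mB _ (TE y).1).
have ic : (cyclic_measure E y).-integrable B (EFin \o cst c).
  apply/integrableP; split; first exact/measurable_EFinP.
  rewrite (eq_integral (cst `|c|%:E)) // integral_cst //= cyclic_self // -EFinM.
  exact: ltry.
have int0 : (\int[cyclic_measure E y]_(t in B) (t%:E - (cst c t)%:E) = 0)%E.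
  rewrite (integralB_EFin (f1 := idfun)) // spectral_int_range //.
  rewrite [X in (_ - X)%E](eq_integral (cst c%:E)) // integral_cst //= cyclic_self //.
  by rewrite -EFinM -EFinB Ty subrr.
have abs0 : (\int[cyclic_measure E y]_(t in B) `|(s * (t - c))%:E| = 0)%E.
  rewrite (eq_integral (fun t : R => (s%:E * (t%:E - (cst c t)%:E))%E)); last first.
    by move=> t; rewrite inE => Bt; rewrite gee0_abs ?lee_fin ?ltW ?Bs // -EFinB -EFinM.
  rewrite integralZl ?int0 ?mule0 //.
  exact: (@integrableB _ _ _ _ _ mB EFin (EFin \o cst c) iy ic).
have mf : measurable_fun B (fun t : R => (s * (t - c))%:E).
  apply/measurable_EFinP; apply: measurable_funM => //.
  by apply: measurable_funB.
have [/(_ abs0) ae _] := ae_eq_integral_abs (cyclic_measure E y) mB mf.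
have : cyclic_measure E y B = 0%E.
  apply/(negligibleP _ mB).
  move: ae; apply: negligibleS => t Bt /= /(_ Bt) [] /eqP.
  by rewrite gt_eqF // Bs.
by rewrite cyclic_self // => -[] /(ip_eq0 ip_norm).
Qed.

(** The half-lines on either side of [c] carry no part of [u]. *)
Lemma eigen_range c u : T u = c *: u -> E [set c] u = u.
Proof.
move=> Tu; have mc : measurable [set c] by exact: measurable_set1.
have m1 : measurable (`]c, +oo[ : set R)%classic by exact: measurable_itv.
have m2 : measurable (`]-oo, c[ : set R)%classic by exact: measurable_itv.
have z1 : E (`]c, +oo[)%classic u = 0.
  apply: (eigen_null (s := 1) m1 _ Tu) => t /=.
  by rewrite in_itv /= andbT mul1r subr_gt0.
have z2 : E (`]-oo, c[)%classic u = 0.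
  apply: (eigen_null (s := -1) m2 _ Tu) => t /=.
  by rewrite in_itv /= mulN1r opprB subr_gt0.
have : E setT u = u by exact: pvm_setT.
have -> : setT = ([set c] `|` (`]c, +oo[ `|` `]-oo, c[) : set R)%classic.
  apply/seteqP; split => // t _; case: (ltgtP t c) => tc.
  - by right; right; rewrite /= in_itv /=.
  - by right; left; rewrite /= in_itv /= andbT.
  - by left.
rewrite pvm_setU //; [|exact: measurableU|]; last first.
  rewrite -subset0 => t [/= ->] [] /=; rewrite in_itv /= ?andbT ltxx //.
rewrite pvm_setU //; last first.
  rewrite -subset0 => t [/=]; rewrite !in_itv /= andbT => h1 h2.
  by move: (lt_trans h1 h2); rewrite ltxx.
by rewrite z1 z2 !addr0.
Qed.

End ProjectionValued.

(** * Discrete measures with equal moments *)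

Section DiscreteUniqueness.
Context {R : realType}.
Variables (c dl : nat -> R) (D : R).
Hypothesis c_ge0 : forall k, 0 <= c k.
Hypothesis c_nd : forall i j, (i <= j)%N -> c j <= c i.
Hypothesis c_cvg : c n @[n --> \oo] --> (0 : R).
Hypothesis dl_sum : forall n, \sum_(0 <= k < n) `|dl k| <= D.
Hypothesis dl0 : forall k, c k = 0 -> dl k = 0.
Hypothesis mom : forall j, (0 < j)%N ->
  \sum_(0 <= k < n) c k ^+ j * dl k @[n --> \oo] --> (0 : R).

(** [n] starts a new level of the nonincreasing sequence [c]. *)
Definition block_end n := forall i, (i < n)%N -> c n < c i.

Lemma block_start n : exists2 n', (n' <= n)%N & c n' = c n /\ block_end n'.
Proof.
have ex : exists k, c k == c n by exists n.
case: (ex_minnP ex) => n' /eqP n'n min; exists n'; first by apply: min.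
split=> // i in'; rewrite lt_neqAle c_nd ?(ltnW in') // andbT.
apply/negP => /eqP E; have := min i; rewrite -E n'n eqxx => /(_ isT).
by rewrite leqNgt in'.
Qed.

(** The weights on one level of [c] have sum zero, by induction over the levels
    from the largest down. Once the levels above vanish, the moment of order [j]
    is [v^j] times the weight [delta] of the level [v], up to an error
    [v'^j * D] with [v' < v] the next value; letting [j] grow gives
    [delta = 0]. *)
Lemma block_sum0 n : block_end n -> forall h : R -> R,
  \sum_(0 <= k < n) h (c k) * dl k = 0.
Proof.
have [N] := ubnP n; elim: N n => // N IH [|n] nN bn h; first by rewrite big_geq.
have [n' n'n [cn' bn']] := block_start n.
have n'lt : (n' < n.+1)%N by [].
have IHn' := IH n' (leq_trans n'lt nN) bn'.
have cE k : (n' <= k < n.+1)%N -> c k = c n.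
  move=> /andP[n'k kn]; apply/eqP; rewrite eq_le -{1}cn' c_nd //= c_nd //.
pose delta := \sum_(n' <= k < n.+1) dl k.
have sE (h' : R -> R) : \sum_(0 <= k < n.+1) h' (c k) * dl k = h' (c n) * delta.
  rewrite (big_cat_nat (leq0n n') (ltnW n'lt)) /= IHn' add0r /delta mulr_sumr.
  by apply: eq_big_nat => k kn; rewrite cE.
rewrite sE; suff -> : delta = 0 by rewrite mulr0.
have v0 : 0 < c n by apply: le_lt_trans (c_ge0 n.+1) _; exact: bn.
pose r := c n.+1 / c n.
have r0 : 0 <= r by rewrite divr_ge0.
have r1 : r < 1 by rewrite ltr_pdivrMr // mul1r bn.
have bound j : (0 < j)%N -> `|delta| <= r ^+ j * D.
  move=> j0.
  have lim1 : `|\sum_(0 <= k < m) c k ^+ j * dl k| @[m --> \oo] --> (0 : R).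
    by have := cvg_norm (mom j0); rewrite normr0 => nm; exact: nm.
  have ge m : (n.+1 <= m)%N -> c n ^+ j * `|delta| - c n.+1 ^+ j * D <=
      `|\sum_(0 <= k < m) c k ^+ j * dl k|.
    move=> nm; rewrite (big_cat_nat (leq0n n.+1) nm) /= (sE (fun t => t ^+ j)).
    have tail : `|\sum_(n.+1 <= k < m) c k ^+ j * dl k| <= c n.+1 ^+ j * D.
      apply: le_trans (ler_norm_sum _ _ _) _.
      apply: (@le_trans _ _ (\sum_(n.+1 <= k < m) c n.+1 ^+ j * `|dl k|)).
        rewrite big_nat_cond [leRHS]big_nat_cond; apply: ler_sum => k /andP[/andP[nk _] _].
        rewrite normrM ler_wpM2r // normrX ger0_norm //.
        by rewrite lerXn2r ?nnegrE // c_nd.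
      rewrite -mulr_sumr ler_wpM2l ?exprn_ge0 //; apply: le_trans (dl_sum m).
      by rewrite [leRHS](big_cat_nat (leq0n n.+1) nm) /= lerDr sumr_ge0.
    have := lerB_normD (c n ^+ j * delta) (\sum_(n.+1 <= k < m) c k ^+ j * dl k).
    rewrite normrM (ger0_norm (exprn_ge0 j (c_ge0 n))).
    move: tail; lra.
  have := cvgn_le (K := n.+1) (cvg_cst _) lim1 ge.
  rewrite subr_le0 -ler_pdivlMl ?exprn_gt0 // => h1.
  have -> : r ^+ j * D = (c n ^+ j)^-1 * (c n.+1 ^+ j * D).
    by rewrite /r expr_div_n; ring.
  exact: h1.
have D0 : 0 <= D by apply: le_trans (dl_sum 0); rewrite big_geq.
have lim2 : r ^+ j * D @[j --> \oo] --> (0 : R).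
  rewrite -[X in _ --> X](mul0r D); apply: cvgM; last exact: cvg_cst.
  by apply: cvg_expr; rewrite ger0_norm.
by apply/eqP; rewrite -normr_le0; exact: (cvgn_le (K := 1) (cvg_cst _) lim2 bound).
Qed.

(** All partial sums up to the start of a level vanish, and there are arbitrarily
    long ones: either [c] decreases to zero through infinitely many levels, or it
    reaches zero, where the weights vanish. *)
Lemma discrete_unique (h : R -> R) (S : R) :
  \sum_(0 <= k < n) h (c k) * dl k @[n --> \oo] --> S -> S = 0.
Proof.
move=> hS; have key N : exists2 n, (N <= n)%N & \sum_(0 <= k < n) h (c k) * dl k = 0.
  have := c_ge0 N; rewrite le_eqVlt => /orP[/eqP cN|cN].
    have [n' n'N [cn' bn']] := block_start N; exists N => //.
    rewrite (big_cat_nat (leq0n n') n'N) /= (block_sum0 bn') add0r big1_seq // => k.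
    rewrite mem_index_iota => /andP[_ /andP[n'k kN]]; rewrite dl0 ?mulr0 //.
    by apply/eqP; rewrite eq_le c_ge0 andbT cN -cn' c_nd.
  move/cvgr0Pnorm_lt: c_cvg => /(_ _ cN)[M _ /(_ (maxn M N) (leq_maxl _ _)) /= cM].
  rewrite ger0_norm // in cM; have [n' n'M [cn' bn']] := block_start (maxn M N).
  exists n'; last exact: block_sum0.
  by rewrite leqNgt; apply/negP => /ltnW /c_nd; rewrite cn' leNgt cM.
apply/eqP; rewrite -normr_le0; apply/ler_addgt0Pr => eps eps0; rewrite add0r.
move/cvgrPdist_lt: hS => /(_ _ eps0)[N _ hN]; have [n Nn n0] := key N.
by have := hN n Nn; rewrite /= n0 subr0 => /ltW.
Qed.

End DiscreteUniqueness.

(** * The spectral measure of [A^* A] *)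

Section ExplicitSpectralMeasure.
Context {R : realType} {H : completeNormedModType R}.
Variable ip : {dot H for idfun}.
Hypothesis ip_norm : hilbert_inner ip.
Variables (A : {linear H -> H}) (a : nat -> R) (g : nat -> H) (C : R).
Hypothesis A_cont : continuous A.
Hypothesis A_skew : skew_adjoint ip A.
Hypothesis a_ge0 : forall k, 0 <= a k.
Hypothesis gA : skew_frame ip A a g.
Hypothesis a_sum : forall n, \sum_(k < n) a k ^+ 2 <= C.
Implicit Types (x y w : H) (z : R) (B : set R).

Let c k := a k ^+ 2.
Let gK : osys ip g (fun i => 0 < a i./2). Proof. by case: gA. Qed.
Local Notation T := (tT A).
Variable E : pvm ip.
Hypothesis TE : spectral_measure_of T E.

Lemma tT_add y w : T (y + w) = T y + T w.
Proof. by rewrite /tT !linearD. Qed.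

Lemma tT_g i : T (g i) = dbl a i *: g i.
Proof. by rewrite /tT (frame_sqr gA) opprK. Qed.

(** The component of [x] in the kernel of [A]. *)
Definition remainder x : H := x - phi ip g (fun=> 1) x.

Lemma tT_remainder x : T (remainder x) = 0.
Proof.
rewrite /tT; have -> : A (remainder x) = 0; last by rewrite linear0 oppr0.
apply: (frame_ker gA) => i; rewrite /remainder ipBl.
by rewrite (phi_coef ip_norm gK _ _ sbounded1) mul1r subrr.
Qed.

Lemma pvm_eigen B c' u : measurable B -> T u = c' *: u -> E B u = \1_B c' *: u.
Proof.
move=> mB /(eigen_range ip_norm tT_add (tT_sym A_skew) TE) <-.
have mc : measurable [set c'] by exact: measurable_set1.
rewrite -pvm_setI // indicE.
have [cB|cB] := boolP (c' \in B).
  by rewrite setIidr ?scale1r // => t ->; move: cB; rewrite inE.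
rewrite (_ : B `&` [set c'] = set0) ?pvm_set0 ?scale0r //.
by rewrite -subset0 => t [Dt /= tl]; move: cB; rewrite -tl => /negP; apply; rewrite inE.
Qed.

Lemma sbounded_indic B (f : nat -> R) : sbounded (fun i => \1_B (f i) : R).
Proof. by exists 1 => i; rewrite indicE; case: (_ \in _); rewrite ?normr1 ?normr0. Qed.

(** [E B] acts on each [g i] and on the kernel as a scalar, since these are
    eigenvectors of [T], and it is continuous. *)
Lemma pvm_explicit B x : measurable B ->
  E B x = phi ip g (fun i => \1_B (dbl a i)) x + \1_B 0 *: remainder x.
Proof.
move=> mB; rewrite -(pvm_eigen mB (c' := 0)) ?tT_remainder ?scale0r //.
suff -> : phi ip g (fun i => \1_B (dbl a i)) x = E B (phi ip g (fun=> 1) x).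
  by rewrite -(linearD (pvm_proj E B)) /remainder addrC subrK.
have h1 := pvm_cvg ip_norm mB (phi_cvg ip_norm gK (y := x) sbounded1) (E := E).
apply: (cvg_unique _ (phi_cvg ip_norm gK (y := x) (sbounded_indic B (dbl a)))) => //.
rewrite (_ : phi_part _ _ _ _ = fun n => E B (phi_part ip g (fun=> 1) x n)) //.
apply/funext => n; rewrite /phi_part (linear_sum (pvm_proj E B)); apply: eq_bigr => i _.
by rewrite (linearZ_LR (pvm_proj E B)) /= (pvm_eigen mB (tT_g i)) scalerA mul1r mulrC.
Qed.

(** The cyclic measure of [x] is the sum of the point masses [weight x n] at
    [atom n]; index zero is that of the kernel of [A]. *)
Definition atom n : R := if n is i.+1 then dbl a i else 0.
Definition weight x n : R := if n is i.+1 then ip x (g i) ^+ 2 else ip (remainder x) x.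

Lemma weight_ge0 x n : 0 <= weight x n.
Proof.
case: n => [|i] /=; last exact: sqr_ge0.
have h : `|x| ^+ 2 - \sum_(0 <= i < n) ip x (g i) ^+ 2 @[n --> \oo] -->
    ip (remainder x) x.
  rewrite /remainder ipBl ip_norm; apply: cvgB; first exact: cvg_cst.
  have h1 := phi_ip ip_norm gK (y := x) (z := x) sbounded1.
  rewrite (_ : (fun n => _) = fun n => \sum_(0 <= i < n) 1 * ip x (g i) * ip x (g i)) //.
  by apply/funext => n; apply: eq_bigr => i _; rewrite mul1r expr2.
apply: (cvgn_le (K := 0) (cvg_cst _) h) => n _.
by rewrite subr_ge0 (bessel ip_norm gK) ?iota_uniq.
Qed.

Lemma weight_series x (h : R -> R) : sbounded (fun i => h (dbl a i)) ->
  series (fun n => weight x n * h (atom n)) n @[n --> \oo] -->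
  ip (phi ip g (fun i => h (dbl a i)) x) x + ip (remainder x) x * h 0.
Proof.
move=> hb; rewrite -(cvg_shiftS (series _)).
rewrite (_ : (fun n => _) = fun n =>
  \sum_(0 <= i < n) h (dbl a i) * ip x (g i) * ip x (g i) + ip (remainder x) x * h 0).
  have h1 := phi_ip ip_norm gK (y := x) (z := x) hb.
  by apply: cvgD; [exact: h1 | exact: cvg_cst].
apply/funext => n; rewrite /series /= big_nat_recl // addrC; congr (_ + _).
by apply: eq_bigr => i _ /=; ring.
Qed.

Lemma eseries_EFin (u : nat -> R) (l : R) : series u n @[n --> \oo] --> l ->
  (\sum_(0 <= n <oo) (u n)%:E = l%:E)%E.
Proof.
move=> ul; apply: cvg_lim => //.
rewrite (_ : (fun n => _) = fun n => (series u n)%:E).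
  by apply: cvg_EFin => //; exact: nearW.
by apply/funext => n; rewrite sumEFin.
Qed.

(** The mass at zero is [|x|^2] minus the mass of the planes. Written with the
    differences [1_B (c k) - 1_B 0], the formula involves the planes and [|x|^2]
    only, which are what the moments control. *)
Lemma cyclic_sqform B x : measurable B ->
  \sum_(k < n) (\1_B (c k) - \1_B 0) * sqform ip g x k + \1_B 0 * ip x x @[n --> \oo] -->
  ip (E B x) x.
Proof.
move=> mB; rewrite (pvm_explicit x mB) ipDl ipZl /remainder ipBl.
have h1 := cvg_double (phi_ip ip_norm gK (y := x) (z := x) (sbounded_indic B (dbl a))).
have h2 := cvg_double (phi_ip ip_norm gK (y := x) (z := x) sbounded1).
have h3 : (fun n => \sum_(0 <= i < n.*2) \1_B (dbl a i) * ip x (g i) * ip x (g i) +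
    \1_B 0 * (ip x x - \sum_(0 <= i < n.*2) 1 * ip x (g i) * ip x (g i))) @ \oo -->
    ip (phi ip g (fun i => \1_B (dbl a i)) x) x +
      \1_B 0 * (ip x x - ip (phi ip g (fun=> 1) x) x).
  apply: cvgD; first exact: h1.
  by apply: cvgM; [exact: cvg_cst | apply: cvgB; [exact: cvg_cst | exact: h2]].
suff -> : (fun n => \sum_(k < n) (\1_B (c k) - \1_B 0) * sqform ip g x k +
    \1_B 0 * ip x x) = (fun n =>
  \sum_(0 <= i < n.*2) \1_B (dbl a i) * ip x (g i) * ip x (g i) +
  \1_B 0 * (ip x x - \sum_(0 <= i < n.*2) 1 * ip x (g i) * ip x (g i))) by [].
apply/funext => n; rewrite !sum_double mulrBr mulr_sumr.
rewrite [X in _ = _ + X]addrC addrA -sumrB; congr (_ + _); apply: eq_bigr => k _.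
by rewrite /dbl doubleK /= uphalf_double /sqform /c; ring.
Qed.

Lemma sbounded_inv z : 0 <= z -> sbounded (fun i => (1 + z * dbl a i)^-1).
Proof.
move=> z0; exists 1 => i; have h : 1 <= 1 + z * dbl a i.
  by rewrite lerDl mulr_ge0 // dbl_ge0.
have h0 : 0 < 1 + z * dbl a i by exact: lt_le_trans h.
by rewrite ger0_norm ?invr_ge0 ?(ltW h0) // invf_le1.
Qed.

Lemma resolvent_phi z x : 0 <= z ->
  ip (resolvent T z x) x =
  ip (phi ip g (fun i => (1 + z * dbl a i)^-1) x) x + ip (remainder x) x * (1 + z * 0)^-1.
Proof.
move=> z0; rewrite (resolventE ip_norm A_cont A_skew a_ge0 gA a_sum) // mulr0 addr0 invr1 mulr1.
rewrite /rinv /remainder !ipBl addrCA; congr (_ + _).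
have h1 := phi_ip ip_norm gK (y := x) (z := x) (sbounded_rcoef a_ge0 z0).
have h2 := phi_ip ip_norm gK (y := x) (z := x) sbounded1.
have h3 := phi_ip ip_norm gK (y := x) (z := x) (sbounded_inv z0).
have h4 : (fun n => - \sum_(0 <= i < n) rcoef a z i * ip x (g i) * ip x (g i)) @ \oo -->
    - ip (phi ip g (rcoef a z) x) x by exact: cvgN h1.
have h5 : (fun n => \sum_(0 <= i < n) (1 + z * dbl a i)^-1 * ip x (g i) * ip x (g i) -
    \sum_(0 <= i < n) 1 * ip x (g i) * ip x (g i)) @ \oo -->
    ip (phi ip g (fun i => (1 + z * dbl a i)^-1) x) x - ip (phi ip g (fun=> 1) x) x.
  exact: cvgB h3 h2.
apply: (cvg_unique _ h4) => //.
suff -> : (fun n => - \sum_(0 <= i < n) rcoef a z i * ip x (g i) * ip x (g i)) =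
  (fun n => \sum_(0 <= i < n) (1 + z * dbl a i)^-1 * ip x (g i) * ip x (g i) -
    \sum_(0 <= i < n) 1 * ip x (g i) * ip x (g i)) by [].
apply/funext => n; rewrite -sumrB /= -sumrN; apply: eq_bigr => i _.
have h0 : 1 + z * dbl a i != 0.
  by rewrite gt_eqF // ltr_pwDl // mulr_ge0 // dbl_ge0.
by rewrite /rcoef -/(dbl a i); field.
Qed.

(** The integral against a sum of point masses is a series, and the resolvent is
    diagonal along the same eigenvectors. *)
Lemma spectral_formula z x : 0 <= z ->
  \int[cyclic_measure E x]_(l in `[0, +oo[) (1 + z * l)^-1 = ip (resolvent T z x) x.
Proof.
move=> z0; rewrite /Rintegral.
have mD : measurable (`[0, +oo[ : set R)%classic by exact: measurable_itv.
pose mu n : {measure set R -> \bar R} := mscale (NngNum (weight_ge0 x n)) \d_(atom n).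
have muE B : measurable B -> cyclic_measure E x B = mseries mu 0 B.
  move=> mB; rewrite cyclicE // (pvm_explicit x mB) ipDl ipZl [X in _ + X]mulrC.
  have ws := weight_series (x := x) (h := \1_B) (sbounded_indic B (dbl a)).
  rewrite -(eseries_EFin ws) /mseries.
  by apply: eq_eseriesr => n _; rewrite /mu EFinM.
rewrite (eq_measure_integral (mseries mu 0)); last by move=> B mB _; exact: muE.
have mf : measurable_fun (`[0, +oo[ : set R)%classic (fun l : R => ((1 + z * l)^-1)%:E).
  apply/measurable_EFinP; apply: subspace_continuous_measurable_fun => //.
  apply: continuous_in_subspaceT => l; rewrite inE /= in_itv /= andbT => l0.
  apply: cvgV; first by rewrite gt_eqF // ltr_pwDl // mulr_ge0.
  by apply: cvgD; [exact: cvg_cst | apply: cvgM; [exact: cvg_cst | exact: cvg_id]].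
have f0 (l : R) : (`[0, +oo[ : set R)%classic l -> (0 <= ((1 + z * l)^-1)%:E)%E.
  by rewrite /= in_itv /= andbT => l0; rewrite lee_fin invr_ge0 addr_ge0 // mulr_ge0.
rewrite ge0_integral_measure_series //.
rewrite (eq_eseriesr (g := fun n => (weight x n * (1 + z * atom n)^-1)%:E)).
  rewrite (eseries_EFin (weight_series (x := x) (h := fun t => (1 + z * t)^-1) (sbounded_inv z0))).
  by rewrite /= -resolvent_phi.
move=> n _; rewrite /mu ge0_integral_mscale // integral_dirac // diracE mem_set ?mul1e //.
rewrite /= in_itv /= andbT; case: n => //= i; exact: dbl_ge0.
Qed.

End ExplicitSpectralMeasure.

(** * What the energies determine *)

Section Determination.
Context {R : realType} {H : completeNormedModType R}.
Variable ip : {dot H for idfun}.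
Hypothesis ip_norm : hilbert_inner ip.
Context {d : Order.disp_t} {J : orderType d}.
Variable e : J -> H.
Hypothesis e_basis : orthonormal_basis ip e.
Implicit Types (A : {linear H -> H}) (a : nat -> R) (x y w : H).

Lemma cvg_eqfun (f h : nat -> R) (l : R) : (forall n, h n = f n) ->
  f n @[n --> \oo] --> l -> h n @[n --> \oo] --> l.
Proof. by move=> fh; rewrite (_ : h = f) //; apply/funext. Qed.

Lemma even_energies_determine x x' A A' a a' :
  hilbert_schmidt ip A -> skew_adjoint ip A -> skew_singular_values ip A a ->
  hilbert_schmidt ip A' -> skew_adjoint ip A' -> skew_singular_values ip A' a' ->
  (forall N, energy ip e x' A' N.*2 = energy ip e x A N.*2) -> a' = a.
Proof.
move=> hs sk sv hs' sk' sv' E.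
have [a0 nd _] := sv; have [a'0 nd' _] := sv'.
have [g gA] := skew_frame_exists sv; have [g' gA'] := skew_frame_exists sv'.
have [C aC] := hs_sum ip_norm a0 hs sk gA.
have [C' aC'] := hs_sum ip_norm a'0 hs' sk' gA'.
apply/funext => k; apply/eqP; rewrite -(eqrXn2 (n := 2)) //; apply/eqP.
apply: (einf_inj (C := C') (C' := C) (c := fun k => a' k ^+ 2) (c' := fun k => a k ^+ 2)) => //.
- by move=> i; exact: sqr_ge0.
- by move=> i; exact: sqr_ge0.
- by move=> i; rewrite ler_sqr ?nnegrE // nd'.
- by move=> i; rewrite ler_sqr ?nnegrE // nd.
move=> m; have := E m.
rewrite (energy_even ip_norm e_basis hs'.1 a'0 gA' aC').
rewrite (energy_even ip_norm e_basis hs.1 a0 gA aC).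
by apply: mulfI; rewrite expf_neq0.
Qed.

Section SameSingularValues.
Variables (A A' : {linear H -> H}) (a : nat -> R) (g g' : nat -> H) (C : R).
Hypotheses (A_cont : continuous A) (A_skew : skew_adjoint ip A).
Hypotheses (A'_cont : continuous A') (A'_skew : skew_adjoint ip A').
Hypotheses (gA : skew_frame ip A a g) (gA' : skew_frame ip A' a g').
Hypothesis a_ge0 : forall k, 0 <= a k.
Hypothesis a_nd : forall i j, (i <= j)%N -> a j <= a i.
Hypothesis a_sum : forall n, \sum_(k < n) a k ^+ 2 <= C.
Variables (x x' : H).

Let c k := a k ^+ 2.

(** The coefficient of the highest moment in [oinf] of order [m] is [(-1)^m], so
    the energies determine the moments one after the other. *)
Lemma odd_energies_moments :
  (forall N, energy ip e x' A' N.*2.+1 = energy ip e x A N.*2.+1) ->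
  forall j, moment ip A' x' j = moment ip A x j.
Proof.
move=> E.
have O m : oinf ip A' a x' m = oinf ip A a x m.
  have := E m; rewrite (energy_odd ip_norm e_basis A'_cont A'_skew a_ge0 gA' a_sum).
  rewrite (energy_odd ip_norm e_basis A_cont A_skew a_ge0 gA a_sum).
  by apply: mulfI; rewrite expf_neq0.
move=> j; have [n] := ubnP j; elim: n j => // n IH j jn.
have := O j; rewrite /oinf !big_ord_recr /= subnn einf0 !mulr1.
under eq_bigr => i _ do rewrite IH ?(leq_trans (ltn_ord i)) //.
by move=> /addrI; apply: mulfI; rewrite signr_eq0.
Qed.

Lemma c_cvg0 : c n @[n --> \oo] --> (0 : R).
Proof.
apply: cvg_series_cvg_0; apply/cvg_ex; exists (einf c 1).
rewrite (_ : series c = fun n => \sum_(k < n) c k); last first.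
  by apply/funext => n; rewrite /series /= big_mkord.
by apply: (einf1_lim (C := C)) => // k; exact: sqr_ge0.
Qed.

Lemma sqform_ge0 (f : nat -> H) y k : 0 <= sqform ip f y k.
Proof. by rewrite addr_ge0 ?sqr_ge0. Qed.

Lemma sqform_sum (B : {linear H -> H}) (f : nat -> H) y n : skew_frame ip B a f ->
  \sum_(k < n) sqform ip f y k <= `|y| ^+ 2.
Proof.
move=> [fK _ _ _]; rewrite (_ : \sum_(k < n) _ = \sum_(0 <= i < n.*2) ip y (f i) ^+ 2).
  by rewrite (bessel ip_norm fK) ?iota_uniq.
by rewrite sum_double; apply: eq_bigr => k _; rewrite addrC.
Qed.

Lemma sqform0 (B : {linear H -> H}) (f : nat -> H) y k : skew_frame ip B a f ->
  a k = 0 -> sqform ip f y k = 0.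
Proof.
move=> [fK _ _ _] ak; rewrite /sqform !(osys0 ip_norm fK) /= ?uphalf_double ?doubleK ?ak ?ltxx //.
by rewrite !linear0r expr0n addr0.
Qed.

(** Both cyclic measures live on the values [a_k^2] and zero. The difference of
    their weights has vanishing moments of positive order, so
    [discrete_unique] applies; the moment of order zero settles the mass at
    zero. *)
Lemma moments_determine (E E' : pvm ip) (B : set R) :
  spectral_measure_of (tT A) E -> spectral_measure_of (tT A') E' -> measurable B ->
  (forall j, moment ip A' x' j = moment ip A x j) ->
  ip (E' B x') x' = ip (E B x) x.
Proof.
move=> TE TE' mB M.
have h := cyclic_sqform ip_norm A_skew gA TE (x:=x) mB.
have h' := cyclic_sqform ip_norm A'_skew gA' TE' (x:=x') mB.
have xx : ip x' x' = ip x x by exact: (M 0%N).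
apply/eqP; rewrite -subr_eq0; apply/eqP.
apply: (@discrete_unique _ c (fun k => sqform ip g' x' k - sqform ip g x k)
  (`|x'| ^+ 2 + `|x| ^+ 2) _ _ _ _ _ _ (fun t => \1_B t - \1_B 0)) => //.
- by move=> k; exact: sqr_ge0.
- by move=> i j ij; rewrite ler_sqr ?nnegrE // a_nd.
- exact: c_cvg0.
- move=> n; rewrite big_mkord.
  apply: (@le_trans _ _ (\sum_(k < n) (sqform ip g' x' k + sqform ip g x k))).
    apply: ler_sum => k _; apply: le_trans (ler_normB _ _) _.
    by rewrite !ger0_norm ?sqform_ge0.
  by rewrite big_split lerD ?(sqform_sum _ _ gA) ?(sqform_sum _ _ gA').
- move=> k /eqP; rewrite sqrf_eq0 => /eqP ak.
  by rewrite (sqform0 _ gA) // (sqform0 _ gA') // subrr.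
- move=> j j0.
  have m1 := moment_cvg ip_norm A_cont A_skew gA (x:=x) j0.
  have m2 := moment_cvg ip_norm A'_cont A'_skew gA' (x:=x') j0.
  have m3 := cvgB m2 m1; rewrite M subrr in m3. apply: (cvg_eqfun _ (m3 _)) => n; rewrite /= big_mkord -sumrB.
  by apply: eq_bigr => k _; rewrite mulrBr.
apply: (cvg_eqfun _ (cvgB h' h)) => n; rewrite /= big_mkord xx opprD addrACA subrr addr0 -sumrB.
by apply: eq_bigr => k _; rewrite mulrBr.
Qed.

(** The moments of [w + y] depend on an eigenvector [y] orthogonal to [w] through
    its norm only. *)
Lemma eigenvector_moment l y w j : tT A y = l *: y -> ip w y = 0 ->
  moment ip A (w + y) j = moment ip A w j + l ^+ j * `|y| ^+ 2.
Proof.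
move=> Ty wy.
have iterE : iter j (tT A) (w + y) = iter j (tT A) w + l ^+ j *: y.
  elim: j => [|j IH]; first by rewrite scale1r.
  rewrite !iterS IH tT_add; congr (_ + _).
  by rewrite {1}/tT !linearZ_LR -[X in _ *: X = _]/(tT A y) Ty scalerA -exprSr.
have iwy i : ip (iter i (tT A) w) y = 0.
  by elim: i => //= i IH; rewrite (tT_sym A_skew) Ty ipZr IH mulr0.
rewrite /moment iterE ipDl !ipDr !ipZl iwy (ipC _ y w) wy -ip_norm.
by rewrite mulr0 addr0 add0r.
Qed.

End SameSingularValues.
End Determination.

(** * Directions inside a spectral subspace *)

Section Directions.
Context {R : realType} {H : completeNormedModType R}.
Variable ip : {dot H for idfun}.
Hypothesis ip_norm : hilbert_inner ip.
Context {d : Order.disp_t} {J : orderType d}.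
Variable e : J -> H.
Hypothesis e_basis : orthonormal_basis ip e.
Variables (A : {linear H -> H}) (a : nat -> R) (g : nat -> H) (C : R).
Hypothesis A_cont : continuous A.
Hypothesis A_skew : skew_adjoint ip A.
Hypothesis a_ge0 : forall k, 0 <= a k.
Hypothesis gA : skew_frame ip A a g.
Hypothesis a_sum : forall n, \sum_(k < n) a k ^+ 2 <= C.

(** The energies depend on the vector through its moments, and the range of
    [E {l}] consists of eigenvectors of [A^* A]. *)
Lemma energy_direction (E : pvm ip) l w y y' k :
  spectral_measure_of (tT A) E ->
  E [set l] w = 0 -> E [set l] y = y -> E [set l] y' = y' -> `|y| = `|y'| ->
  energy ip e (w + y) A k = energy ip e (w + y') A k.
Proof.
move=> TE Ew Ey Ey' yy'; have ml : measurable [set l] by exact: measurable_set1.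
have orth u : E [set l] u = u -> ip w u = 0.
  by move=> <-; rewrite -(pvm_sym E) // Ew ip0l.
have eig u : E [set l] u = u -> tT A u = l *: u.
  exact: (spectral_range_scalar ip_norm (tT_add A) (tT_sym A_skew) TE).
have mE j : moment ip A (w + y) j = moment ip A (w + y') j.
  rewrite (eigenvector_moment ip_norm A_skew _ (eig _ Ey) (orth _ Ey)).
  by rewrite (eigenvector_moment ip_norm A_skew _ (eig _ Ey') (orth _ Ey')) yy'.
rewrite -(odd_double_half k); case: (odd k); rewrite ?add0n ?add1n.
  rewrite !(energy_odd ip_norm e_basis A_cont A_skew a_ge0 gA a_sum) /oinf.
  by congr (_ * _); apply: eq_bigr => j _; rewrite mE.
by rewrite !(energy_even ip_norm e_basis A_cont a_ge0 gA a_sum).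
Qed.

End Directions.

Theorem theorem9p4 (R : realType) (H : completeNormedModType R)
    (ip : {dot H for idfun}) (ip_norm : hilbert_inner ip)
    (H_separable : separable (H := H))
    (d : Order.disp_t) (J : orderType d) (e : J -> H)
    (e_basis : orthonormal_basis ip e)
    (x : H) (A : {linear H -> H})
    (A_HS : hilbert_schmidt ip A) (A_skew : skew_adjoint ip A)
    (a : nat -> R) (A_sv : skew_singular_values ip A a) :
  let AA := fun y => adjoint ip A (A y) in
  let D := skew_det a in
  let even := fun N => energy ip e x A N.*2 in
  let odd := fun N => energy ip e x A N.*2.+1 in
  (* well-definedness of the objects involved *)
  [/\ in_fock (response ip e x A), in_fock (fock_alpha ip e A),
      forall z : R[i]^o, cvgn (skew_det_partial a z) &
      forall z : R, 0 < z -> bijective (fun y => y + z *: AA y)] /\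
  (* the even energies and the Fredholm determinant *)
  (forall z : R[i]^o,
      energy_series even z @ \oo --> D z /\
      is_fredholm_det ip e AA z (D z ^+ 2)) /\
  (* the even energies determine the skew singular values *)
  (forall (x' : H) (A' : {linear H -> H}) (a' : nat -> R),
      hilbert_schmidt ip A' -> skew_adjoint ip A' ->
      skew_singular_values ip A' a' ->
      (forall N, energy ip e x' A' N.*2 = even N) -> a' = a) /\
  (* the odd energies *)
  (forall z : R, 0 < z ->
      energy_series odd z%:C @ \oo --> D z%:C * (ip (resolvent AA z x) x)%:C) /\
  (* the total energy *)
  (fock_norm (response ip e x A) ^+ 2)%:C
    = D 4 * (1 + ip (resolvent AA 4 x) x)%:C /\
  [/\ D 4 <= (expR (4 * fock_norm (fock_alpha ip e A) ^+ 2))%:C,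
      forall y, ip (resolvent AA 4 y) y <= ip y y &
      fock_norm (response ip e x A) ^+ 2 <=
        (1 + `|x| ^+ 2) * expR (4 * fock_norm (fock_alpha ip e A) ^+ 2)] /\
  (forall E : pvm ip, spectral_measure_of AA E ->
      (* the spectral formula *)
      (forall z : R, 0 < z ->
         limn (energy_series odd z%:C) / D z%:C =
           (\int[cyclic_measure E x]_(l in `[0, +oo[) (1 + z * l)^-1)%:C) /\
      (* all energies determine the cyclic spectral measure, that is, the
         energy of x in every spectral subspace *)
      (forall (x' : H) (A' : {linear H -> H}) (a' : nat -> R) (E' : pvm ip),
         hilbert_schmidt ip A' -> skew_adjoint ip A' ->
         skew_singular_values ip A' a' ->
         spectral_measure_of (fun y => adjoint ip A' (A' y)) E' ->
         (forall N, energy ip e x' A' N.*2 = even N) ->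
         (forall N, energy ip e x' A' N.*2.+1 = odd N) ->
         forall B : set R, measurable B -> B `<=` `[0, +oo[ ->
           cyclic_measure E' x' B = cyclic_measure E x B /\
           `|E' B x'| ^+ 2 = `|E B x| ^+ 2) /\
      (* directions inside a spectral subspace are not seen by the energies *)
      (forall (l : R) (w y y' : H),
         E [set l] w = 0 -> E [set l] y = y -> E [set l] y' = y' ->
         `|y| = `|y'| ->
         forall k, energy ip e (w + y) A k = energy ip e (w + y') A k)).
Proof.
have A_cont : continuous A := A_HS.1.
have [a_ge0 a_nd _] := A_sv.
have [g gA] := skew_frame_exists A_sv.
have [C a_sum] := hs_sum ip_norm a_ge0 A_HS A_skew gA.
have [r rE totE] := fock_norm2_response_total ip_norm e_basis A_cont A_skew a_ge0 gA a_sum x.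
have alphaE := normlim_alpha ip_norm e_basis A_cont a_ge0 gA a_sum.
have r4 : skew_det a (4 : R)%:C = r%:C by rewrite -rE rmorph_nat.
have r_ge1 := skew_det_ge1 a_sum (ler0n R 4) r4.
have r_le := skew_det_le_exp a_sum (ler0n R 4) r4.
rewrite -(fock_norm_sqr alphaE) in r_le.
have normE : fock_norm (response ip e x A) ^+ 2 =
    r * (1 + ip (resolvent (tT A) 4 x) x).
  rewrite /fock_norm totE /= sqr_sqrtr // -lee_fin -totE.
  by apply: esum_ge0 => S _; rewrite lee_fin sqr_ge0.
have res_le y : ip (resolvent (tT A) 4 y) y <= ip y y.
  exact: (resolvent_le ip_norm A_cont A_skew a_ge0 gA a_sum _ (ler0n R 4)).
rewrite (adjoint_compE ip_norm A_skew) /=.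
split; first split.
- by rewrite /in_fock totE ltry.
- by rewrite /in_fock (fock_norm2_lim alphaE) ltry.
- move=> z; apply/cvg_ex; exists (skew_det a z).
  exact: (skew_det_cvg a_sum z).1.
- by move=> z /ltW z0; exact: (one_zT_bij ip_norm A_cont A_skew a_ge0 gA a_sum).
split.
  move=> z; split.
    exact: (energy_series_even ip_norm e_basis A_cont a_ge0 gA a_sum).
  exact: (fredholm_det ip_norm e_basis A_cont A_skew a_ge0 gA a_sum).
split.
  move=> x' A' a' hs' sk' sv'.
  exact: (even_energies_determine ip_norm e_basis A_HS A_skew A_sv hs' sk' sv').
split.
  move=> z /ltW z0.
  exact: (energy_series_odd ip_norm e_basis A_cont A_skew a_ge0 gA a_sum).
split; first by rewrite normE rE -rmorphM.
split.
  split; first by rewrite rE lecR.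
  - exact: res_le.
  rewrite normE mulrC; apply: (@le_trans _ _ ((1 + `|x| ^+ 2) * r)).
    by rewrite ler_wpM2r ?(le_trans ler01) // lerD2l -ip_norm.
  by rewrite ler_wpM2l // addr_ge0 ?exprn_ge0.
move=> E TE; split; last split.
- move=> z z0; have z0' := ltW z0.
  have [rz rzE _] := skew_det_real a_sum z.
  have rz1 := skew_det_ge1 a_sum z0' rzE.
  rewrite (spectral_formula ip_norm A_cont A_skew a_ge0 gA a_sum TE x z0').
  rewrite (cvg_lim _ (energy_series_odd ip_norm e_basis A_cont A_skew a_ge0 gA a_sum z0')) //.
  rewrite mulrC mulKf // rzE; apply/eqP => /complexI r0.
  by move: rz1; rewrite r0 ler10.
- move=> x' A' a' E' hs' sk' sv' TE' ev od B mB _.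
  have aa : a' = a.
    exact: (even_energies_determine ip_norm e_basis A_HS A_skew A_sv hs' sk' sv' ev).
  rewrite aa in sv'; have [g' gA'] := skew_frame_exists sv'.
  rewrite (adjoint_compE ip_norm sk') in TE'.
  have mE := odd_energies_moments ip_norm e_basis A_cont A_skew hs'.1 sk' gA gA' a_ge0 a_sum od.
  have EE := moments_determine ip_norm A_cont A_skew hs'.1 sk' gA gA' a_ge0 a_nd a_sum
    TE TE' mB mE.
  by rewrite !cyclicE // !(pvm_norm ip_norm) // EE.
- move=> l w y y' Ew Ey Ey' yy' k.
  exact: (energy_direction ip_norm e_basis A_cont A_skew a_ge0 gA a_sum k TE Ew Ey Ey' yy').
Qed.
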